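(* Let $\mathcal F$ be a Frobenius category, $l\in\mathbb N$, and $s,t\in\{0,\dots,l\}$ with $s\le t$ and $t-s<l$. There is the following chain of functors between $\mathcal M_l$ and $\mathcal M_{l-t+s-1}$, infinite in both directions, in which each functor is left adjoint to the next one (written $\dashv$): $$\cdots\dashv\Theta^{t-s+1}\underline{\hat\gamma}^{[0,l-t+s-1]^c}$$ $$\dashv\underline\delta^{[0,l-t+s-1]^c}\Theta^{-t+s-1}\dashv\cdots\dashv\Theta\,\underline{\hat\gamma}^{[t-s,l-1]^c}\dashv\underline\delta^{[t-s,l-1]^c}\Theta^{-1}\dashv\underline{\hat\gamma}^{[t-s+1,l]^c}\dashv\underline\delta^{[t-s+1,l]^c}$$ $$\dashv\underline\gamma^{[0,t-s]}\dashv\cdots\dashv\underline\gamma^{[s-1,t-1]}\dashv\underline\delta^{[s-1,t]}\dashv\underline\gamma^{[s,t]}\dashv\underline\delta^{[s,t+1]}\dashv\underline\gamma^{[s+1,t+1]}\dashv\cdots\dashv\underline\gamma^{[l-t+s,l]}$$ $$\dashv\underline\delta^{[0,l-t+s-1]^c}\dashv\underline{\check\gamma}^{[0,l-t+s-1]^c}\dashv\underline\delta^{[1,l-t+s]^c}\Theta\dashv\Theta^{-1}\underline{\check\gamma}^{[1,l-t+s]^c}\dashv\cdots\dashv\underline\delta^{[t-s+1,l]^c}\Theta^{t-s+1}$$ $$\dashv\Theta^{-t+s-1}\underline{\check\gamma}^{[t-s+1,l]^c}\dashv\cdots,$$ where $\underline{\hat\gamma}^{[0,l-t+s-1]^c}=\underline\gamma^{[l-t+s,l]}$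 and $\underline{\check\gamma}^{[t-s+1,l]^c}=\underline\gamma^{[0,t-s]}$. Explicitly, with $m=t-s$ and $n=l-m-1$: the second line (starting from the last functor of the first line) runs through $\Theta^{j}\underline{\hat\gamma}^{[m+1-j,l-j]^c}\dashv\underline\delta^{[m+1-j,l-j]^c}\Theta^{-j}$ for $j=m+1,m,\dots,0$; the third line runs through $\underline\gamma^{[k,k+m]}\dashv\underline\delta^{[k,k+m+1]}\dashv\underline\gamma^{[k+1,k+m+1]}$ for $k=0,\dots,n$; the fourth line (up to the first functor of the fifth) runs through $\underline\delta^{[k,k+n]^c}\Theta^{k}\dashv\Theta^{-k}\underline{\check\gamma}^{[k,k+n]^c}$ for $k=0,\dots,m+1$. Beyond the displayed part the chain continues to the right after $\Theta^{-m-1}\underline{\check\gamma}^{[m+1,l]^c}=\Theta^{-m-1}\underline\gamma^{[0,m]}$ and to the left before $\Theta^{m+1}\underline{\hat\gamma}^{[0,n]^c}=\Theta^{m+1}\underline\gamma^{[l-m,l]}$ by repeating the displayed pattern, with the functors $\mathcal M_n\to\mathcal M_l$ precomposed with, and the functors $\mathcal M_l\to\mathcal M_n$ postcomposed with, the corresponding powers of $\Theta^{\pm(m+1)}$.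
   Context: A Frobenius category $\mathcal F$ is an exact category with enough projectives and enough injectives in which projective and injective objects coincide; its stable category is triangulated. $\mathbb N$ contains $0$. For $l\in\mathbb N$, $\mathrm{Mor}^{\mathrm m}_l(\mathcal F)$ is the category of chains $X=(X,\alpha)\colon X^0\xrightarrow{\alpha^0}\cdots\xrightarrow{\alpha^{l-1}}X^l$ of $l$ admissible monomorphisms in $\mathcal F$, with commutative ladders as morphisms; with the termwise exact structure it is a Frobenius category whose projective-injectives are the chains of admissible monomorphisms with all terms projective. $\mathcal M_l$ is its stable category. For each $A\in\mathcal F$ fix an admissible monic $i_A\colon A\to I(A)$ with $I(A)$ injective and an admissible epic $p_A\colon P(A)\to A$ with $P(A)$ projective (identities if $A$ is projective-injective). Let $0\le a\le b\le l$. All of the following are triangulated functors on stable categories; on morphisms they are induced in the evident way by morphisms of chains (choosing extensions between the $I(-)$, respectively lifts between the $P(-)$, where needed; the result is well defined in the stable category). - $\underline\gamma^{[a,b]}\colon\mathcal M_l\to\mathcal M_{l-b+a-1}$ (for $b-a<l$): delete the terms $X^a,\dots,X^b$ and compose the morphisms around them. - $\underline\delta^{[a,b]}\colon\mathcal M_{l-b+a}\to\mathcal M_l$: repeat the term $X^a$, with identity morphisms, at positions $a,\dots,b$, giving $X^0\to\cdots\to X^a=\cdots=X^a\to X^{a+1}\to\cdots\to X^{l-b+a}$. - $\underline\delta^{[a,b]^c}\colon\mathcal M_{b-a}\to\mathcal M_l$: send $X$ to $0=\cdots=0\to X^0\to\cdots\to X^{b-a}\xrightarrow{i_{X^{b-a}}}I(X^{b-a})=\cdots=I(X^{b-a})$,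 with $X^0$ placed at position $a$ and $X^{b-a}$ at position $b$. - $\underline{\hat\gamma}^{[a,b]^c}\colon\mathcal M_l\to\mathcal M_{b-a}$: for $a>0$, send $X$ to the chain $Y$ with $Y^{k-a}$ the cokernel of the composed monic $X^{a-1}\to X^k$, $k=a,\dots,b$, and induced morphisms; for $a=0$, $\underline{\hat\gamma}^{[0,b]^c}=\underline\gamma^{[b+1,l]}$ (the identity if $b=l$). - $\underline{\check\gamma}^{[a,b]^c}\colon\mathcal M_l\to\mathcal M_{b-a}$: for $b<l$, send $X$ to the chain $Y$ with $Y^{k-a}$ the pullback of $X^k\to X^{b+1}\xleftarrow{p_{X^{b+1}}}P(X^{b+1})$, $k=a,\dots,b$, and induced morphisms; for $b=l$, $\underline{\check\gamma}^{[a,l]^c}=\underline\gamma^{[0,a-1]}$ (the identity if $a=0$). - $\Theta\colon\mathcal M_n\to\mathcal M_n$ (for any $n\in\mathbb N$): the auto-equivalence sending $X$ to the chain $Y$ with $Y^k$ the cokernel of the composed monic $X^0\to X^{k+1}$ for $0\le k<n$ and $Y^n$ the cokernel of the composed monic $X^0\to X^n\xrightarrow{i_{X^n}}I(X^n)$, with induced morphisms. $\Theta^{-1}$ is its quasi-inverse, sending $Y$ to the chain $X$ where $X^0$ is the kernel of $p_{Y^n}\colon P(Y^n)\to Y^n$ and $X^{k+1}$ is the pullback of $Y^k\to Y^n\xleftarrow{p_{Y^n}}P(Y^n)$ for $0\le k<n$. Negative powers of $\Theta$ are powers of $\Theta^{-1}$. *)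

(* Defs.v *)
(* MathComp, with the classical axioms of mathcomp.classical.boolp *)
From HB Require Import structures.
From mathcomp Require Import all_boot all_algebra zify.
From mathcomp Require Import boolp.

Set Implicit Arguments.
Unset Strict Implicit.
Unset Printing Implicit Defensive.

Import GRing.Theory.
Local Open Scope ring_scope.
Local Open Scope quotient_scope.

Local Obligation Tactic := idtac.

(* The choice structure carried by the zmodType of morphisms is no restriction
   in the presence of the classical axioms. *)
Record precat := Precat {
  ob :> Type;
  hom : ob -> ob -> zmodType;
  idm : forall A, hom A A;
  mcomp : forall A B D, hom B D -> hom A B -> hom A D;
  comp1m : forall A B (f : hom A B), mcomp (idm B) f = f;
  compm1 : forall A B (f : hom A B), mcomp f (idm A) = f;
  compA : forall A B D E (h : hom D E) (g : hom B D) (f : hom A B),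
    mcomp h (mcomp g f) = mcomp (mcomp h g) f;
  compDl : forall A B D (g g' : hom B D) (f : hom A B),
    mcomp (g + g') f = mcomp g f + mcomp g' f;
  compDr : forall A B D (g : hom B D) (f f' : hom A B),
    mcomp g (f + f') = mcomp g f + mcomp g f' }.

Arguments idm {p} A.
Notation "g ∘ f" := (mcomp g f) (at level 40, left associativity).

Section Precat.
Variable C : precat.
Implicit Types A B D : C.

Lemma comp0m A B D (f : hom A B) : (0 : hom B D) ∘ f = 0.
Proof. by apply: (addrI ((0 : hom B D) ∘ f)); rewrite -compDl !addr0. Qed.

Lemma compm0 A B D (f : hom B D) : f ∘ (0 : hom A B) = 0.
Proof. by apply: (addrI (f ∘ (0 : hom A B))); rewrite -compDr !addr0. Qed.

Lemma compNl A B D (g : hom B D) (f : hom A B) : (- g) ∘ f = - (g ∘ f).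
Proof. by apply: (addrI (g ∘ f)); rewrite -compDl !subrr comp0m. Qed.

Lemma compNr A B D (g : hom B D) (f : hom A B) : g ∘ (- f) = - (g ∘ f).
Proof. by apply: (addrI (g ∘ f)); rewrite -compDr !subrr compm0. Qed.

Lemma compBl A B D (g g' : hom B D) (f : hom A B) :
  (g - g') ∘ f = g ∘ f - g' ∘ f.
Proof. by rewrite compDl compNl. Qed.

Lemma compBr A B D (g : hom B D) (f f' : hom A B) :
  g ∘ (f - f') = g ∘ f - g ∘ f'.
Proof. by rewrite compDr compNr. Qed.

Definition is_iso A B (f : hom A B) : Prop :=
  exists2 g : hom B A, g ∘ f = idm A & f ∘ g = idm B.

Definition is_kernel A B D (i : hom A B) (p : hom B D) : Prop :=
  p ∘ i = 0 /\
  forall T (f : hom T B), p ∘ f = 0 -> exists! g : hom T A, i ∘ g = f.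

Definition is_cokernel A B D (i : hom A B) (p : hom B D) : Prop :=
  p ∘ i = 0 /\
  forall T (f : hom B T), f ∘ i = 0 -> exists! g : hom D T, g ∘ p = f.

Definition is_pushout A B A' B' (i : hom A B) (f : hom A A')
    (g : hom B B') (j : hom A' B') : Prop :=
  g ∘ i = j ∘ f /\
  forall T (u : hom B T) (v : hom A' T), u ∘ i = v ∘ f ->
    exists! w : hom B' T, w ∘ g = u /\ w ∘ j = v.

Definition is_pullback A B D K (f : hom A D) (p : hom B D)
    (q1 : hom K A) (q2 : hom K B) : Prop :=
  f ∘ q1 = p ∘ q2 /\
  forall T (u : hom T A) (v : hom T B), f ∘ u = p ∘ v ->
    exists! w : hom T K, q1 ∘ w = u /\ q2 ∘ w = v.

End Precat.

Record functor (C D : precat) := Functor {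
  fob :> C -> D;
  fmap : forall A B, hom A B -> hom (fob A) (fob B);
  fmap1 : forall A, fmap (idm A) = idm (fob A);
  fmapM : forall A B E (g : hom B E) (f : hom A B),
    fmap (g ∘ f) = fmap g ∘ fmap f;
  fmapB : forall A B (f g : hom A B), fmap (f - g) = fmap f - fmap g }.

Program Definition idF (C : precat) : functor C C :=
  @Functor C C id (fun _ _ f => f) _ _ _.
Solve All Obligations with by [].

Program Definition compF (C D E : precat) (G : functor D E) (F : functor C D) :
  functor C E := @Functor C E (fun A => G (F A)) (fun _ _ f => fmap G (fmap F f)) _ _ _.
Next Obligation. by move=> * /=; rewrite !fmap1. Qed.
Next Obligation. by move=> * /=; rewrite !fmapM. Qed.
Next Obligation. by move=> * /=; rewrite !fmapB. Qed.

Notation "G ⊙ F" := (compF G F) (at level 40, left associativity).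

Definition adjoint (C D : precat) (F : functor C D) (G : functor D C) : Prop :=
  exists phi : forall (A : C) (B : D), hom (F A) B -> hom A (G B),
    [/\ forall A B, bijective (phi A B),
        forall A A' B (f : hom A' A) (g : hom (F A) B),
          phi A' B (g ∘ fmap F f) = phi A B g ∘ f
      & forall A B B' (h : hom B B') (g : hom (F A) B),
          phi A B' (h ∘ g) = fmap G h ∘ phi A B g].

Notation "F ⊣ G" := (adjoint F G) (at level 70, no associativity).

Record addcat := Addcat {
  acat :> precat;
  zob : acat;
  zob_init : forall A (f : hom zob A), f = 0;
  zob_term : forall A (f : hom A zob), f = 0;
  bip : acat -> acat -> acat;
  in1 : forall A B, hom A (bip A B);
  in2 : forall A B, hom B (bip A B);
  pr1 : forall A B, hom (bip A B) A;
  pr2 : forall A B, hom (bip A B) B;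
  pr1in1 : forall A B, pr1 A B ∘ in1 A B = idm A;
  pr2in2 : forall A B, pr2 A B ∘ in2 A B = idm B;
  pr1in2 : forall A B, pr1 A B ∘ in2 A B = 0;
  pr2in1 : forall A B, pr2 A B ∘ in1 A B = 0;
  bipE : forall A B, in1 A B ∘ pr1 A B + in2 A B ∘ pr2 A B = idm (bip A B) }.

(* [is_exact] below has to hold for [conf] to be an exact structure. *)
Record confcat := Confcat {
  ccat :> addcat;
  conf : forall A B D : ccat, hom A B -> hom B D -> Prop }.

Section Confcat.
Variable C : confcat.
Implicit Types A B D : C.

Definition inflation A B (i : hom A B) : Prop :=
  exists D (p : hom B D), conf i p.

Definition deflation B D (p : hom B D) : Prop :=
  exists A (i : hom A B), conf i p.

Definition projective P : Prop :=
  forall B D (p : hom B D) (f : hom P D), deflation p ->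
    exists g : hom P B, p ∘ g = f.

Definition injective_ob I : Prop :=
  forall A B (i : hom A B) (f : hom A I), inflation i ->
    exists g : hom B I, g ∘ i = f.

(* Quillen's axioms, in Buehler's formulation *)
Record is_exact : Prop := IsExact {
  conf_ker : forall A B D (i : hom A B) (p : hom B D), conf i p -> is_kernel i p;
  conf_coker : forall A B D (i : hom A B) (p : hom B D),
    conf i p -> is_cokernel i p;
  conf_iso : forall A B D A' B' D' (i : hom A B) (p : hom B D)
    (i' : hom A' B') (p' : hom B' D')
    (a : hom A A') (b : hom B B') (d : hom D D'),
    is_iso a -> is_iso b -> is_iso d ->
    b ∘ i = i' ∘ a -> d ∘ p = p' ∘ b -> conf i p -> conf i' p';
  infl_id : forall A, inflation (idm A);
  defl_id : forall A, deflation (idm A);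
  infl_comp : forall A B D (j : hom B D) (i : hom A B),
    inflation i -> inflation j -> inflation (j ∘ i);
  defl_comp : forall A B D (q : hom B D) (p : hom A B),
    deflation p -> deflation q -> deflation (q ∘ p);
  infl_pushout : forall A B A' (i : hom A B) (f : hom A A'), inflation i ->
    exists B' (g : hom B B') (j : hom A' B'),
      is_pushout i f g j /\ inflation j;
  defl_pullback : forall A B D (f : hom A D) (p : hom B D), deflation p ->
    exists K (q1 : hom K A) (q2 : hom K B),
      is_pullback f p q1 q2 /\ deflation q1 }.

End Confcat.

Record frobenius := Frobenius {
  fcat :> confcat;
  frob_exact : is_exact fcat;
  enough_proj : forall A : fcat,
    exists P (p : hom P A), projective P /\ deflation p;
  enough_inj : forall A : fcat,
    exists I (i : hom A I), injective_ob I /\ inflation i;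
  proj_inj : forall P : fcat, projective P <-> injective_ob P }.

Section Stable.
Variable C : confcat.

Definition factors_proj (A B : C) (f : hom A B) : Prop :=
  exists P (u : hom A P) (v : hom P B), projective P /\ f = v ∘ u.

Definition stably_null (A B : C) (f : hom A B) : bool := `[< factors_proj f >].

Lemma projective_bip (P Q : C) :
  projective P -> projective Q -> projective (bip P Q).
Proof.
move=> hP hQ B D p f dp.
have [g gE] := hP _ _ p (f ∘ in1 P Q) dp.
have [h hE] := hQ _ _ p (f ∘ in2 P Q) dp.
exists (g ∘ pr1 P Q + h ∘ pr2 P Q).
by rewrite compDr !compA gE hE -!compA -compDr bipE compm1.
Qed.

Lemma projective_zob : projective (zob C).
Proof. by move=> B D p f _; exists 0; rewrite compm0 (zob_init f). Qed.

Lemma stably_null_zmod (A B : C) : zmod_closed (@stably_null A B).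
Proof.
split=> [|f g /asboolP[P [u [v [hP ->]]]] /asboolP[Q [x [y [hQ ->]]]]].
  apply/asboolP; exists (zob C), 0, 0; split; first exact: projective_zob.
  by rewrite comp0m.
apply/asboolP; exists (bip P Q), (in1 P Q ∘ u + in2 P Q ∘ x).
exists (v ∘ pr1 P Q - y ∘ pr2 P Q); split; first exact: projective_bip.
rewrite compBl !compDr -!compA ![pr1 _ _ ∘ (_ ∘ _)]compA.
rewrite ![pr2 _ _ ∘ (_ ∘ _)]compA pr1in1 pr1in2 pr2in1 pr2in2.
by rewrite !comp0m !comp1m !compm0 addr0 add0r.
Qed.

HB.instance Definition _ A B :=
  GRing.isZmodClosed.Build (hom A B) (@stably_null A B) (stably_null_zmod A B).

Definition shom (A B : C) : zmodType :=
  Quotient.quot (GRing.ZmodClosed.clone (hom A B) (@stably_null A B) _).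

Definition spi (A B : C) (f : hom A B) : shom A B := \pi f.

Lemma spi_eq (A B : C) (f g : hom A B) :
  spi f = spi g <-> factors_proj (f - g).
Proof.
rewrite /spi; split=> [/eqP|h]; last apply/eqP.
  by rewrite -Quotient.idealrBE => /asboolP.
by rewrite -Quotient.idealrBE; apply/asboolP.
Qed.

Lemma spiB (A B : C) (f g : hom A B) : spi (f - g) = spi f - spi g.
Proof. exact: raddfB. Qed.

Lemma spiD (A B : C) (f g : hom A B) : spi (f + g) = spi f + spi g.
Proof. exact: raddfD. Qed.

Lemma srepr (A B : C) (x : shom A B) : exists f, x = spi f.
Proof. by exists (repr x); rewrite /spi reprK. Qed.

Lemma factors_compl (A B D : C) (g : hom B D) (f : hom A B) :
  factors_proj f -> factors_proj (g ∘ f).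
Proof.
by move=> [P [u [v [hP ->]]]]; exists P, u, (g ∘ v); rewrite compA.
Qed.

Lemma factors_compr (A B D : C) (g : hom B D) (f : hom A B) :
  factors_proj g -> factors_proj (g ∘ f).
Proof.
by move=> [P [u [v [hP ->]]]]; exists P, (u ∘ f), v; rewrite compA.
Qed.

Definition scomp (A B D : C) (g : shom B D) (f : shom A B) : shom A D :=
  spi (repr g ∘ repr f).

Lemma scompE (A B D : C) (g : hom B D) (f : hom A B) :
  scomp (spi g) (spi f) = spi (g ∘ f).
Proof.
have e (X Y : C) (h : hom X Y) : factors_proj (repr (spi h) - h).
  by apply/spi_eq; rewrite {1}/spi reprK.
rewrite /scomp; apply/spi_eq.
rewrite -(subrK (repr (spi g) ∘ f) (_ ∘ _)) -compBr -addrA -compBl.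
have /spi_eq h1 : factors_proj (repr (spi g) ∘ (repr (spi f) - f) - 0).
  by rewrite subr0; apply/factors_compl/e.
have /spi_eq h2 : factors_proj ((repr (spi g) - g) ∘ f - 0).
  by rewrite subr0; apply/factors_compr/e.
by rewrite -[X in factors_proj X]subr0; apply/spi_eq; rewrite spiD h1 h2 -spiD addr0.
Qed.

Program Definition stable : precat :=
  @Precat C shom (fun A => spi (idm A)) scomp _ _ _ _ _.
Next Obligation. by move=> A B x; have [f ->] := srepr x; rewrite scompE comp1m. Qed.
Next Obligation. by move=> A B x; have [f ->] := srepr x; rewrite scompE compm1. Qed.
Next Obligation.
move=> A B D E x y z; have [f ->] := srepr x; have [g ->] := srepr y.
by have [h ->] := srepr z; rewrite !scompE compA.
Qed.
Next Obligation.
move=> A B D x y z; have [f ->] := srepr x; have [g ->] := srepr y.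
by have [h ->] := srepr z; rewrite -spiD !scompE -spiD compDl.
Qed.
Next Obligation.
move=> A B D x y z; have [f ->] := srepr x; have [g ->] := srepr y.
by have [h ->] := srepr z; rewrite -spiD !scompE -spiD compDr.
Qed.

End Stable.

(* A recipe for a functor between stable categories: [sind f g] says that g is
   a morphism induced by f; it need only be unique up to stable equality. *)
Record srecipe (C D : confcat) := SRecipe {
  sob : C -> D;
  sind : forall A B, hom A B -> hom (sob A) (sob B) -> Prop;
  sind_ex : forall A B (f : hom A B), exists g, sind f g;
  sind1 : forall A, sind (idm A) (idm (sob A));
  sindM : forall A B E (g : hom B E) (f : hom A B) g' f',
    sind g g' -> sind f f' -> sind (g ∘ f) (g' ∘ f');
  sindB : forall A B (f g : hom A B) f' g',
    sind f f' -> sind g g' -> sind (f - g) (f' - g');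
  sind0 : forall A B (g : hom (sob A) (sob B)), sind 0 g -> factors_proj g;
  sob_proj : forall P, projective P -> projective (sob P) }.

Section StableFunctor.
Variables (C D : confcat) (r : srecipe C D).

Definition sfmap (A B : C) (x : shom A B) : shom (sob r A) (sob r B) :=
  spi (projT1 (cid (sind_ex r (repr x)))).

Lemma sfmapE (A B : C) (f : hom A B) g : sind f g -> sfmap (spi f) = spi g.
Proof.
rewrite /sfmap; case: cid => g' /= ig' ig; apply/spi_eq.
have : factors_proj (repr (spi f) - f) by apply/spi_eq; rewrite {1}/spi reprK.
have := sindB ig' ig; move: (g' - g) (repr _ - f) => {ig' ig} {}g' {}f ig.
move=> [P [u [v [hP fE]]]].
have [u' iu] := sind_ex r u; have [v' iv] := sind_ex r v.
have := sindB ig (sindM iv iu); rewrite -fE subrr => /sind0 h.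
have /spi_eq : factors_proj (g' - v' ∘ u') by [].
move=> e; rewrite -[g']subr0; apply/spi_eq; rewrite e; apply/spi_eq.
rewrite subr0; exists (sob r P), u', v'; split=> //; exact: sob_proj.
Qed.

Program Definition sfunctor : functor (stable C) (stable D) :=
  @Functor (stable C) (stable D) (sob r) sfmap _ _ _.
Next Obligation. by move=> A; apply/sfmapE/sind1. Qed.
Next Obligation.
move=> A B E x y; have [f ->] := srepr x; have [g ->] := srepr y.
have [f' i] := sind_ex r f; have [g' j] := sind_ex r g.
by rewrite /= (sfmapE i) (sfmapE j) !scompE (sfmapE (sindM i j)).
Qed.
Next Obligation.
move=> A B x y; have [f ->] := srepr x; have [g ->] := srepr y.
have [f' i] := sind_ex r f; have [g' j] := sind_ex r g.
by rewrite -spiB (sfmapE i) (sfmapE j) (sfmapE (sindB i j)) spiB.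
Qed.

End StableFunctor.

Section ExactLemmas.
Variables (C : confcat) (ex : is_exact C).
Implicit Types A B D : C.

Lemma iso_id A : is_iso (idm A). Proof. by exists (idm A); rewrite comp1m. Qed.

Lemma kernel_mono A B D (i : hom A B) (p : hom B D) T (f g : hom T A) :
  is_kernel i p -> i ∘ f = i ∘ g -> f = g.
Proof.
move=> [pi0 u] e; have [|h [_ hu]] := u _ (i ∘ g).
  by rewrite compA pi0 comp0m.
by rewrite -(hu f e) (hu g erefl).
Qed.

Lemma cokernel_epi A B D (i : hom A B) (p : hom B D) T (f g : hom D T) :
  is_cokernel i p -> f ∘ p = g ∘ p -> f = g.
Proof.
move=> [pi0 u] e; have [|h [_ hu]] := u _ (g ∘ p).
  by rewrite -compA pi0 compm0.
by rewrite -(hu f e) (hu g erefl).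
Qed.

Lemma iso_inflation A B (f : hom A B) : is_iso f -> inflation f.
Proof.
move=> fi; have [D [p ip]] := infl_id ex A; have [g gf fg] := fi.
exists D, (p ∘ g).
apply: (conf_iso ex (iso_id A) fi (iso_id D) _ _ ip); first by [].
by rewrite comp1m -compA gf compm1.
Qed.

Lemma kernel_conf A B D (i : hom A B) (p : hom B D) :
  deflation p -> is_kernel i p -> conf i p.
Proof.
move=> [K [k kp]] ki; have kk := conf_ker ex kp.
have [u [uE _]] := ki.2 _ k kk.1.
have [v [vE _]] := kk.2 _ i ki.1.
have iu : is_iso u; last first.
  by apply: (conf_iso ex iu (iso_id B) (iso_id D) _ _ kp); rewrite comp1m ?compm1 ?uE.
exists v.
  by apply: (kernel_mono kk); rewrite compA vE uE compm1.
by apply: (kernel_mono ki); rewrite compA uE vE compm1.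
Qed.

Lemma cokernel_conf A B D (i : hom A B) (p : hom B D) :
  inflation i -> is_cokernel i p -> conf i p.
Proof.
move=> [K [k kp]] ki; have kk := conf_coker ex kp.
have [u [uE _]] := ki.2 _ k kk.1.
have [v [vE _]] := kk.2 _ p ki.1.
have iv : is_iso v; last first.
  by apply: (conf_iso ex (iso_id A) (iso_id B) iv _ _ kp); rewrite ?comp1m compm1.
exists u.
  by apply: (cokernel_epi kk); rewrite -compA vE uE comp1m.
by apply: (cokernel_epi ki); rewrite -compA uE vE comp1m.
Qed.

Lemma pushout_inflation A B A' B' (i : hom A B) (f : hom A A')
    (g : hom B B') (j : hom A' B') :
  inflation i -> is_pushout i f g j -> inflation j.
Proof.
move=> ii po; have [E [g1 [j1 [po1 ij1]]]] := infl_pushout ex f ii.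
have [u [[uE1 uE2] _]] := po1.2 _ _ _ po.1.
have [v [[vE1 vE2] _]] := po.2 _ _ _ po1.1.
rewrite -uE2; apply: infl_comp => //; apply: iso_inflation; exists v.
  have [w [_ wu]] := po1.2 _ _ _ po1.1.
  rewrite -(wu (idm E)) ?comp1m // -(wu (v ∘ u)) //.
  by rewrite -!compA uE1 uE2 vE1 vE2.
have [w [_ wu]] := po.2 _ _ _ po.1.
rewrite -(wu (idm _)) ?comp1m // -(wu (u ∘ v)) //.
by rewrite -!compA vE1 vE2 uE1 uE2.
Qed.

Definition bipm A B A' B' (f : hom A A') (g : hom B B') :
    hom (bip A B) (bip A' B') :=
  in1 A' B' ∘ f ∘ pr1 A B + in2 A' B' ∘ g ∘ pr2 A B.

Lemma bipm_in1 A B A' B' (f : hom A A') (g : hom B B') :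
  bipm f g ∘ in1 A B = in1 A' B' ∘ f.
Proof.
by rewrite /bipm compDl -!compA pr1in1 pr2in1 !compm0 addr0 compm1.
Qed.

Lemma bipm_in2 A B A' B' (f : hom A A') (g : hom B B') :
  bipm f g ∘ in2 A B = in2 A' B' ∘ g.
Proof.
by rewrite /bipm compDl -!compA pr2in2 pr1in2 !compm0 add0r compm1.
Qed.

Lemma pr1_bipm A B A' B' (f : hom A A') (g : hom B B') :
  pr1 A' B' ∘ bipm f g = f ∘ pr1 A B.
Proof.
by rewrite /bipm compDr !compA pr1in1 pr1in2 !comp0m addr0 comp1m.
Qed.

Lemma pr2_bipm A B A' B' (f : hom A A') (g : hom B B') :
  pr2 A' B' ∘ bipm f g = g ∘ pr2 A B.
Proof.
by rewrite /bipm compDr !compA pr2in2 pr2in1 !comp0m add0r comp1m.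
Qed.

Lemma bip_homP A B T (f g : hom (bip A B) T) :
  f ∘ in1 A B = g ∘ in1 A B -> f ∘ in2 A B = g ∘ in2 A B -> f = g.
Proof.
by move=> e1 e2; rewrite -[f]compm1 -[g]compm1 -bipE !compDr !compA e1 e2.
Qed.

Lemma hom_bipP A B T (f g : hom T (bip A B)) :
  pr1 A B ∘ f = pr1 A B ∘ g -> pr2 A B ∘ f = pr2 A B ∘ g -> f = g.
Proof.
by move=> e1 e2; rewrite -[f]comp1m -[g]comp1m -bipE !compDl -!compA e1 e2.
Qed.

Lemma bipmM A B A' B' A'' B'' (f' : hom A' A'') (g' : hom B' B'')
    (f : hom A A') (g : hom B B') :
  bipm f' g' ∘ bipm f g = bipm (f' ∘ f) (g' ∘ g).
Proof.
apply: bip_homP; rewrite -compA !(bipm_in1, bipm_in2) compA.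
  by rewrite bipm_in1 compA.
by rewrite bipm_in2 compA.
Qed.

Lemma bipm1 A B : bipm (idm A) (idm B) = idm (bip A B).
Proof. by rewrite /bipm !compm1 bipE. Qed.

Lemma inflation_bip1 A B D (f : hom A B) :
  inflation f -> inflation (bipm f (idm D)).
Proof.
move=> fi; apply: (pushout_inflation (f := in1 A D) (g := in1 B D) fi).
split=> [|T u v e]; first by rewrite bipm_in1.
exists (u ∘ pr1 B D + v ∘ in2 A D ∘ pr2 B D); split=> [|w [w1 w2]].
  split; first by rewrite compDl -!compA pr1in1 pr2in1 !compm0 addr0 compm1.
  apply: bip_homP; rewrite -compA (bipm_in1, bipm_in2) compDl -!compA.
    by rewrite ![pr1 _ _ ∘ (_ ∘ _)]compA ![pr2 _ _ ∘ (_ ∘ _)]compA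
      pr1in1 pr2in1 comp0m comp1m !compm0 addr0.
  by rewrite ![pr1 _ _ ∘ (_ ∘ _)]compA ![pr2 _ _ ∘ (_ ∘ _)]compA
    pr1in2 pr2in2 comp0m !comp1m !compm0 add0r compm1.
apply: bip_homP; rewrite compDl -!compA.
  by rewrite pr1in1 pr2in1 !compm0 addr0 compm1 w1.
by rewrite pr1in2 pr2in2 !compm0 add0r compm1 -w2 -compA bipm_in2 compm1.
Qed.

Lemma bip_swap A B A' B' (f : hom A A') (g : hom B B') :
  exists (s : hom (bip A B) (bip B A)) (s' : hom (bip B' A') (bip A' B')),
    [/\ is_iso s, is_iso s' & bipm f g = s' ∘ bipm g f ∘ s].
Proof.
pose sw (X Y : C) : hom (bip X Y) (bip Y X) := in2 Y X ∘ pr1 X Y + in1 Y X ∘ pr2 X Y.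
have sw1 (X Y : C) : sw X Y ∘ in1 X Y = in2 Y X.
  by rewrite /sw compDl -!compA pr1in1 pr2in1 !compm0 addr0 compm1.
have sw2 (X Y : C) : sw X Y ∘ in2 X Y = in1 Y X.
  by rewrite /sw compDl -!compA pr1in2 pr2in2 !compm0 add0r compm1.
have swK (X Y : C) : sw Y X ∘ sw X Y = idm _.
  by apply: bip_homP; rewrite -compA (sw1, sw2) (sw1, sw2) comp1m.
exists (sw _ _), (sw _ _); split; [by exists (sw _ _) | by exists (sw _ _) |].
apply: bip_homP; rewrite -!compA (sw1, sw2) (bipm_in1, bipm_in2).
  by rewrite bipm_in2 compA sw2.
by rewrite bipm_in1 compA sw1.
Qed.

Lemma inflation_bip A B A' B' (f : hom A A') (g : hom B B') :
  inflation f -> inflation g -> inflation (bipm f g).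
Proof.
move=> fi gi.
have -> : bipm f g = bipm f (idm B') ∘ bipm (idm A) g.
  by rewrite bipmM compm1 comp1m.
apply: infl_comp => //; last exact: inflation_bip1.
have [s [s' [si s'i ->]]] := bip_swap (idm A) g.
apply: infl_comp => //; first exact: iso_inflation.
by apply: infl_comp => //; [exact: inflation_bip1 | exact: iso_inflation].
Qed.

Lemma inflation_zob A : inflation (0 : hom (zob C) A).
Proof.
exists A, (idm A); apply: kernel_conf; first exact: defl_id.
split=> [|T f]; first by rewrite compm0.
rewrite comp1m => ->; exists 0; split; first by rewrite comp0m.
by move=> g _; rewrite (zob_term g).
Qed.

Lemma inflation_in1 A B : inflation (in1 A B).
Proof.
apply: (pushout_inflation (f := 0) (g := in2 A B) (inflation_zob B)).
split=> [|T u v _]; first by rewrite !compm0.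
exists (v ∘ pr1 A B + u ∘ pr2 A B); split=> [|w [w2 w1]].
  split; rewrite compDl -!compA.
    by rewrite pr1in2 pr2in2 compm0 compm1 add0r.
  by rewrite pr1in1 pr2in1 compm0 compm1 addr0.
by rewrite -w1 -w2 -!compA -compDr bipE compm1.
Qed.

Lemma inflation_pair A I J (i : hom A I) (h : hom A J) :
  injective_ob J -> inflation i -> inflation (in1 I J ∘ i + in2 I J ∘ h).
Proof.
move=> hJ ii; have [k kE] := hJ _ _ i h ii.
pose n := in2 I J ∘ k ∘ pr1 I J.
have nn : n ∘ n = 0.
  by rewrite /n -!compA [pr1 _ _ ∘ (_ ∘ _)]compA pr1in2 comp0m !compm0.
have -> : in1 I J ∘ i + in2 I J ∘ h = (idm _ + n) ∘ in1 I J ∘ i.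
  by rewrite /n !compDl comp1m -!compA [pr1 _ _ ∘ (_ ∘ _)]compA pr1in1 comp1m kE.
apply: infl_comp => //; apply: infl_comp => //; first exact: inflation_in1.
apply: iso_inflation; exists (idm _ - n).
  by rewrite compBl !compDr !compm1 !comp1m nn addr0 addrK.
by rewrite compBr !compDl !compm1 !comp1m nn addr0 addrK.
Qed.

Lemma injective_retract A B (s : hom A B) (r : hom B A) :
  r ∘ s = idm A -> injective_ob B -> injective_ob A.
Proof.
move=> rs hB X Y i f ii; have [g gE] := hB _ _ i (s ∘ f) ii.
by exists (r ∘ g); rewrite -compA gE compA rs comp1m.
Qed.

Lemma projective_retract A B (s : hom A B) (r : hom B A) :
  r ∘ s = idm A -> projective B -> projective A.
Proof.
move=> rs hB X Y p f dp; have [g gE] := hB _ _ p (f ∘ r) dp.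
by exists (g ∘ s); rewrite compA gE -compA rs compm1.
Qed.

Lemma coker_injective A B D (i : hom A B) (p : hom B D) :
  conf i p -> injective_ob A -> exists s, p ∘ s = idm D.
Proof.
move=> ip hA; have kp := conf_coker ex ip.
have [|r rE] := hA _ _ i (idm A); first by exists D, p.
have [|s [sE _]] := kp.2 _ (idm B - i ∘ r).
  by rewrite compBl comp1m -compA rE compm1 subrr.
exists s; apply: (cokernel_epi kp).
by rewrite -compA sE compBr compm1 compA kp.1 comp0m subr0 comp1m.
Qed.

Lemma deflation_kernel B D (p : hom B D) : deflation p ->
  exists A (i : hom A B), conf i p /\ is_kernel i p.
Proof. by move=> [A [i ip]]; exists A, i; split=> //; apply: conf_ker. Qed.

Lemma inflation_pullback A B K L (i : hom A B) (d : hom L B)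
    (q1 : hom K A) (q2 : hom K L) :
  inflation i -> deflation d -> is_pullback i d q1 q2 -> inflation q2.
Proof.
move=> [D [c ic]] dd pb; exists D, (c ∘ d).
have ki := conf_ker ex ic.
apply: kernel_conf; first by apply: defl_comp => //; exists A, i.
split=> [|T f e]; first by rewrite -compA -pb.1 compA ki.1 comp0m.
have [|g [gE gu]] := ki.2 _ (d ∘ f); first by rewrite compA.
have [w [[w1 w2] wu]] := pb.2 _ g f gE.
exists w; split=> // v vE; apply: wu; split=> //.
by apply/esym/gu; rewrite compA pb.1 -compA vE.
Qed.

End ExactLemmas.

(* A chain X^0 -> ... -> X^l of admissible monics together with all its
   composites X^i -> X^j, i <= j, that is, a functor on the poset {0,..,l};
   the maps X^i -> X^{i+1} determine the others, and since composites of
   admissible monics are admissible monics, asking the latter of all composites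
   is no stronger than asking it of the maps X^i -> X^{i+1}. *)
Record chain (C : confcat) (l : nat) := Chain {
  tm :> 'I_l.+1 -> C;
  tmap : forall i j : 'I_l.+1, (i <= j)%N -> hom (tm i) (tm j);
  tmap1 : forall (i : 'I_l.+1) (h : (i <= i)%N), tmap h = idm (tm i);
  tmapM : forall (i j k : 'I_l.+1) (hij : (i <= j)%N) (hjk : (j <= k)%N) (hik : (i <= k)%N),
    tmap hjk ∘ tmap hij = tmap hik;
  tmap_infl : forall (i j : 'I_l.+1) (h : (i <= j)%N), inflation (tmap h) }.

Record chain_hom (C : confcat) l (X Y : chain C l) := ChainHom {
  cm :> forall i, hom (X i) (Y i);
  cm_nat : forall (i j : 'I_l.+1) (h : (i <= j)%N), tmap Y h ∘ cm i = cm j ∘ tmap X h }.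

Section ChainHom.
Variables (C : confcat) (l : nat).

Lemma chain_homP (X Y : chain C l) (f g : chain_hom X Y) :
  (forall i, f i = g i) -> f = g.
Proof.
case: f g => [f fn] [g gn] /= e.
have {}e : f = g by apply: functional_extensionality_dep.
by subst g; congr ChainHom; exact: Prop_irrelevance.
Qed.

Variables X Y : chain C l.

HB.instance Definition _ := gen_eqMixin (chain_hom X Y).
HB.instance Definition _ := gen_choiceMixin (chain_hom X Y).

Program Definition ch_zero : chain_hom X Y := @ChainHom _ _ X Y (fun i => 0) _.
Next Obligation. by move=> i j h /=; rewrite compm0 comp0m. Qed.

Program Definition ch_opp (f : chain_hom X Y) : chain_hom X Y :=
  @ChainHom _ _ X Y (fun i => - f i) _.
Next Obligation. by move=> f i j h /=; rewrite compNl compNr cm_nat. Qed.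

Program Definition ch_add (f g : chain_hom X Y) : chain_hom X Y :=
  @ChainHom _ _ X Y (fun i => f i + g i) _.
Next Obligation. by move=> f g i j h /=; rewrite compDl compDr !cm_nat. Qed.

Lemma ch_addA : associative ch_add.
Proof. by move=> f g h; apply: chain_homP => i /=; rewrite addrA. Qed.
Lemma ch_addC : commutative ch_add.
Proof. by move=> f g; apply: chain_homP => i /=; rewrite addrC. Qed.
Lemma ch_add0 : left_id ch_zero ch_add.
Proof. by move=> f; apply: chain_homP => i /=; rewrite add0r. Qed.
Lemma ch_addN : left_inverse ch_zero ch_opp ch_add.
Proof. by move=> f; apply: chain_homP => i /=; rewrite addNr. Qed.

HB.instance Definition _ :=
  GRing.isZmodule.Build (chain_hom X Y) ch_addA ch_addC ch_add0 ch_addN.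

Lemma cm0 i : (0 : chain_hom X Y) i = 0. Proof. by []. Qed.
Lemma cmD (f g : chain_hom X Y) i : (f + g) i = f i + g i. Proof. by []. Qed.
Lemma cmB (f g : chain_hom X Y) i : (f - g) i = f i - g i. Proof. by []. Qed.

End ChainHom.

Section ChainCat.
Variables (C : confcat) (l : nat).

Program Definition ch_id (X : chain C l) : chain_hom X X :=
  @ChainHom _ _ X X (fun i => idm (X i)) _.
Next Obligation. by move=> X i j h /=; rewrite comp1m compm1. Qed.

Program Definition ch_comp (X Y Z : chain C l) (g : chain_hom Y Z)
    (f : chain_hom X Y) : chain_hom X Z :=
  @ChainHom _ _ X Z (fun i => g i ∘ f i) _.
Next Obligation.
by move=> X Y Z g f i j h /=; rewrite compA cm_nat -!compA cm_nat.
Qed.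

Program Definition chain_precat : precat :=
  @Precat (chain C l) (fun X Y => chain_hom X Y : zmodType) ch_id ch_comp
    _ _ _ _ _.
Next Obligation. by move=> *; apply: chain_homP => i /=; rewrite comp1m. Qed.
Next Obligation. by move=> *; apply: chain_homP => i /=; rewrite compm1. Qed.
Next Obligation. by move=> *; apply: chain_homP => i /=; rewrite compA. Qed.
Next Obligation. by move=> *; apply: chain_homP => i /=; rewrite compDl. Qed.
Next Obligation. by move=> *; apply: chain_homP => i /=; rewrite compDr. Qed.

End ChainCat.

Section Mor.
Variables (F : frobenius) (l : nat).

Program Definition ch_zob : chain F l :=
  @Chain F l (fun _ => zob F) (fun _ _ _ => idm _) _ _ _.
Next Obligation. by []. Qed.
Next Obligation. by move=> * /=; rewrite comp1m. Qed.
Next Obligation. by move=> *; exact: (infl_id (frob_exact F)). Qed.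

Program Definition ch_bip (X Y : chain F l) : chain F l :=
  @Chain F l (fun i => bip (X i) (Y i))
    (fun i j h => bipm (tmap X h) (tmap Y h)) _ _ _.
Next Obligation. by move=> X Y i h /=; rewrite !tmap1 bipm1. Qed.
Next Obligation. by move=> X Y i j k h1 h2 h3 /=; rewrite bipmM !tmapM. Qed.
Next Obligation. 
by move=> X Y i j h /=; apply: (inflation_bip (frob_exact F)); apply: tmap_infl.
 Qed.

Program Definition ch_in1 (X Y : chain F l) : chain_hom X (ch_bip X Y) :=
  @ChainHom _ _ X (ch_bip X Y) (fun i => in1 (X i) (Y i)) _.
Next Obligation. by move=> X Y i j h /=; rewrite bipm_in1. Qed.
Program Definition ch_in2 (X Y : chain F l) : chain_hom Y (ch_bip X Y) :=
  @ChainHom _ _ Y (ch_bip X Y) (fun i => in2 (X i) (Y i)) _.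
Next Obligation. by move=> X Y i j h /=; rewrite bipm_in2. Qed.
Program Definition ch_pr1 (X Y : chain F l) : chain_hom (ch_bip X Y) X :=
  @ChainHom _ _ (ch_bip X Y) X (fun i => pr1 (X i) (Y i)) _.
Next Obligation. by move=> X Y i j h /=; rewrite pr1_bipm. Qed.
Program Definition ch_pr2 (X Y : chain F l) : chain_hom (ch_bip X Y) Y :=
  @ChainHom _ _ (ch_bip X Y) Y (fun i => pr2 (X i) (Y i)) _.
Next Obligation. by move=> X Y i j h /=; rewrite pr2_bipm. Qed.

Program Definition chain_addcat : addcat :=
  @Addcat (chain_precat F l) ch_zob _ _ ch_bip ch_in1 ch_in2 ch_pr1 ch_pr2
    _ _ _ _ _.
Next Obligation. by move=> X f; apply: chain_homP => i; apply: zob_init. Qed.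
Next Obligation. by move=> X f; apply: chain_homP => i; apply: zob_term. Qed.
Next Obligation. by move=> *; apply: chain_homP => i /=; rewrite pr1in1. Qed.
Next Obligation. by move=> *; apply: chain_homP => i /=; rewrite pr2in2. Qed.
Next Obligation. by move=> *; apply: chain_homP => i /=; rewrite pr1in2. Qed.
Next Obligation. by move=> *; apply: chain_homP => i /=; rewrite pr2in1. Qed.
Next Obligation. by move=> *; apply: chain_homP => i /=; rewrite bipE. Qed.

(* Mor^m_l(F) with the termwise exact structure *)
Definition Morm : confcat :=
  @Confcat chain_addcat (fun X Y Z (i : chain_hom X Y) (p : chain_hom Y Z) =>
    forall k, conf (i k) (p k)).

(* the category M_l *)
Definition sMorm : precat := stable Morm.

End Mor.

Section TwoStep.
Variables (F : frobenius) (l : nat).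

Definition step_ob (A B : F) (b : bool) : F := if b then A else B.

Definition step_map (A B : F) (j : hom A B) (b b' : bool) :
    hom (step_ob A B b) (step_ob A B b') :=
  match b, b' return hom (step_ob A B b) (step_ob A B b') with
  | true, true => idm A
  | true, false => j
  | false, true => 0
  | false, false => idm B
  end.

(* the chain with A at the positions i with P i, B elsewhere *)
Program Definition step_chain (P : pred nat)
    (P_down : forall i j, (i <= j)%N -> P j -> P i)
    (A B : F) (j : hom A B) (ji : inflation j) : chain F l :=
  @Chain F l (fun i => step_ob A B (P i)) (fun i k _ => step_map j (P i) (P k)) _ _ _.
Next Obligation. by move=> P Pd A B j ji i h /=; case: (P i). Qed.
Next Obligation.
move=> P Pd A B j ji a b c hab hbc hac /=.
move: (Pd _ _ hab) (Pd _ _ hbc).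
by case: (P a); case: (P b); case: (P c) => /= h1 h2; rewrite ?comp1m ?compm1 //;
  first [by have := h1 isT | by have := h2 isT].
Qed.
Next Obligation.
move=> P Pd A B j ji a b hab /=; move: (Pd _ _ hab).
case: (P a); case: (P b) => //= h; try exact: (infl_id (frob_exact F)).
by have := h isT.
Qed.

Definition step_hom (A B A' B' : F) (f : hom A A') (g : hom B B') (b : bool) :
    hom (step_ob A B b) (step_ob A' B' b) :=
  match b return hom (step_ob A B b) (step_ob A' B' b) with
  | true => f | false => g end.

End TwoStep.

Section MorProj.
Variables (F : frobenius) (l : nat).
Let ex := frob_exact F.

Lemma termwise_lift (Q : chain F l) (B D : Morm F l) (p : hom B D) (f : hom (Q : Morm F l) D) :
  (forall i, projective (Q i)) -> deflation p ->
  exists g : hom (Q : Morm F l) B, p ∘ g = f.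
Proof.
move=> hQ [K [u up]].
suff key n : exists g : forall i, hom (Q i) ((B : chain F l) i),
    (forall i : 'I_l.+1, (i < n)%N -> (p : chain_hom _ _) i ∘ g i = (f : chain_hom _ _) i) /\
    (forall (i j : 'I_l.+1) (h : (i <= j)%N), (j < n)%N ->
      tmap B h ∘ g i = g j ∘ tmap Q h).
  have [g [gp gn]] := key l.+1.
  have gn' (i j : 'I_l.+1) (h : (i <= j)%N) : tmap B h ∘ g i = g j ∘ tmap Q h.
    exact: gn.
  by exists (ChainHom gn'); apply: chain_homP => i; apply: gp.
elim: n => [|k [g [gp gn]]]; first by exists (fun i => 0); split.
case: (ltnP k l.+1) => hk; last first.
  by exists g; split=> [i _|i j h _]; [apply: gp|apply: gn]; apply: leq_trans hk.
pose K' := Ordinal hk.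
have [h hE] : exists h : hom (Q K') ((B : chain F l) K'),
    (p : chain_hom _ _) K' ∘ h = (f : chain_hom _ _) K'.
  by apply: hQ; exists ((K : chain F l) K'), ((u : chain_hom _ _) K'); apply: up.
have [h' [h'p h'n]] : exists h' : hom (Q K') ((B : chain F l) K'),
    (p : chain_hom _ _) K' ∘ h' = (f : chain_hom _ _) K' /\
    forall (i : 'I_l.+1) (hi : (i <= K')%N), (i < k)%N ->
      tmap B hi ∘ g i = h' ∘ tmap Q hi.
  case: k hk @K' g gp gn h hE => [|k] hk K' g gp gn h hE.
    by exists h.
  have hk1 : (k < l.+1)%N by apply: ltnW.
  pose K1 := Ordinal hk1.
  have h1 : (K1 <= K')%N by rewrite /=.
  have [r rE] := (proj_inj (Q K1)).1 (hQ K1) _ _ (tmap Q h1)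
    (idm _) (tmap_infl Q h1).
  exists (h - (h ∘ tmap Q h1 - tmap B h1 ∘ g K1) ∘ r); split.
    rewrite compBr compA compBr !compA hE -(cm_nat p) -!compA gp //.
    by rewrite (cm_nat f) subrr comp0m subr0.
  move=> i hi ik; have hi1 : (i <= K1)%N by rewrite -ltnS.
  rewrite -(tmapM Q hi1 h1 hi) -(tmapM B hi1 h1 hi) -compA gn //.
  rewrite !compA; congr (_ ∘ _).
  by rewrite compBl -[_ ∘ r ∘ _]compA rE compm1 opprB addrC subrK.
exists (dfwith g h'); split=> [i|i j hij].
  rewrite ltnS leq_eqVlt => /orP[/eqP e|ik].
    by have -> : i = K' by [apply: val_inj]; rewrite dfwith_in.
  rewrite dfwith_out ?gp //; apply: contraTneq ik => <- /=.
  by rewrite ltnn.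
have out (i0 : 'I_l.+1) : (i0 < k)%N -> dfwith g h' i0 = g i0.
  by move=> ik; rewrite dfwith_out //; apply: contraTneq ik => <- /=; rewrite ltnn.
rewrite ltnS leq_eqVlt => /orP[/eqP e|jk]; last first.
  by rewrite !out ?gn //; apply: leq_ltn_trans jk.
have ej : j = K' by apply: val_inj.
subst j; rewrite dfwith_in; have := hij; rewrite {1}leq_eqVlt => /orP[/eqP e'|ik].
  have ei : i = K' by apply: val_inj.
  by subst i; rewrite dfwith_in !tmap1 comp1m compm1.
by rewrite out // h'n.
Qed.

Lemma Morm_projective (Q : Morm F l) :
  projective Q <-> forall i, projective ((Q : chain F l) i).
Proof.
split=> [hQ k|hQ B D p f dp]; last exact: termwise_lift.
move=> B D p f dp.
have [J [j [hJ jj]]] := enough_inj B; have [I [i [hI ii]]] := enough_inj D.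
have [K [u [upc _]]] := deflation_kernel ex dp.
have ui : inflation u by exists D, p.
pose P n := (n <= k)%N.
have Pd n n' : (n <= n')%N -> P n' -> P n by apply: leq_trans.
have bi := inflation_pair ex (i ∘ p) hI jj.
set b := (in1 J I ∘ j + _) in bi.
have kj : inflation (j ∘ u) by apply: infl_comp.
pose D' := step_chain l Pd ii; pose B' := step_chain l Pd bi.
pose K' := step_chain l Pd kj.
have pn (x y : 'I_l.+1) (h : (x <= y)%N) :
    tmap D' h ∘ step_hom p (pr2 J I) (P x) = step_hom p (pr2 J I) (P y) ∘ tmap B' h.
  move=> /=; have := Pd _ _ h; case: (P x); case: (P y) => /= hh; last first.
  - by rewrite comp1m compm1.
  - by have := hh isT.
  - rewrite /b compDr !compA pr2in1 pr2in2 !comp0m add0r.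
    by rewrite comp1m.
  - by rewrite comp1m compm1.
have un (x y : 'I_l.+1) (h : (x <= y)%N) :
    tmap B' h ∘ step_hom u (in1 J I) (P x) = step_hom u (in1 J I) (P y) ∘ tmap K' h.
  move=> /=; have := Pd _ _ h; case: (P x); case: (P y) => /= hh; last first.
  - by rewrite comp1m compm1.
  - by have := hh isT.
  - rewrite /b compDl -!compA (conf_ker ex upc).1 !compm0 addr0.
    by [].
  - by rewrite comp1m compm1.
have [t tE] := hI _ _ (tmap (Q : chain F l) (leq_ord k : (k <= @ord_max l)%N)) (i ∘ f)
  (tmap_infl _ _).
pose qk (x : 'I_l.+1) : hom ((Q : chain F l) x) ((Q : chain F l) k) :=
  if pselect (x <= k)%N is left h then tmap (Q : chain F l) h else 0.
have qkE (x : 'I_l.+1) (h : (x <= k)%N) : qk x = tmap (Q : chain F l) h.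
  by rewrite /qk; case: pselect => [h'|//]; congr tmap; exact: Prop_irrelevance.
pose ql (x : 'I_l.+1) := tmap (Q : chain F l) (leq_ord x : (x <= @ord_max l)%N).
pose f' (x : 'I_l.+1) : hom ((Q : chain F l) x) (D' x) :=
  match P x as c return hom ((Q : chain F l) x) (step_ob D I c) with
  | true => f ∘ qk x | false => t ∘ ql x end.
have fn (x y : 'I_l.+1) (h : (x <= y)%N) :
    tmap D' h ∘ f' x = f' y ∘ tmap (Q : chain F l) h.
  have e1 : P y -> qk y ∘ tmap (Q : chain F l) h = qk x.
    move=> hy; rewrite (qkE _ hy) (qkE _ (leq_trans h hy)).
    exact: tmapM.
  have e2 : ql y ∘ tmap (Q : chain F l) h = ql x by exact: tmapM.
  have e3 : P x -> i ∘ (f ∘ qk x) = t ∘ ql x.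
    move=> hx; rewrite (qkE _ hx) compA -tE -compA; congr (_ ∘ _); exact: tmapM.
  rewrite /f' /=; move: (Pd _ _ h) e1 e3.
  case: (P x); case: (P y) => /= hh e1 e3; last first.
  - by rewrite comp1m -compA e2.
  - by have := hh isT.
  - by rewrite e3 // -compA e2.
  - by rewrite comp1m -compA e1.
have [|G /(congr1 (fun h : chain_hom _ _ => h k)) /= GE] := hQ (B' : Morm F l)
    (D' : Morm F l) (@ChainHom _ _ B' D' (fun x => step_hom p (pr2 J I) (P x)) pn)
    (@ChainHom _ _ Q D' f' fn).
  exists (K' : Morm F l), (@ChainHom _ _ K' B' (fun x => step_hom u (in1 J I) (P x)) un) => x.
  suff : conf (step_hom u (in1 J I) (P x)) (step_hom p (pr2 J I) (P x)) by [].
  case: (P x) => //=.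
  apply: cokernel_conf => //; first exact: inflation_in1.
  split=> [|T g g0]; first exact: pr2in1.
  exists (g ∘ in2 J I); split=> [|g' <-]; last by rewrite -compA pr2in2 compm1.
  apply: bip_homP; rewrite -!compA ?pr2in1 ?pr2in2 ?compm1 //.
  by rewrite !compm0 g0.
move: GE; move: ((G : chain_hom _ _) k); rewrite /f' /=.
have -> : P k = true by rewrite /P leqnn.
move=> /= G' GE; exists G'; rewrite GE (qkE _ (leqnn k)) tmap1.
by rewrite compm1.
Qed.

End MorProj.

Section Choices.
Variables (C : confcat) (ex : is_exact C).

Section Cokernel.
Variables (A B : C) (i : hom A B) (h : inflation i).
Definition cok : C := projT1 (cid h).
Definition cokp : hom B cok := projT1 (cid (projT2 (cid h))).
Lemma cok_conf : conf i cokp.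
Proof. exact: (projT2 (cid (projT2 (cid h)))). Qed.
Lemma cok_coker : is_cokernel i cokp. Proof. exact: (conf_coker ex cok_conf). Qed.
Lemma cokp0 : cokp ∘ i = 0. Proof. exact: cok_coker.1. Qed.

Lemma cok_fact_ex T (f : hom B T) : f ∘ i = 0 -> exists g, g ∘ cokp = f.
Proof. by move=> /cok_coker.2[g [gE _]]; exists g. Qed.

Definition cok_fact T (f : hom B T) (f0 : f ∘ i = 0) : hom cok T :=
  projT1 (cid (cok_fact_ex f0)).
Lemma cok_factE T (f : hom B T) (f0 : f ∘ i = 0) : cok_fact f0 ∘ cokp = f.
Proof. exact: (projT2 (cid (cok_fact_ex f0))). Qed.
Lemma cok_inj T (f g : hom cok T) : f ∘ cokp = g ∘ cokp -> f = g.
Proof. exact: (cokernel_epi cok_coker). Qed.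
End Cokernel.

Section Pullback.
Variables (A B D : C) (f : hom A D) (p : hom B D) (dp : deflation p).
Let e := defl_pullback ex f dp.
Definition pb : C := projT1 (cid e).
Definition pb1 : hom pb A := projT1 (cid (projT2 (cid e))).
Definition pb2 : hom pb B := projT1 (cid (projT2 (cid (projT2 (cid e))))).
Lemma pbP : is_pullback f p pb1 pb2.
Proof. exact: (projT2 (cid (projT2 (cid (projT2 (cid e)))))).1. Qed.
Lemma pb1_defl : deflation pb1.
Proof. exact: (projT2 (cid (projT2 (cid (projT2 (cid e)))))).2. Qed.
Lemma pbE : f ∘ pb1 = p ∘ pb2. Proof. exact: pbP.1. Qed.

Lemma pb_pair_ex T (u : hom T A) (v : hom T B) : f ∘ u = p ∘ v ->
  exists w, pb1 ∘ w = u /\ pb2 ∘ w = v.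
Proof. by move=> /pbP.2[w [wE _]]; exists w. Qed.

Definition pb_pair T (u : hom T A) (v : hom T B) (uv : f ∘ u = p ∘ v) :
  hom T pb := projT1 (cid (pb_pair_ex uv)).
Lemma pb1_pair T (u : hom T A) (v : hom T B) (uv : f ∘ u = p ∘ v) :
  pb1 ∘ pb_pair uv = u.
Proof. exact: (projT2 (cid (pb_pair_ex uv))).1. Qed.
Lemma pb2_pair T (u : hom T A) (v : hom T B) (uv : f ∘ u = p ∘ v) :
  pb2 ∘ pb_pair uv = v.
Proof. exact: (projT2 (cid (pb_pair_ex uv))).2. Qed.
Lemma pb_inj T (w w' : hom T pb) :
  pb1 ∘ w = pb1 ∘ w' -> pb2 ∘ w = pb2 ∘ w' -> w = w'.
Proof.
move=> e1 e2; have [|x [_ xu]] := pbP.2 T (pb1 ∘ w) (pb2 ∘ w).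
  by rewrite !compA pbE.
by rewrite -(xu w) // -(xu w').
Qed.
End Pullback.

End Choices.

(* the chosen A -> I(A) and P(A) -> A *)
Record hulls (F : frobenius) := Hulls {
  ihull : forall A : F, {I : F & hom A I};
  ihull_inj : forall A, injective_ob (projT1 (ihull A));
  ihull_infl : forall A, inflation (projT2 (ihull A));
  ihull_id : forall A, projective A -> ihull A = existT _ A (idm A);
  pcover : forall A : F, {P : F & hom P A};
  pcover_proj : forall A, projective (projT1 (pcover A));
  pcover_defl : forall A, deflation (projT2 (pcover A));
  pcover_id : forall A, projective A -> pcover A = existT _ A (idm A) }.

Definition hullI F (H : hulls F) (A : F) : F := projT1 (ihull H A).
Definition hulli F (H : hulls F) (A : F) : hom A (hullI H A) := projT2 (ihull H A).
Definition coverP F (H : hulls F) (A : F) : F := projT1 (pcover H A).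
Definition coverp F (H : hulls F) (A : F) : hom (coverP H A) A := projT2 (pcover H A).

(* k, truncated so as to be a position in a chain of l morphisms; no truncation
   takes place in any of the functors below as long as the numbers l, n, a, b
   are related as in their descriptions *)
Definition clip (l k : nat) : 'I_l.+1 :=
  Ordinal (geq_minl l k : (minn l k < l.+1)%N).

Lemma clip_homo l : {homo clip l : i j / (i <= j)%N}.
Proof. by move=> i j h /=; lia. Qed.

Section Reindex.
Variables (F : frobenius) (l n : nat) (phi : nat -> nat).
Hypothesis phi_homo : {homo phi : i j / (i <= j)%N}.

Lemma reindex_le (i j : 'I_n.+1) : (i <= j)%N -> (clip l (phi i) <= clip l (phi j))%N.
Proof. by move=> h; apply/clip_homo/phi_homo. Qed.

Program Definition reindex_ob (X : chain F l) : chain F n :=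
  @Chain F n (fun i => X (clip l (phi i)))
    (fun i j h => tmap X (reindex_le h)) _ _ _.
Next Obligation. by move=> X i h /=; apply: tmap1. Qed.
Next Obligation. by move=> X i j k h1 h2 h3 /=; apply: tmapM. Qed.
Next Obligation. by move=> X i j h /=; apply: tmap_infl. Qed.

Program Definition reindex_recipe : srecipe (Morm F l) (Morm F n) :=
  @SRecipe (Morm F l) (Morm F n) reindex_ob
    (fun X Y (f : chain_hom X Y) (g : chain_hom (reindex_ob X) (reindex_ob Y)) =>
       forall i : 'I_n.+1, g i = f (clip l (phi i))) _ _ _ _ _ _.
Next Obligation.
move=> X Y f.
have gn (i j : 'I_n.+1) (h : (i <= j)%N) :
    tmap (reindex_ob Y) h ∘ (f : chain_hom X Y) (clip l (phi i)) =
    (f : chain_hom X Y) (clip l (phi j)) ∘ tmap (reindex_ob X) h.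
  exact: cm_nat.
by exists (@ChainHom _ _ (reindex_ob X) (reindex_ob Y) _ gn).
Qed.
Next Obligation. by []. Qed.
Next Obligation. by move=> X Y Z g f g' f' hg hf i /=; rewrite hg hf. Qed.
Next Obligation. move=> X Y f g f1 g1 hf hg i.
by rewrite !cmB hf hg. Qed.
Next Obligation.
move=> X Y g hg; exists (zob (Morm F n)), 0, 0; split; first exact: projective_zob.
by rewrite comp0m; apply: chain_homP => i; rewrite hg.
Qed.
Next Obligation.
by move=> P /Morm_projective hP; apply/Morm_projective => i; apply: hP.
Qed.

End Reindex.

(* the chain of cokernels of X^a -> X^(a+1+k), k = 0,..,n *)
Section Cokernels.
Variables (F : frobenius) (l n a : nat).
Let ex := frob_exact F.

Definition ck_pos (k : nat) : 'I_l.+1 := clip l (a.+1 + k).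

Lemma ck_pos_le (i j : 'I_n.+1) : (i <= j)%N -> (ck_pos i <= ck_pos j)%N.
Proof. by move=> h; apply: clip_homo; rewrite leq_add2l. Qed.

Lemma ck_le k : (clip l a <= ck_pos k)%N.
Proof. by apply: clip_homo; rewrite addSnnS leq_addr. Qed.

Definition ck (X : chain F l) (k : nat) : F := cok (tmap_infl X (ck_le k)).
Definition ckp (X : chain F l) (k : nat) : hom (X (ck_pos k)) (ck X k) :=
  cokp (tmap_infl X (ck_le k)).

Lemma ck_map0 (X : chain F l) (i j : 'I_n.+1) (h : (i <= j)%N) :
  (ckp X j ∘ tmap X (ck_pos_le h)) ∘ tmap X (ck_le i) = 0.
Proof. by rewrite -compA (tmapM X _ _ (ck_le j)) cokp0. Qed.

Definition ck_map (X : chain F l) (i j : 'I_n.+1) (h : (i <= j)%N) :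
  hom (ck X i) (ck X j) := cok_fact ex (tmap_infl X (ck_le i)) (ck_map0 X h).

Lemma ck_mapE (X : chain F l) (i j : 'I_n.+1) (h : (i <= j)%N) :
  ck_map X h ∘ ckp X i = ckp X j ∘ tmap X (ck_pos_le h).
Proof. exact: cok_factE. Qed.

Program Definition ck_ob (X : chain F l) : chain F n :=
  @Chain F n (ck X) (ck_map X) _ _ _.
Next Obligation.
move=> X i h; apply: (cok_inj ex); rewrite -/(ckp X i) ck_mapE tmap1.
by rewrite comp1m compm1.
Qed.
Next Obligation.
move=> X i j k h1 h2 h3; apply: (cok_inj ex); rewrite -/(ckp X i) ck_mapE.
by rewrite -compA ck_mapE compA ck_mapE -compA (tmapM X _ _ (ck_pos_le h3)).
Qed.
Next Obligation.
move=> X i j h; apply: (pushout_inflation ex (f := ckp X i) (g := ckp X j)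
  (tmap_infl X (ck_pos_le h))).
split=> [|T u v e]; first by rewrite ck_mapE.
have u0 : u ∘ tmap X (ck_le j) = 0.
  by rewrite -(tmapM X (ck_le i) (ck_pos_le h)) compA e -compA cokp0 ?compm0.
exists (cok_fact ex (tmap_infl X (ck_le j)) u0); split=> [|w [w1 w2]]; last first.
  by apply: (cok_inj ex); rewrite cok_factE -w1.
split; first exact: cok_factE.
apply: (cok_inj ex); rewrite -/(ckp X i) -compA ck_mapE compA.
by rewrite [_ ∘ ckp X j]cok_factE.
Qed.

Program Definition ck_recipe : srecipe (Morm F l) (Morm F n) :=
  @SRecipe (Morm F l) (Morm F n) ck_ob
    (fun X Y (f : chain_hom X Y) (g : chain_hom (ck_ob X) (ck_ob Y)) =>
       forall k : 'I_n.+1, g k ∘ ckp X k = ckp Y k ∘ f (ck_pos k)) _ _ _ _ _ _.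
Next Obligation.
move=> X Y f.
have f0 (k : 'I_n.+1) : (ckp Y k ∘ (f : chain_hom X Y) (ck_pos k)) ∘
    tmap (X : chain F l) (ck_le k) = 0.
  by rewrite -compA -cm_nat compA cokp0 ?comp0m.
have gn (i j : 'I_n.+1) (h : (i <= j)%N) :
    tmap (ck_ob Y) h ∘ cok_fact ex (tmap_infl (X : chain F l) (ck_le i)) (f0 i) = cok_fact ex (tmap_infl (X : chain F l) (ck_le j)) (f0 j) ∘ tmap (ck_ob X) h.
  apply: (cok_inj ex); rewrite -!compA cok_factE -/(ckp X i) ck_mapE.
  rewrite [RHS]compA [_ ∘ ckp X j]cok_factE compA ck_mapE -!compA.
  by rewrite cm_nat.
exists (@ChainHom _ _ (ck_ob X) (ck_ob Y) (fun k => cok_fact ex (tmap_infl (X : chain F l) (ck_le k)) (f0 k)) gn).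
by move=> k; apply: cok_factE.
Qed.
Next Obligation. by move=> X k /=; rewrite comp1m compm1. Qed.
Next Obligation.
by move=> X Y Z g f g' f' hg hf k /=; rewrite -compA hf compA hg compA.
Qed.
Next Obligation.
by move=> X Y f g f' g' hf hg k; rewrite !cmB compBl compBr hf hg.
Qed.
Next Obligation.
move=> X Y g hg; exists (zob (Morm F n)), 0, 0; split; first exact: projective_zob.
rewrite comp0m; apply: chain_homP => k; apply: (cok_inj ex).
by rewrite cm0 comp0m hg cm0 compm0.
Qed.
Next Obligation.
move=> Q /Morm_projective hQ; apply/Morm_projective => k.
have [s sE] := coker_injective ex (cok_conf (tmap_infl (Q : chain F l) (ck_le k)))
  ((proj_inj _).1 (hQ _)).
exact: (projective_retract sE (hQ _)).
Qed.

End Cokernels.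

(* the chain of pullbacks of X^(a+k) -> X^(b+1) <- P(X^(b+1)), k = 0,..,n *)
Section Pullbacks.
Variables (F : frobenius) (H : hulls F) (l n a b : nat).
Let ex := frob_exact F.

Definition pl_pos (k : nat) : 'I_l.+1 := clip l (minn b (a + k)).
Definition pl_end : 'I_l.+1 := clip l b.+1.

Lemma pl_pos_le (i j : 'I_n.+1) : (i <= j)%N -> (pl_pos i <= pl_pos j)%N.
Proof. by move=> h; apply: clip_homo; lia. Qed.

Lemma pl_le k : (pl_pos k <= pl_end)%N.
Proof. by apply: clip_homo; lia. Qed.

Definition pl_cov (X : chain F l) : hom (coverP H (X pl_end)) (X pl_end) :=
  coverp H (X pl_end).

Definition pl_defl (X : chain F l) : deflation (pl_cov X) := pcover_defl H _.

Definition pl (X : chain F l) (k : nat) : F :=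
  pb ex (tmap X (pl_le k)) (pl_defl X).
Definition pl1 (X : chain F l) (k : nat) : hom (pl X k) (X (pl_pos k)) :=
  pb1 ex (tmap X (pl_le k)) (pl_defl X).
Definition pl2 (X : chain F l) (k : nat) : hom (pl X k) (coverP H (X pl_end)) :=
  pb2 ex (tmap X (pl_le k)) (pl_defl X).

Lemma plE (X : chain F l) k : tmap X (pl_le k) ∘ pl1 X k = pl_cov X ∘ pl2 X k.
Proof. exact: pbE. Qed.

Lemma pl_map_eq (X : chain F l) (i j : 'I_n.+1) (h : (i <= j)%N) :
  tmap X (pl_le j) ∘ (tmap X (pl_pos_le h) ∘ pl1 X i) = pl_cov X ∘ pl2 X i.
Proof. by rewrite compA (tmapM X _ _ (pl_le i)) plE. Qed.

Definition pl_map (X : chain F l) (i j : 'I_n.+1) (h : (i <= j)%N) :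
  hom (pl X i) (pl X j) := pb_pair ex (pl_defl X) (pl_map_eq X h).

Lemma pl1_map (X : chain F l) (i j : 'I_n.+1) (h : (i <= j)%N) :
  pl1 X j ∘ pl_map X h = tmap X (pl_pos_le h) ∘ pl1 X i.
Proof. exact: pb1_pair. Qed.

Lemma pl2_map (X : chain F l) (i j : 'I_n.+1) (h : (i <= j)%N) :
  pl2 X j ∘ pl_map X h = pl2 X i.
Proof. exact: pb2_pair. Qed.

Lemma pl_inj (X : chain F l) k T (w w' : hom T (pl X k)) :
  pl1 X k ∘ w = pl1 X k ∘ w' -> pl2 X k ∘ w = pl2 X k ∘ w' -> w = w'.
Proof. exact: pb_inj. Qed.

Program Definition pl_ob (X : chain F l) : chain F n :=
  @Chain F n (pl X) (pl_map X) _ _ _.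
Next Obligation.
by move=> X i h; apply: pl_inj; rewrite (pl1_map, pl2_map) ?tmap1 ?comp1m compm1.
Qed.
Next Obligation.
move=> X i j k h1 h2 h3; apply: pl_inj; rewrite compA; last by rewrite !pl2_map.
by rewrite !pl1_map -compA pl1_map compA (tmapM X _ _ (pl_pos_le h3)).
Qed.
Next Obligation.
move=> X i j h; apply: (inflation_pullback ex (i := tmap X (pl_pos_le h))
  (d := pl1 X j) (q1 := pl1 X i)); [exact: tmap_infl|exact: pb1_defl|].
split=> [|T u v e]; first by rewrite pl1_map.
have e' : tmap X (pl_le i) ∘ u = pl_cov X ∘ (pl2 X j ∘ v).
  by rewrite -(tmapM X (pl_pos_le h) (pl_le j)) -compA e compA plE compA.
exists (pb_pair ex (pl_defl X) e'); split=> [|w [w1 w2]]; last first.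
  apply: pl_inj; first by rewrite [LHS]pb1_pair.
  by rewrite [LHS]pb2_pair -w2 compA pl2_map.
split; first exact: pb1_pair.
apply: pl_inj; rewrite compA.
  by rewrite pl1_map -compA [pl1 _ _ ∘ _]pb1_pair.
by rewrite pl2_map [LHS]pb2_pair.
Qed.

Program Definition pl_recipe : srecipe (Morm F l) (Morm F n) :=
  @SRecipe (Morm F l) (Morm F n) pl_ob
    (fun X Y (f : chain_hom X Y) (g : chain_hom (pl_ob X) (pl_ob Y)) =>
       exists2 h : hom (coverP H ((X : chain F l) pl_end))
                       (coverP H ((Y : chain F l) pl_end)),
         pl_cov Y ∘ h = f pl_end ∘ pl_cov X &
         forall k : 'I_n.+1, pl1 Y k ∘ g k = f (pl_pos k) ∘ pl1 X k /\
                             pl2 Y k ∘ g k = h ∘ pl2 X k) _ _ _ _ _ _.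
Next Obligation.
move=> X Y f; set f_ := (f : chain_hom X Y).
have [h hE] := pcover_proj (f_ pl_end ∘ pl_cov X) (pl_defl Y).
have e (k : 'I_n.+1) : tmap (Y : chain F l) (pl_le k) ∘ (f_ (pl_pos k) ∘ pl1 X k) =
    pl_cov Y ∘ (h ∘ pl2 X k).
  by rewrite !compA hE cm_nat -!compA plE.
have gn (i j : 'I_n.+1) (hij : (i <= j)%N) :
    tmap (pl_ob Y) hij ∘ pb_pair ex (pl_defl Y) (e i) =
    pb_pair ex (pl_defl Y) (e j) ∘ tmap (pl_ob X) hij.
  apply: pl_inj; rewrite /= !compA.
    rewrite pl1_map -[LHS]compA [pl1 _ _ ∘ _]pb1_pair.
    rewrite [pl1 _ _ ∘ _]pb1_pair -[RHS]compA pl1_map compA cm_nat.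
    by rewrite !compA.
  by rewrite pl2_map [LHS]pb2_pair [pl2 _ _ ∘ _]pb2_pair -compA pl2_map.
exists (@ChainHom _ _ (pl_ob X) (pl_ob Y) (fun k => pb_pair ex (pl_defl Y) (e k)) gn).
by exists h => // k; split; [exact: pb1_pair | exact: pb2_pair].
Qed.
Next Obligation.
move=> X; exists (idm _) => [|k] /=; first by rewrite comp1m compm1.
by rewrite !compm1 !comp1m.
Qed.
Next Obligation.
move=> X Y Z g f g' f' [h hE hg] [h' h'E hf]; exists (h ∘ h').
  by rewrite compA hE -compA h'E compA.
move=> k /=; have [g1 g2] := hg k; have [f1 f2] := hf k.
by split; rewrite compA (g1, g2) -[LHS]compA (f1, f2) compA.
Qed.
Next Obligation.
move=> X Y f g f' g' [h hE hf] [h' h'E hg]; exists (h - h').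
  by rewrite compBr cmB compBl hE h'E.
move=> k; have [g1 g2] := hg k; have [f1 f2] := hf k.
by rewrite !cmB !compBl !compBr f1 f2 g1 g2.
Qed.
Next Obligation.
move=> X Y g [h hE hg].
pose P := coverP H ((X : chain F l) pl_end).
have Pd (i j : nat) : (i <= j)%N -> predT j -> predT i by [].
pose S := step_chain n Pd (infl_id ex P).
have e (k : 'I_n.+1) : tmap (Y : chain F l) (pl_le k) ∘ 0 = pl_cov Y ∘ h.
  by rewrite compm0 hE comp0m.
have un (i j : 'I_n.+1) (hij : (i <= j)%N) :
    tmap S hij ∘ pl2 X i = pl2 X j ∘ tmap (pl_ob X) hij.
  by rewrite /= comp1m pl2_map.
have vn (i j : 'I_n.+1) (hij : (i <= j)%N) :
    tmap (pl_ob Y) hij ∘ pb_pair ex (pl_defl Y) (e i) =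
    pb_pair ex (pl_defl Y) (e j) ∘ tmap S hij.
  rewrite /= compm1; apply: pl_inj; rewrite compA.
    by rewrite pl1_map -compA ![pl1 _ _ ∘ _]pb1_pair compm0.
  by rewrite pl2_map ![pl2 _ _ ∘ _]pb2_pair.
exists (S : Morm F n), (@ChainHom _ _ (pl_ob X) S (fun k => pl2 X k) un),
  (@ChainHom _ _ S (pl_ob Y) (fun k => pb_pair ex (pl_defl Y) (e k)) vn); split.
  by apply/Morm_projective => k; apply: pcover_proj.
apply: chain_homP => k /=; have [g1 g2] := hg k.
apply: pl_inj; rewrite compA.
  by rewrite g1 [pl1 _ _ ∘ pb_pair _ _ _]pb1_pair !comp0m.
by rewrite g2 [pl2 _ _ ∘ pb_pair _ _ _]pb2_pair.
Qed.
Next Obligation.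
move=> Q /Morm_projective hQ; apply/Morm_projective => k.
suff [s sE] : exists s, s ∘ pl1 Q k = idm _ by exact: (projective_retract sE (hQ _)).
have [j jE] : exists j, j ∘ pl_cov Q = idm _.
  rewrite /pl_cov /coverp /coverP (pcover_id H (hQ _)) /=.
  by exists (idm _); rewrite comp1m.
have pj : pl_cov Q ∘ j = idm _.
  move: jE; rewrite /pl_cov; move: j; rewrite /coverp /coverP (pcover_id H (hQ _)) /=.
  by move=> j; rewrite compm1 => ->; rewrite comp1m.
have e : tmap (Q : chain F l) (pl_le k) ∘ idm _ =
    pl_cov Q ∘ (j ∘ tmap (Q : chain F l) (pl_le k)).
  by rewrite compm1 compA pj comp1m.
exists (pb_pair ex (pl_defl Q) e); apply: pl_inj; rewrite compA compm1.
  by rewrite [pl1 _ _ ∘ pb_pair _ _ _]pb1_pair comp1m.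
rewrite [pl2 _ _ ∘ pb_pair _ _ _]pb2_pair -compA plE compA jE comp1m.
by [].
Qed.

End Pullbacks.

(* the chain 0 = .. = 0 -> X^0 -> .. -> X^n -> I(X^n) = .. = I(X^n), with X^0 at
   position a and X^n at position b = a + n *)
Section Extension.
Variables (F : frobenius) (H : hulls F).
Let ex := frob_exact F.

Inductive ext (n : nat) := Below | Inside of 'I_n.+1 | Above.
Arguments Below {n}.
Arguments Above {n}.

Definition ext_le n (e e' : ext n) : bool :=
  match e, e' with
  | Below, _ | _, Above => true
  | Inside i, Inside j => (i <= j)%N
  | _, _ => false
  end.

Section ExtOb.
Variables (n : nat) (X : chain F n).

Definition xhull : hom (X ord_max) (hullI H (X ord_max)) := hulli H (X ord_max).

Definition ext_ob (e : ext n) : F :=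
  match e with
  | Below => zob F | Inside i => X i | Above => hullI H (X ord_max)
  end.

Definition ext_map (e e' : ext n) : ext_le e e' -> hom (ext_ob e) (ext_ob e') :=
  match e, e' return ext_le e e' -> hom (ext_ob e) (ext_ob e') with
  | Below, _ => fun _ => 0
  | Inside i, Inside j => fun h => tmap X h
  | Inside i, Above =>
      fun _ => xhull ∘ tmap X (leq_ord i : (i <= @ord_max n)%N)
  | Above, Above => fun _ => idm _
  | _, _ => fun _ => 0
  end.

Lemma ext_map1 e (h : ext_le e e) : ext_map h = idm (ext_ob e).
Proof. by case: e h => [|i|] //= h; [exact/esym/zob_init | apply: tmap1]. Qed.

Lemma ext_mapM e1 e2 e3 (h12 : ext_le e1 e2) (h23 : ext_le e2 e3)
  (h13 : ext_le e1 e3) : ext_map h23 ∘ ext_map h12 = ext_map h13.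
Proof.
case: e1 h12 h13 => [|i|]; case: e2 h23 => [|j|]; case: e3 => [|k|] //=;
  intros; rewrite ?compm0 ?comp1m //; first exact: tmapM.
by rewrite -compA (tmapM X _ _ (leq_ord i : (i <= @ord_max n)%N)).
Qed.

Lemma xhull_infl : inflation xhull. Proof. exact: ihull_infl. Qed.

Lemma ext_map_infl e e' (h : ext_le e e') : inflation (ext_map h).
Proof.
case: e h => [|i|]; case: e' => [|j|] //= h; try exact: inflation_zob.
- exact: tmap_infl.
- by apply: infl_comp => //; [exact: tmap_infl | exact: xhull_infl].
- exact: infl_id.
Qed.

End ExtOb.

Definition ext_hom n (X Y : chain F n) (f : chain_hom X Y)
    (h : hom (hullI H (X ord_max)) (hullI H (Y ord_max))) (e : ext n) :
    hom (ext_ob X e) (ext_ob Y e) :=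
  match e with Below => 0 | Inside i => f i | Above => h end.

Lemma ext_homB n (X Y : chain F n) (f g : chain_hom X Y)
    (h h' : hom (hullI H (X ord_max)) (hullI H (Y ord_max))) e :
  ext_hom f h e - ext_hom g h' e = ext_hom (f - g) (h - h') e.
Proof. by case: e => [|i|] //=; rewrite subrr. Qed.

Variables (n l a b : nat).

Definition xpos (k : nat) : ext n :=
  if (k < a)%N then Below
  else if (k <= b)%N then Inside (clip n (k - a))
  else Above.

Lemma xpos_le i j : (i <= j)%N -> ext_le (xpos i) (xpos j).
Proof.
rewrite /xpos => h; case: (ltnP i a) => // ia.
case: (ltnP j a) => [|ja]; first lia.
case: (leqP i b) => ib; case: (leqP j b) => jb //=; lia.
Qed.

Program Definition x_ob (X : chain F n) : chain F l :=
  @Chain F l (fun k => ext_ob X (xpos k))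
    (fun i j h => ext_map X (xpos_le h)) _ _ _.
Next Obligation. by move=> X i h; apply: ext_map1. Qed.
Next Obligation. by move=> X i j k h1 h2 h3; apply: ext_mapM. Qed.
Next Obligation. by move=> X i j h; apply: ext_map_infl. Qed.

Program Definition x_recipe : srecipe (Morm F n) (Morm F l) :=
  @SRecipe (Morm F n) (Morm F l) x_ob
    (fun X Y (f : chain_hom X Y) (g : chain_hom (x_ob X) (x_ob Y)) =>
       exists2 h, h ∘ xhull X = xhull Y ∘ f ord_max &
                  forall k : 'I_l.+1, g k = ext_hom f h (xpos k)) _ _ _ _ _ _.
Next Obligation.
move=> X Y f.
have [h hE] := ihull_inj (xhull Y ∘ (f : chain_hom X Y) ord_max) (xhull_infl X).
have en e e' (le : ext_le e e') :
    ext_map Y le ∘ ext_hom f h e = ext_hom f h e' ∘ ext_map X le.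
  case: e le => [|i|]; case: e' => [|j|] //= le; rewrite ?compm0 ?comp0m //.
  - exact: cm_nat.
  - by rewrite compA hE -!compA cm_nat.
  - by rewrite comp1m compm1.
have gn (i j : 'I_l.+1) (le : (i <= j)%N) :
    tmap (x_ob Y) le ∘ ext_hom f h (xpos i) = ext_hom f h (xpos j) ∘ tmap (x_ob X) le.
  exact: en.
by exists (@ChainHom _ _ (x_ob X) (x_ob Y) (fun k => ext_hom f h (xpos k)) gn), h.
Qed.
Next Obligation.
move=> X; exists (idm _) => [|k] /=; first by rewrite comp1m compm1.
by case: (xpos k) => //=; apply: zob_init.
Qed.
Next Obligation.
move=> X Y Z g f g' f' [h hE hg] [h' h'E hf]; exists (h ∘ h').
  by rewrite -compA h'E !compA hE.
by move=> k /=; rewrite hg hf; case: (xpos k) => //=; rewrite compm0.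
Qed.
Next Obligation.
move=> X Y f g f' g' [h hE hf] [h' h'E hg]; exists (h - h').
  by rewrite compBl cmB compBr hE h'E.
by move=> k; rewrite cmB hg hf; apply: ext_homB.
Qed.
Next Obligation.
move=> X Y g [h hE hg].
pose I := hullI H ((Y : chain F n) ord_max).
pose P (k : nat) := if xpos k is Above then false else true.
have Pd (i j : nat) : (i <= j)%N -> P j -> P i.
  by move=> /xpos_le; rewrite /P; case: (xpos i); case: (xpos j).
pose S := step_chain l Pd (inflation_zob ex I).
pose below (e : ext n) := if e is Above then false else true.
pose u (e : ext n) : hom (ext_ob X e) (step_ob (zob F) I (below e)) :=
  match e return hom (ext_ob X e) (step_ob (zob F) I (below e)) with
  | Above => h | _ => 0 end.
pose v (e : ext n) : hom (step_ob (zob F) I (below e)) (ext_ob Y e) :=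
  match e return hom (step_ob (zob F) I (below e)) (ext_ob Y e) with
  | Above => idm I | _ => 0 end.
have h0 : h ∘ xhull X = 0 by rewrite hE cm0 compm0.
have un (i j : 'I_l.+1) (le : (i <= j)%N) :
    tmap S le ∘ u (xpos i) = u (xpos j) ∘ tmap (x_ob X) le.
  rewrite /= /P; move: (xpos_le le).
  case: (xpos i) => [|x|]; case: (xpos j) => [|y|] //= le'.
  all: rewrite ?compm0 ?comp0m ?comp1m ?compm1 //.
  by rewrite compA h0 comp0m.
have vn (i j : 'I_l.+1) (le : (i <= j)%N) :
    tmap (x_ob Y) le ∘ v (xpos i) = v (xpos j) ∘ tmap S le.
  rewrite /= /P; move: (xpos_le le).
  case: (xpos i) => [|x|]; case: (xpos j) => [|y|] //= le'.
  all: rewrite ?compm0 ?comp0m ?comp1m ?compm1 //.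
exists (S : Morm F l), (@ChainHom _ _ (x_ob X) S (fun k => u (xpos k)) un),
  (@ChainHom _ _ S (x_ob Y) (fun k => v (xpos k)) vn); split.
  apply/Morm_projective => k /=; case: (P k) => /=; first exact: projective_zob.
  exact/proj_inj/ihull_inj.
have uv e : ext_hom (0 : chain_hom X Y) h e = v e ∘ u e.
  by case: e => [|x|] /=; rewrite ?comp0m ?comp1m.
by apply: chain_homP => k; rewrite hg; apply: uv.
Qed.
Next Obligation.
move=> Q /Morm_projective hQ; apply/Morm_projective => k /=.
case: (xpos k) => [|x|] /=; first exact: projective_zob.
  exact: hQ.
exact/proj_inj/ihull_inj.
Qed.

End Extension.

Section Functors.
Variables (F : frobenius) (H : hulls F).
Local Notation M l := (sMorm F l).

(* deletion of the c terms at the positions a,..,a+c-1 *)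
Definition omit_pos (a c k : nat) : nat := if (k < a)%N then k else (k + c)%N.

Lemma omit_pos_homo a c : {homo omit_pos a c : i j / (i <= j)%N}.
Proof.
by move=> i j h; rewrite /omit_pos; case: (ltnP i a) => ?; case: (ltnP j a) => ?; lia.
Qed.

Definition omit l n a c : functor (M l) (M n) :=
  sfunctor (reindex_recipe F l n (@omit_pos_homo a c)).

(* In what follows [a,b] is a subinterval of {0,..,l}. *)

(* gamma^[a,b], with n = l - (b - a) - 1 *)
Definition gamma l n a b : functor (M l) (M n) := omit l n a (b.+1 - a).

Definition repeat_pos (a b k : nat) : nat :=
  if (k < a)%N then k else if (k <= b)%N then a else (k - (b - a))%N.

Lemma repeat_pos_homo a b : {homo repeat_pos a b : i j / (i <= j)%N}.
Proof.
move=> i j h; rewrite /repeat_pos; case: (ltnP i a) => ?; case: (ltnP j a) => ?;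
  by case: (leqP i b) => ?; case: (leqP j b) => ?; lia.
Qed.

(* delta^[a,b], with n = l - (b - a) *)
Definition delta n l a b : functor (M n) (M l) :=
  sfunctor (reindex_recipe F n l (@repeat_pos_homo a b)).

(* delta^([a,b]^c), with n = b - a *)
Definition delta_c n l a b : functor (M n) (M l) := sfunctor (x_recipe H n l a b).

(* hat-gamma^([a,b]^c), with n = b - a *)
Definition hat_gamma l n a b : functor (M l) (M n) :=
  if a is a'.+1 then sfunctor (ck_recipe F l n a') else omit l n b.+1 (l - b).

(* check-gamma^([a,b]^c), with n = b - a *)
Definition check_gamma l n a b : functor (M l) (M n) :=
  if (b < l)%N then sfunctor (pl_recipe H l n a b) else omit l n 0 a.

(* The description of Theta X is that of the chain of cokernels of X^0 -> X^k,
   k = 1,..,n+1, for the extended chain X^0 -> .. -> X^n -> I(X^n) = X^(n+1). *)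
Definition Theta n : functor (M n) (M n) :=
  hat_gamma n.+1 n 1 n.+1 ⊙ delta_c n n.+1 0 n.

(* Similarly with the pullbacks along P(Y^n) -> Y^n of the terms but the last
   of 0 -> Y^0 -> .. -> Y^n. *)
Definition Theta_inv n : functor (M n) (M n) :=
  check_gamma n.+1 n 0 n ⊙ delta_c n n.+1 1 n.+1.

Definition powF (C : precat) (T : functor C C) (k : nat) : functor C C :=
  iter k (compF T) (idF C).

Definition Theta_pow n (z : int) : functor (M n) (M n) :=
  match z with
  | Posz k => powF (Theta n) k
  | Negz k => powF (Theta_inv n) k.+1
  end.

Variables (l m n : nat).

Definition hatF (j : nat) : functor (M l) (M n) :=
  Theta_pow n j%:Z ⊙ hat_gamma l n (m.+1 - j) (l - j).
Definition hatG (j : nat) : functor (M n) (M l) :=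
  delta_c n l (m.+1 - j) (l - j) ⊙ Theta_pow n (- j%:Z).
Definition checkF (k : nat) : functor (M n) (M l) :=
  delta_c n l k (k + n) ⊙ Theta_pow n k%:Z.
Definition checkG (k : nat) : functor (M l) (M n) :=
  Theta_pow n (- k%:Z) ⊙ check_gamma l n k (k + n).

(* The finite chain of adjunctions
     hatF (m+1) -| hatG (m+1) -| .. -| hatF 0 -| hatG 0
       -| gamma^[0,m] -| delta^[0,m+1] -| .. -| delta^[n,n+m+1] -| gamma^[n+1,l]
       -| checkF 0 -| checkG 0 -| .. -| checkF (m+1) -| checkG (m+1),
   where l = m + n + 1, with U and V applied to its terms. *)
Definition adjunction_chain (U : functor (M l) (M n) -> functor (M l) (M n))
    (V : functor (M n) (M l) -> functor (M n) (M l)) : Prop :=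
  [/\ (forall j, (j <= m.+1)%N -> U (hatF j) ⊣ V (hatG j)) /\
      (forall j, (j < m.+1)%N -> V (hatG j.+1) ⊣ U (hatF j)),
      V (hatG 0) ⊣ U (gamma l n 0 m),
      forall k, (k <= n)%N ->
        U (gamma l n k (k + m)) ⊣ V (delta n l k (k + m.+1)) /\
        V (delta n l k (k + m.+1)) ⊣ U (gamma l n k.+1 (k.+1 + m)),
      U (gamma l n n.+1 l) ⊣ V (checkF 0)
    & (forall k, (k <= m.+1)%N -> V (checkF k) ⊣ U (checkG k)) /\
      (forall k, (k < m.+1)%N -> U (checkG k) ⊣ V (checkF k.+1))].

End Functors.

Arguments gamma {F}.
Arguments delta {F}.
Arguments adjunction_chain {F} H l m n U V.

(* Main.v *)
(* The functors gamma and delta reindex chains along monotone maps between the posets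
   {0,..,n} and {0,..,l}, and each adjunction between them is a Galois connection. The adjunctions hat-gamma -| delta_c -| check-gamma
   are the universal properties of cokernels and pullbacks, valid up to chain maps
   that factor through a chain 0 = .. = 0 -> P = .. = P with P projective. They
   give Theta -| Theta^-1. Moreover hat-gamma^([a+1,b+1]^c) is bijective on maps out
   of a chain delta_c^([a,b]^c) Y, and its composite with delta_c^([a,b]^c) is Theta.
   Hence Theta is fully faithful; it is essentially surjective because Z is the
   chain of cokernels of the pullbacks of 0 -> Z^0 -> .. -> Z^n = Z^n along
   P(Z^n) -> Z^n. So Theta is an equivalence, and by uniqueness of adjoints
   check-gamma^([a,b]^c) = Theta^-1 hat-gamma^([a+1,b+1]^c), which yields the
   adjunctions across consecutive functors. *)

From mathcomp Require Import all_boot all_algebra zify.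
From mathcomp Require Import boolp.
Require Import Defs.

Set Implicit Arguments.
Unset Strict Implicit.
Unset Printing Implicit Defensive.

Import GRing.Theory.
Local Open Scope ring_scope.

(** * Natural isomorphisms and adjunctions *)

(** Hulls and covers are functorial only up to maps through projectives, so units and transposes are
    awkward to define on stable morphisms directly. Everything is done on representatives: a strict
    chain map serves as unit or counit, strictly natural for suitable induced maps, and
    transposition is shown to be onto and to kill only null maps; [stable_adjoint_unit] and
    [stable_adjoint_counit] pass to the quotient. The freedom in extending over a hull is a map
    through a chain 0 = .. = 0 -> P = .. = P, hence a null lemma next to each extension lemma. A
    second obstacle: composing the two universal properties makes [Theta_inv] only a right adjoint
    of [Theta], whereas moving the interval by one also needs it as a left adjoint. Full
    faithfulness of [Theta] uses both properties of hull terms: maps into an extended chain extend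
    because hulls are injective, and maps out of it lift through projections onto cokernels because
    hulls are projective. *)

Lemma inj_surj_bij (S T : Type) (f : S -> T) :
  injective f -> (forall y, exists x, f x = y) -> bijective f.
Proof.
move=> fI /choice[g gK]; exists g => // x.
by apply: fI; rewrite gK.
Qed.

Lemma dep_choice (I : Type) (T : I -> Type) (P : forall i, T i -> Prop) :
  (forall i, exists x, P i x) -> exists f : forall i, T i, forall i, P i (f i).
Proof. by move=> h; exists (fun i => projT1 (cid (h i))) => i; case: cid. Qed.

Definition natiso (C D : precat) (F G : functor C D) : Prop :=
  exists t : forall A, hom (F A) (G A),
    (forall A, is_iso (t A)) /\
    forall A B (f : hom A B), t B ∘ fmap F f = fmap G f ∘ t A.

Definition fully_faithful (C D : precat) (F : functor C D) : Prop :=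
  forall A B, bijective (fun f : hom A B => fmap F f).

Section Isos.
Variable C : precat.

Lemma is_iso_comp (A B K : C) (g : hom B K) (f : hom A B) :
  is_iso g -> is_iso f -> is_iso (g ∘ f).
Proof.
move=> [g' gK Kg] [f' fK Kf]; exists (f' ∘ g').
  by rewrite -compA [g' ∘ _]compA gK comp1m.
by rewrite -compA [f ∘ _]compA Kf comp1m.
Qed.

Lemma iso_precomp_bij (A B K : C) (f : hom A B) :
  is_iso f -> bijective (fun g : hom B K => g ∘ f).
Proof.
move=> [g gK Kg]; exists (fun h => h ∘ g) => h; rewrite -compA.
  by rewrite Kg compm1.
by rewrite gK compm1.
Qed.

Lemma iso_postcomp_bij (A B K : C) (f : hom A B) :
  is_iso f -> bijective (fun g : hom K A => f ∘ g).
Proof.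
move=> [g gK Kg]; exists (fun h => g ∘ h) => h; rewrite compA.
  by rewrite gK comp1m.
by rewrite Kg comp1m.
Qed.

End Isos.

Lemma fmap_iso (C D : precat) (F : functor C D) (A B : C) (f : hom A B) :
  is_iso f -> is_iso (fmap F f).
Proof.
by move=> [g gK Kg]; exists (fmap F g); rewrite -fmapM (gK, Kg) fmap1.
Qed.

Section Functors.
Variables C D E : precat.

Lemma natiso_refl (F : functor C D) : natiso F F.
Proof.
exists (fun A => idm (F A)); split=> [A|A B f]; first by exists (idm (F A)); rewrite comp1m.
by rewrite comp1m compm1.
Qed.

Lemma natiso_sym (F G : functor C D) : natiso F G -> natiso G F.
Proof.
move=> [t [ti tn]].
have /dep_choice[s sP] A : exists s : hom (G A) (F A), s ∘ t A = idm _ /\ t A ∘ s = idm _.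
  by have [s] := ti A; exists s.
exists s; split=> [A|A B f]; first by have [] := sP A; exists (t A).
have [s1 _] := sP B; have [_ s2] := sP A.
rewrite -[fmap G f]compm1 -s2 [fmap G f ∘ _]compA -tn.
by rewrite !compA s1 comp1m.
Qed.

Lemma natiso_trans (G F H : functor C D) :
  natiso F G -> natiso G H -> natiso F H.
Proof.
move=> [t [ti tn]] [s [si sn]]; exists (fun A => s A ∘ t A); split=> [A|A B f].
  exact: is_iso_comp.
by rewrite -compA tn compA sn compA.
Qed.

Lemma natiso_whisker_l (G : functor D E) (F F' : functor C D) :
  natiso F F' -> natiso (G ⊙ F) (G ⊙ F').
Proof.
move=> [t [ti tn]]; exists (fun A => fmap G (t A)); split=> [A|A B f] /=.
  exact: fmap_iso.
by rewrite -!fmapM tn.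
Qed.

Lemma natiso_whisker_r (G G' : functor D E) (F : functor C D) :
  natiso G G' -> natiso (G ⊙ F) (G' ⊙ F).
Proof.
move=> [t [ti tn]]; exists (fun A => t (F A)); split=> [A|A B f] /=.
  exact: ti.
exact: tn.
Qed.

Lemma adjoint_comp (F : functor C D) (G : functor D C) (F' : functor D E)
    (G' : functor E D) : F ⊣ G -> F' ⊣ G' -> F' ⊙ F ⊣ G ⊙ G'.
Proof.
move=> [p [pb p1 p2]] [q [qb q1 q2]].
exists (fun A B f => p A (G' B) (q (F A) B f)); split=> [A B|A A' B f g|A B B' h g].
- exact: (bij_comp (pb _ _) (qb _ _)).
- by rewrite -p1 -q1.
- by rewrite -p2 -q2.
Qed.

Lemma adjoint_natiso_l (F F' : functor C D) (G : functor D C) :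
  natiso F F' -> F ⊣ G -> F' ⊣ G.
Proof.
move=> [t [ti tn]] [p [pb p1 p2]].
exists (fun A B f => p A B (f ∘ t A)); split=> [A B|A A' B f g|A B B' h g].
- exact: (bij_comp (pb _ _) (iso_precomp_bij _ (ti A))).
- by rewrite -p1 -!compA tn.
- by rewrite -p2 compA.
Qed.

Lemma adjoint_natiso_r (F : functor C D) (G G' : functor D C) :
  natiso G G' -> F ⊣ G -> F ⊣ G'.
Proof.
move=> [t [ti tn]] [p [pb p1 p2]].
exists (fun A B f => t B ∘ p A B f); split=> [A B|A A' B f g|A B B' h g].
- exact: (bij_comp (iso_postcomp_bij _ (ti B)) (pb _ _)).
- by rewrite p1 compA.
- by rewrite p2 !compA tn.
Qed.

(* Associativity of composition holds only on objects and morphisms, not for the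
   records of functors with their proofs. *)
Lemma adjoint_assoc_l (B : precat) (K : functor D E) (G : functor C D)
    (F : functor B C) (R : functor E B) :
  K ⊙ G ⊙ F ⊣ R -> K ⊙ (G ⊙ F) ⊣ R.
Proof. by []. Qed.

Lemma adjoint_assoc_r (B : precat) (K : functor D E) (G : functor C D)
    (F : functor B C) (L : functor E B) :
  L ⊣ K ⊙ G ⊙ F -> L ⊣ K ⊙ (G ⊙ F).
Proof. by []. Qed.

Lemma natiso_assoc_l (B : precat) (K : functor D E) (G : functor C D)
    (F : functor B C) (R : functor B E) :
  natiso (K ⊙ G ⊙ F) R -> natiso (K ⊙ (G ⊙ F)) R.
Proof. by []. Qed.

(** The comparison is the transpose, under the second adjunction, of the counit of the first;
    exchanging the roles gives its inverse. *)
Lemma right_adjoint_unique (F : functor C D) (G G' : functor D C) :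
  F ⊣ G -> F ⊣ G' -> natiso G G'.
Proof.
move=> [p [pb p1 p2]] [q [qb q1 q2]].
have /dep_choice[x px] B : exists x : hom (F (G B)) B, p _ _ x = idm _.
  by have [p' _ Kp] := pb (G B) B; exists (p' (idm _)).
have /dep_choice[y qy] B : exists y : hom (F (G' B)) B, q _ _ y = idm _.
  by have [q' _ Kq] := qb (G' B) B; exists (q' (idm _)).
exists (fun B => q _ _ (x B)); split=> [B|A B f].
  exists (p _ _ (y B)).
    rewrite -p1 -px; congr (p _ _ _); apply: (bij_inj (qb _ _)).
    by rewrite q1 qy comp1m.
  rewrite -q1 -qy; congr (q _ _ _); apply: (bij_inj (pb _ _)).
  by rewrite p1 px comp1m.
rewrite -q1 -q2; congr (q _ _ _); apply: (bij_inj (pb _ _)).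
by rewrite p1 p2 !px comp1m compm1.
Qed.

Lemma fully_faithful_comp (G : functor D E) (F : functor C D) :
  (forall A B, bijective (fun f : hom (F A) (F B) => fmap G f)) ->
  fully_faithful F -> fully_faithful (G ⊙ F).
Proof. by move=> Gb Fb A B; exact: (bij_comp (Gb A B) (Fb A B)). Qed.

(* [fmap G] identifies Hom(F A, B) with Hom(G F A, G B) = Hom(A, R G B). *)
Lemma adjoint_cancel (F : functor C D) (G : functor D E) (R : functor E C) :
  G ⊙ F ⊣ R -> (forall A B, bijective (fun f : hom (F A) B => fmap G f)) ->
  F ⊣ R ⊙ G.
Proof.
move=> [p [pb p1 p2]] Gb; exists (fun A B f => p A (G B) (fmap G f)).
split=> [A B|A A' B f g|A B B' h g].
- exact: (bij_comp (pb _ _) (Gb A B)).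
- by rewrite -p1 fmapM.
- by rewrite -p2 fmapM.
Qed.

Lemma adjoint_id : idF C ⊣ idF C.
Proof. by exists (fun A B f => f); split=> // A B; exists id. Qed.

(** At an object [F A] the counit has [fmap F] of the unit as a right inverse, and full faithfulness
    makes this two-sided. Naturality along an isomorphism from some [F A] carries invertibility to
    every object. *)
Lemma counit_natiso (F : functor C D) (G : functor D C) :
  F ⊣ G -> fully_faithful F -> (forall B, exists A (s : hom (F A) B), is_iso s) ->
  natiso (F ⊙ G) (idF D).
Proof.
move=> [p [pb p1 p2]] Fb Fs.
have /dep_choice[x px] B : exists x : hom (F (G B)) B, p _ _ x = idm _.
  by have [p' _ Kp] := pb (G B) B; exists (p' (idm _)).
have xn A B (f : hom A B) : x B ∘ fmap F (fmap G f) = f ∘ x A.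
  by apply: (bij_inj (pb _ _)); rewrite p1 p2 !px comp1m compm1.
have xF A : is_iso (x (F A)).
  have xu : x (F A) ∘ fmap F (p _ _ (idm (F A))) = idm _.
    by apply: (bij_inj (pb _ _)); rewrite p1 px comp1m.
  have [k kK Kk] := Fb (G (F A)) A.
  exists (fmap F (p _ _ (idm (F A)))) => //.
  have ux : p _ _ (idm (F A)) ∘ k (x (F A)) = idm _.
    by rewrite -p1 Kk comp1m px.
  by rewrite -[x (F A)]Kk -fmapM ux fmap1.
exists x; split=> // B; have [A [s si]] := Fs B.
have [s' sK Ks] := si; rewrite -[x B]compm1.
have [t tK Kt] := fmap_iso (compF F G) si.
rewrite -[idm _]Kt compA (xn _ _ s); apply: is_iso_comp.
  exact: (is_iso_comp si (xF A)).
by exists (fmap (compF F G) s).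
Qed.

End Functors.

Lemma natiso_cancel (C D E : precat) (S : functor D C) (T : functor C D)
    (F : functor E D) :
  natiso (T ⊙ S) (idF D) -> natiso (T ⊙ (S ⊙ F)) F.
Proof. exact: natiso_whisker_r. Qed.

(** Being isomorphic to the identity, [F ⊙ G] is left adjoint to the identity, and [adjoint_cancel]
    strips off the fully faithful [F]. *)
Lemma adjoint_equivalence (C D : precat) (F : functor C D) (G : functor D C) :
  fully_faithful F -> natiso (F ⊙ G) (idF D) -> G ⊣ F.
Proof.
move=> Fb e; suff : G ⊣ idF D ⊙ F by [].
apply: adjoint_cancel => [|A B]; last exact: Fb.
apply: (@adjoint_natiso_l _ _ (idF D)); last exact: adjoint_id.
exact: natiso_sym.
Qed.

(** * Adjunctions between stable categories *)

Section StablyNull.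
Variable C : confcat.

Lemma factors_proj0 (A B : C) : factors_proj (0 : hom A B).
Proof.
by exists (zob C), 0, 0; rewrite comp0m; split=> //; exact: projective_zob.
Qed.

Lemma factors_projD (A B : C) (f g : hom A B) :
  factors_proj f -> factors_proj g -> factors_proj (f + g).
Proof.
move=> f0 g0; have /spi_eq ef : factors_proj (f - 0) by rewrite subr0.
have /spi_eq eg : factors_proj (g - 0) by rewrite subr0.
by rewrite -[f + g]subr0; apply/spi_eq; rewrite spiD ef eg -spiD addr0.
Qed.

Lemma factors_proj_sub (A B : C) (f g : hom A B) :
  factors_proj g -> factors_proj (f - g) -> factors_proj f.
Proof. by move=> g0 fg; rewrite -[f](subrK g); exact: factors_projD. Qed.

Lemma spi0 (A B : C) (f : hom A B) : spi f = 0 <-> factors_proj f.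
Proof. by rewrite -[f in factors_proj f]subr0 -spi_eq /spi raddf0. Qed.

Lemma stable_compE (A B E : C) (g : hom B E) (f : hom A B) :
  @mcomp (stable C) A B E (spi g) (spi f) = spi (g ∘ f).
Proof. exact: scompE. Qed.

Lemma spi_iso (A B : C) (f : hom A B) :
  is_iso f -> @is_iso (stable C) A B (spi f).
Proof.
move=> [g gK Kg].
by exists (spi g : @hom (stable C) B A); rewrite stable_compE (gK, Kg).
Qed.

End StablyNull.

Lemma sfunctorE (C D : confcat) (r : srecipe C D) (A B : C) (f : hom A B) g :
  sind f g -> fmap (sfunctor r) (spi f) = spi g.
Proof. exact: sfmapE. Qed.

Lemma additive_bij (U V : zmodType) (f : U -> V) :
  {morph f : x y / x - y} -> (forall x, f x = 0 -> x = 0) ->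
  (forall y, exists x, f x = y) -> bijective f.
Proof.
move=> fB f0 fS; apply: inj_surj_bij => // x y e.
by apply/subr0_eq/f0; rewrite fB e subrr.
Qed.

Section StableCriteria.
Variables C D : confcat.

Lemma sfunctor_bij (r : srecipe C D) (X Y : C) :
  (forall g : hom (sob r X) (sob r Y), exists (f : hom X Y) f',
    sind f f' /\ factors_proj (f' - g)) ->
  (forall (f : hom X Y) (f' : hom (sob r X) (sob r Y)),
    sind f f' -> factors_proj f' -> factors_proj f) ->
  bijective (fun f : @hom (stable C) X Y => fmap (sfunctor r) f).
Proof.
move=> rS rI; apply: additive_bij => [x y|x|y]; first exact: fmapB.
  have [f ->] := srepr x; have [f' ff'] := sind_ex r f.
  rewrite (sfunctorE ff') => /spi0 f'0; apply/spi0; exact: rI ff' f'0.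
have [g ->] := srepr y; have [f [f' [ff' fg]]] := rS g.
by exists (spi f); rewrite (sfunctorE ff'); apply/spi_eq.
Qed.

Variables (r : srecipe C D) (r' : srecipe D C).

Lemma stable_adjoint_unit (eta : forall X : C, hom X (sob r' (sob r X))) :
  (forall X X' (v : hom X X'), exists (v1 : hom (sob r X) (sob r X')) v2,
    [/\ sind v v1, sind v1 v2 & v2 ∘ eta X = eta X' ∘ v]) ->
  (forall X Y (g : hom X (sob r' Y)), exists (f : hom (sob r X) Y) f',
    sind f f' /\ f' ∘ eta X = g) ->
  (forall X Y (f : hom (sob r X) Y) (f' : hom (sob r' (sob r X)) (sob r' Y)),
    sind f f' -> f' ∘ eta X = 0 -> factors_proj f) ->
  sfunctor r ⊣ sfunctor r'.
Proof.
move=> eN eS eI; pose p (A : C) (B : D) (x : shom (sob r A) B) :=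
  @mcomp (stable C) _ _ _ (fmap (sfunctor r') x) (spi (eta A)).
have pE A B (f : hom (sob r A) B) f' : sind f f' -> p A B (spi f) = spi (f' ∘ eta A).
  by move=> ff'; rewrite /p (sfunctorE ff'); exact: stable_compE.
exists p; split=> [A B|A A' B x y|A B B' y x].
- apply: additive_bij => [x y|x|y].
  + have [f ->] := srepr x; have [g ->] := srepr y.
    have [f' ff'] := sind_ex r' f; have [g' gg'] := sind_ex r' g.
    by rewrite -spiB (pE _ _ _ _ (sindB ff' gg')) (pE _ _ _ _ ff') (pE _ _ _ _ gg')
      compBl spiB.
  + have [f ->] := srepr x; have [f' ff'] := sind_ex r' f.
    rewrite (pE _ _ _ _ ff') => /spi0[Q [u [v [hQ vu]]]]; apply/spi0.
    have [w [w' [ww' w'e]]] := eS _ _ v.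
    have [u1 [u2 [uu1 u12 u2e]]] := eN _ _ u.
    apply: (@factors_proj_sub _ _ _ f (w ∘ u1)).
      by exists (sob r Q), u1, w; split=> //; exact: sob_proj.
    apply: (eI _ _ _ _ (sindB ff' (sindM ww' u12))).
    by rewrite compBl vu -compA u2e compA w'e subrr.
  + have [g ->] := srepr y; have [f [f' [ff' f'e]]] := eS _ _ g.
    by exists (spi f); rewrite (pE _ _ _ _ ff') f'e.
- have [f ->] := srepr x; have [g ->] := srepr y.
  have [f1 [f2 [ff1 ff2 e]]] := eN _ _ f; have [g' gg'] := sind_ex r' g.
  rewrite (sfunctorE ff1) stable_compE (pE _ _ _ _ (sindM gg' ff2)).
  by rewrite (pE _ _ _ _ gg') stable_compE -!compA e.
- have [f ->] := srepr x; have [g ->] := srepr y.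
  have [f' ff'] := sind_ex r' f; have [g' gg'] := sind_ex r' g.
  rewrite stable_compE (pE _ _ _ _ (sindM gg' ff')) (sfunctorE gg').
  by rewrite (pE _ _ _ _ ff') stable_compE compA.
Qed.

(** Composition with the counit runs against the direction that [adjoint] asks for, so its
    bijectivity is proved first and the required family is its inverse, obtained by choice over
    pairs of objects. *)
Lemma stable_adjoint_counit (eps : forall Y : D, hom (sob r (sob r' Y)) Y) :
  (forall Y Y' (v : hom Y Y'), exists (v1 : hom (sob r' Y) (sob r' Y')) v2,
    [/\ sind v v1, sind v1 v2 & eps Y' ∘ v2 = v ∘ eps Y]) ->
  (forall X Y (g : hom (sob r X) Y), exists (f : hom X (sob r' Y)) f',
    sind f f' /\ eps Y ∘ f' = g) ->
  (forall X Y (f : hom X (sob r' Y)) (f' : hom (sob r X) (sob r (sob r' Y))),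
    sind f f' -> eps Y ∘ f' = 0 -> factors_proj f) ->
  sfunctor r ⊣ sfunctor r'.
Proof.
move=> eN eS eI; pose q (A : C) (B : D) (x : shom A (sob r' B)) : shom (sob r A) B :=
  @mcomp (stable D) _ _ _ (spi (eps B)) (fmap (sfunctor r) x).
have qE A B (f : hom A (sob r' B)) f' : sind f f' -> q A B (spi f) = spi (eps B ∘ f').
  by move=> ff'; rewrite /q (sfunctorE ff'); exact: stable_compE.
have q1 (A A' : C) (B : D) (x : shom A' A) (y : shom A (sob r' B)) :
    q A' B (@mcomp (stable C) _ _ _ y x) =
    @mcomp (stable D) _ _ _ (q A B y) (fmap (sfunctor r) x).
  have [f ->] := srepr x; have [g ->] := srepr y.
  have [f' ff'] := sind_ex r f; have [g' gg'] := sind_ex r g.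
  rewrite stable_compE (qE _ _ _ _ (sindM gg' ff')) (sfunctorE ff').
  by rewrite (qE _ _ _ _ gg') stable_compE compA.
have q2 (A : C) (B B' : D) (y : shom B B') (x : shom A (sob r' B)) :
    q A B' (@mcomp (stable C) _ _ _ (fmap (sfunctor r') y) x) =
    @mcomp (stable D) _ _ _ y (q A B x).
  have [f ->] := srepr x; have [g ->] := srepr y.
  have [g1 [g2 [gg1 g12 e]]] := eN _ _ g; have [f' ff'] := sind_ex r f.
  rewrite (sfunctorE gg1) stable_compE (qE _ _ _ _ (sindM g12 ff')).
  by rewrite (qE _ _ _ _ ff') stable_compE !compA e.
have qb A B : bijective (q A B).
  apply: additive_bij => [x y|x|y].
  - have [f ->] := srepr x; have [g ->] := srepr y.
    have [f' ff'] := sind_ex r f; have [g' gg'] := sind_ex r g.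
    by rewrite -spiB (qE _ _ _ _ (sindB ff' gg')) (qE _ _ _ _ ff') (qE _ _ _ _ gg')
      compBr spiB.
  - have [f ->] := srepr x; have [f' ff'] := sind_ex r f.
    rewrite (qE _ _ _ _ ff') => /spi0[Q [u [v [hQ vu]]]]; apply/spi0.
    have [w [w' [ww' w'e]]] := eS _ _ u.
    have [v1 [v2 [vv1 v12 v2e]]] := eN _ _ v.
    apply: (@factors_proj_sub _ _ _ f (v1 ∘ w)).
      by exists (sob r' Q), w, v1; split=> //; exact: sob_proj.
    apply: (eI _ _ _ _ (sindB ff' (sindM v12 ww'))).
    by rewrite compBr vu compA v2e -compA w'e subrr.
  - have [g ->] := srepr y; have [f [f' [ff' f'e]]] := eS _ _ g.
    by exists (spi f); rewrite (qE _ _ _ _ ff') f'e.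
have /dep_choice[p pP] (AB : C * D) : exists p : shom (sob r AB.1) AB.2 ->
    shom AB.1 (sob r' AB.2), cancel (q _ _) p /\ cancel p (q _ _).
  by have [p qK Kq] := qb AB.1 AB.2; exists p.
have pK A B : cancel (q A B) (p (A, B)) by have [] := pP (A, B).
have Kp A B : cancel (p (A, B)) (q A B) by have [] := pP (A, B).
exists (fun A B => p (A, B)); split=> [A B|A A' B x y|A B B' y x].
- exact: (Bijective (Kp A B) (pK A B)).
- by apply: (can_inj (pK A' B)); rewrite Kp [RHS]q1 Kp.
- by apply: (can_inj (pK A B')); rewrite Kp [RHS]q2 Kp.
Qed.

End StableCriteria.

(** * Chains of admissible monomorphisms *)

Section ExactCategory.
Variables (C : confcat) (ex : is_exact C).
Implicit Types A B D : C.

Lemma inflation_mono A B T (i : hom A B) (f g : hom T A) :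
  inflation i -> i ∘ f = i ∘ g -> f = g.
Proof. by move=> [D [p ip]]; apply/kernel_mono/(conf_ker ex ip). Qed.

(** The cokernel of [i] is one such [q]; quantifying over all of them spares [ck_full] from naming
    it. *)
Lemma inflation_factor A B T (i : hom A B) (f : hom T B) :
  inflation i -> (forall D (q : hom B D), q ∘ i = 0 -> q ∘ f = 0) ->
  exists x, i ∘ x = f.
Proof.
move=> [D [q iq]] h; have [qi u] := conf_ker ex iq.
by have [x [xE _]] := u _ f (h _ q qi); exists x.
Qed.

Lemma cokernel_iso A B D D' (i : hom A B) (p : hom B D) (p' : hom B D')
    (w : hom D D') :
  is_cokernel i p -> is_cokernel i p' -> w ∘ p = p' -> is_iso w.
Proof.
move=> cp cp' wp; have [v [vp _]] := cp'.2 _ p cp.1; exists v.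
  by apply: (cokernel_epi cp); rewrite -compA wp vp comp1m.
by apply: (cokernel_epi cp'); rewrite -compA vp wp comp1m.
Qed.

End ExactCategory.

Section Chains.
Variables (F : frobenius) (l : nat).
Let ex := frob_exact F.
Implicit Types X Y : chain F l.

Lemma tmap_irrelevance X (i j : 'I_l.+1) (h h' : (i <= j)%N) : tmap X h = tmap X h'.
Proof. by rewrite (bool_irrelevance h h'). Qed.

Lemma chain_iso X Y (f : chain_hom X Y) :
  (forall i, is_iso (f i)) -> @is_iso (Morm F l) X Y f.
Proof.
move=> fi.
have /dep_choice[g gP] i : exists g : hom (Y i) (X i),
    g ∘ f i = idm _ /\ f i ∘ g = idm _.
  by have [g] := fi i; exists g.
have gn (i j : 'I_l.+1) (h : (i <= j)%N) : tmap X h ∘ g i = g j ∘ tmap Y h.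
  have [g1 _] := gP j; have [_ g2] := gP i.
  rewrite -[tmap Y h]compm1 -g2 [tmap Y h ∘ _]compA cm_nat.
  by rewrite !compA g1 comp1m.
by exists (@ChainHom _ _ Y X g gn : @hom (Morm F l) Y X);
  apply: chain_homP => i; have [] := gP i.
Qed.

(** All maps into the last term of [Y] are monic, so components lifting one map of last terms are
    compatible automatically. *)
Lemma chain_hom_from_last X Y (f : hom (X ord_max) (Y ord_max)) :
  (forall i : 'I_l.+1, exists fi : hom (X i) (Y i),
     tmap Y (leq_ord i : (i <= @ord_max l)%N) ∘ fi =
                        f ∘ tmap X (leq_ord i : (i <= @ord_max l)%N)) ->
  exists g : chain_hom X Y,
    forall (i : 'I_l.+1) (h : (i <= @ord_max l)%N), tmap Y h ∘ g i = f ∘ tmap X h.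
Proof.
move=> /dep_choice[g gP].
have gn (i j : 'I_l.+1) (h : (i <= j)%N) : tmap Y h ∘ g i = g j ∘ tmap X h.
  apply: (inflation_mono ex (tmap_infl Y (leq_ord j : (j <= @ord_max l)%N))).
  rewrite !compA gP (tmapM Y _ _ (leq_ord i : (i <= @ord_max l)%N)) gP.
  by rewrite -compA (tmapM X _ _ (leq_ord i : (i <= @ord_max l)%N)).
exists (ChainHom gn) => i h /=.
by rewrite (bool_irrelevance h (leq_ord i)) gP.
Qed.

(* [f] factors through 0 = .. = 0 -> P = .. = P, with P from position [c] on. *)
Lemma null_from X Y (f : chain_hom X Y) (c : nat) (P : F)
    (u : hom (X ord_max) P) (v : hom P (Y (clip l c))) :
  projective P ->
  (forall i : 'I_l.+1, (i < c)%N ->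
     f i = 0 /\ forall h : (i <= @ord_max l)%N, u ∘ tmap X h = 0) ->
  (forall (i : 'I_l.+1) (h : (clip l c <= i)%N) (h' : (i <= @ord_max l)%N),
     (c <= i)%N -> f i = tmap Y h ∘ v ∘ u ∘ tmap X h') ->
  @factors_proj (Morm F l) X Y f.
Proof.
move=> hP f0 fE.
pose Q (k : nat) := (k < c)%N.
have Qd (i j : nat) : (i <= j)%N -> Q j -> Q i by exact: leq_ltn_trans.
pose S := step_chain l Qd (inflation_zob ex P).
pose us (i : 'I_l.+1) : hom (X i) (S i) :=
  match Q i as b return hom (X i) (step_ob (zob F) P b) with
  | true => 0 | false => u ∘ tmap X (leq_ord i : (i <= @ord_max l)%N) end.
(* The component makes sense only where [clip l c <= i]; elsewhere 0 is a filler, and [vs] consults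
   [w] only from position [c] on. *)
have vh (i : 'I_l.+1) : exists w : hom P (Y i),
    forall h : (clip l c <= i)%N, w = tmap Y h ∘ v.
  have [h|h] := pselect (clip l c <= i)%N; last by exists 0.
  by exists (tmap Y h ∘ v) => h'; rewrite (bool_irrelevance h h').
have /dep_choice[w wE] := vh.
pose vs (i : 'I_l.+1) : hom (S i) (Y i) :=
  match Q i as b return hom (step_ob (zob F) P b) (Y i) with
  | true => 0 | false => w i end.
have cle (i : 'I_l.+1) : Q i = false -> (clip l c <= i)%N.
  by rewrite /Q => /negbT; rewrite -leqNgt /= => h; apply: leq_trans h; exact: geq_minr.
have un (i j : 'I_l.+1) (h : (i <= j)%N) : tmap S h ∘ us i = us j ∘ tmap X h.
  have e : tmap X (leq_ord j : (j <= @ord_max l)%N) ∘ tmap X h =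
      tmap X (leq_ord i : (i <= @ord_max l)%N) by exact: tmapM.
  have u0 : Q i -> u ∘ tmap X (leq_ord i : (i <= @ord_max l)%N) = 0.
    by move=> Qi; have [_] := f0 i Qi; apply.
  rewrite /us /=; move: (Qd _ _ h) u0.
  case: (Q i); case: (Q j) => /= h1 u0; rewrite ?compm0 ?comp0m //.
  - by rewrite -compA e u0.
  - by rewrite comp1m -compA e.
have vn (i j : 'I_l.+1) (h : (i <= j)%N) : tmap Y h ∘ vs i = vs j ∘ tmap S h.
  have e : Q i = false -> tmap Y h ∘ w i = w j.
    move=> Qi; have hi := cle i Qi; have hj : (clip l c <= j)%N by exact: leq_trans h.
    by rewrite (wE _ hi) (wE _ hj) compA (tmapM Y _ _ hj).
  rewrite /vs /=; move: (Qd _ _ h) e.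
  case: (Q i); case: (Q j) => /= h1 e; rewrite ?compm0 ?comp0m //.
  - by have := h1 isT.
  - by rewrite compm1 e.
exists (S : Morm F l), (@ChainHom _ _ X S us un), (@ChainHom _ _ S Y vs vn); split.
  apply/Morm_projective => k /=; case: (Q k) => //; exact: projective_zob.
apply: chain_homP => i /=.
have e1 : Q i -> f i = 0 by move=> Qi; have [] := f0 i Qi.
have e2 : Q i = false ->
    f i = w i ∘ (u ∘ tmap X (leq_ord i : (i <= @ord_max l)%N)).
  move=> Qi; rewrite (wE _ (cle i Qi)) compA; apply: fE.
  by move: Qi; rewrite /Q => /negbT; rewrite -leqNgt.
rewrite /us /vs; case: (Q i) e1 e2 => /= [e1 _|_ e2]; first by rewrite comp0m e1.
exact: e2.
Qed.

End Chains.

(** * Reindexing along Galois connections *)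

Section ReindexAdjunction.
Variables (F : frobenius) (l n : nat) (phi psi : nat -> nat).
Hypothesis phi_homo : {homo phi : i j / (i <= j)%N}.
Hypothesis psi_homo : {homo psi : i j / (i <= j)%N}.
Hypothesis unit_le :
  forall j : 'I_l.+1, (j <= clip l (phi (clip n (psi j))))%N.
Hypothesis counit_le :
  forall i : 'I_n.+1, (clip n (psi (clip l (phi i))) <= i)%N.

(** On positions [psi] is left adjoint to [phi]; precomposition exchanges the sides. The unit
    consists of maps of the chain itself, from [X^j] to [X^(phi (psi j))]. *)
Lemma reindex_adjoint :
  sfunctor (reindex_recipe F l n phi_homo) ⊣ sfunctor (reindex_recipe F n l psi_homo).
Proof.
pose R (X : chain F l) := reindex_ob l psi_homo (reindex_ob n phi_homo X).
have etan (X : chain F l) (i j : 'I_l.+1) (h : (i <= j)%N) :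
    tmap (R X) h ∘ tmap X (unit_le i) = tmap X (unit_le j) ∘ tmap X h.
  by rewrite /= !(tmapM X _ _ (leq_trans h (unit_le j))).
pose eta (X : chain F l) := @ChainHom _ _ X (R X) (fun j => tmap X (unit_le j)) (etan X).
apply: (@stable_adjoint_unit _ _ (reindex_recipe F l n phi_homo)
  (reindex_recipe F n l psi_homo) eta).
- move=> X X' v.
  have [v1 v1E] := sind_ex (reindex_recipe F l n phi_homo) v.
  have [v2 v2E] := sind_ex (reindex_recipe F n l psi_homo) v1.
  exists v1, v2; split=> //; apply: chain_homP => j /=.
  by rewrite v2E v1E /= cm_nat.
- move=> X Y g; set g_ := (g : chain_hom X (reindex_ob l psi_homo Y)).
  have fn (i j : 'I_n.+1) (h : (i <= j)%N) :
      tmap (Y : chain F n) h ∘ (tmap (Y : chain F n) (counit_le i) ∘ g_ (clip l (phi i))) =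
      (tmap (Y : chain F n) (counit_le j) ∘ g_ (clip l (phi j)))
        ∘ tmap (reindex_ob n phi_homo X) h.
    rewrite /= -!compA -(cm_nat g_ (reindex_le l phi_homo h)) !compA /=.
    by rewrite !(tmapM (Y : chain F n) _ _ (leq_trans (counit_le i) h)).
  pose f := @ChainHom _ _ (reindex_ob n phi_homo X) Y _ fn.
  have [f' f'E] := sind_ex (reindex_recipe F n l psi_homo) (f : @hom (Morm F n) _ _).
  exists f, f'; split=> //; apply: chain_homP => j /=; rewrite f'E /= -compA.
  rewrite -(cm_nat g_ (unit_le j)) compA /=.
  by rewrite (tmapM (Y : chain F n) _ _ (leqnn _)) tmap1 comp1m.
- move=> X Y f f' f'E f0.
  suff -> : f = 0 by exact: factors_proj0.
  apply: chain_homP => i; set f_ := (f : chain_hom _ _).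
  (* Triangle identity: the identity at position [phi i] passes through [phi (psi (phi i))], and
     there [f] after the unit is zero. *)
  have h1 := unit_le (clip l (phi i)).
  pose h2 := reindex_le l phi_homo (counit_le i).
  have e : f_ (clip n (psi (clip l (phi i)))) ∘ tmap (X : chain F l) h1 = 0.
    have /(congr1 (fun k : chain_hom _ _ => k (clip l (phi i)))) := f0.
    by rewrite /= f'E /eta /= (bool_irrelevance (unit_le _) h1).
  rewrite -[f_ i]compm1 -(tmap1 (X : chain F l) (leqnn _)).
  have e2 : f_ i ∘ tmap (X : chain F l) h2 = tmap (Y : chain F n) (counit_le i) ∘ f_ _.
    exact/esym/(cm_nat f_).
  by rewrite -(tmapM (X : chain F l) h1 h2) compA e2 -compA e compm0.
Qed.

End ReindexAdjunction.

(** * Maps into and out of the extended chains *)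

Lemma add_homo (a : nat) : {homo addn a : i j / (i <= j)%N}.
Proof. by move=> i j h; rewrite leq_add2l. Qed.

Section Positions.
Variables (n l a : nat).
Local Notation xp := (xpos n a (a + n)).

Lemma xpos_below j : (j < a)%N -> xp j = Below n.
Proof. by rewrite /xpos => ->. Qed.

Lemma xpos_inside (i : 'I_n.+1) j : j = (a + i)%N -> xp j = Inside i.
Proof.
move=> ->; rewrite /xpos ltnNge leq_addr leq_add2l leq_ord /=; congr Inside.
by apply: val_inj; rewrite /= addKn; apply/minn_idPr/leq_ord.
Qed.

Lemma xpos_above j : (a + n < j)%N -> xp j = Above n.
Proof. by rewrite /xpos => h; case: ltnP => [|_]; [lia | case: leqP => //; lia]. Qed.

Lemma xposB j : xp j = Below n -> (j < a)%N.
Proof. by rewrite /xpos; case: ltnP => // _; case: leqP. Qed.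

Lemma xposI i j : xp j = Inside i -> j = (a + i)%N.
Proof.
rewrite /xpos; case: ltnP => // h1; case: leqP => // h2 [<-] /=.
lia.
Qed.

Lemma xposA j : xp j = Above n -> (a + n < j)%N.
Proof. by rewrite /xpos; case: ltnP => // _; case: leqP. Qed.

Lemma xposI_ord i (j : 'I_l.+1) : xp j = Inside i -> j = clip l (a + i).
Proof. by move=> /xposI e; apply: val_inj => /=; have := leq_ord j; lia. Qed.

Lemma xposI_le i (j : 'I_l.+1) : xp j = Inside i -> (j <= clip l (a + i))%N.
Proof. by move=> /xposI /= e; rewrite -e; have := leq_ord j; lia. Qed.

Lemma xposI_ge i (j : nat) : xp j = Inside i -> (clip l (a + i) <= j)%N.
Proof. by move=> /xposI /= ->; exact: geq_minr. Qed.

Lemma xposA_ge (j : nat) : xp j = Above n -> (clip l (a + n).+1 <= j)%N.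
Proof. by move=> /xposA /= h; exact: leq_trans (geq_minr _ _) h. Qed.

End Positions.

Section Extension.
Variables (F : frobenius) (H : hulls F) (n l a : nat).
Hypothesis anl : (a + n <= l)%N.
Let ex := frob_exact F.
Local Notation xp := (xpos n a (a + n)).
Local Notation xo := (x_ob H l a (a + n)).

Definition rst (X : chain F l) : chain F n := reindex_ob n (@add_homo a) X.

(** The kind [xp j] equals [Inside i] or [Above] only propositionally. Going along [ext_map] in both
    directions replaces transport along that equality here and below. *)
Lemma ext_map_id (Y : chain F n) (e e' : ext n) (h : ext_le e e') (h' : ext_le e' e) :
  ext_map H Y h' ∘ ext_map H Y h = idm _.
Proof.
have h0 : ext_le e e by case: (e) => //= i; exact: leqnn.
by rewrite (ext_mapM H Y _ _ h0) ext_map1.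
Qed.

Lemma ext_map_id3 (Y : chain F n) (e e1 e2 : ext n) (h1 : ext_le e e1)
    (h2 : ext_le e1 e2) (h3 : ext_le e2 e) :
  ext_map H Y h3 ∘ ext_map H Y h2 ∘ ext_map H Y h1 = idm _.
Proof.
have h : ext_le e e2 by case: (e) (e1) (e2) h1 h2 => [|i|] [|j|] [|k|] //=; exact: leq_trans.
by rewrite -compA (ext_mapM H Y h1 h2 h) ext_map_id.
Qed.

Lemma ext_le_refl (e e' : ext n) : e = e' -> ext_le e e'.
Proof. by move=> ->; case: e' => //= i; exact: leqnn. Qed.

Lemma ext_map_below (Y : chain F n) (e e' : ext n) (h : ext_le e e') :
  e = Below n -> ext_map H Y h = 0.
Proof. by move=> E; move: h; rewrite E. Qed.

Lemma above_le (e : ext n) : ext_le (Above n) e -> e = Above n.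
Proof. by case: e. Qed.

Lemma clip_inside (i : 'I_n.+1) : xp (clip l (a + i)) = Inside i.
Proof.
by apply: xpos_inside => /=; apply/minn_idPr; have := leq_ord i; lia.
Qed.

(** Below [a] the target is 0, which is why [g] has to kill those terms; beyond the inside positions
    [g] continues because the hull is injective. *)
Lemma ext_to (X : chain F l) (Y : chain F n) (g : chain_hom (rst X) Y) :
  (forall (i : 'I_n.+1) (j : 'I_l.+1) (h : (j <= clip l (a + i))%N),
     (j < a)%N -> g i ∘ tmap X h = 0) ->
  exists f : chain_hom X (xo Y),
    forall (j : 'I_l.+1) (i : 'I_n.+1) (h : ext_le (xp j) (Inside i))
      (h' : (j <= clip l (a + i))%N), ext_map H Y h ∘ f j = g i ∘ tmap X h'.
Proof.
move=> g0; pose L := clip l (a + @ord_max n).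
(* The extension is chosen once, on the last term of [X]; the components above restrict it and are
   therefore compatible. *)
have [k kE] := ihull_inj (h := H) (xhull H Y ∘ g ord_max)
  (tmap_infl X (leq_ord L : (L <= @ord_max l)%N)).
pose into (j : 'I_l.+1) (e : ext n) : xp j = e -> hom (X j) (ext_ob H Y e) :=
  match e return xp j = e -> hom (X j) (ext_ob H Y e) with
  | Below => fun _ => 0
  | Inside i => fun E => g i ∘ tmap X (xposI_le E)
  | Above => fun _ => k ∘ tmap X (leq_ord j : (j <= @ord_max l)%N)
  end.
have kI (i : 'I_n.+1) (j : 'I_l.+1) (h : (j <= clip l (a + i))%N)
    (h' : (j <= @ord_max l)%N) :
    k ∘ tmap X h' = xhull H Y ∘ tmap Y (leq_ord i : (i <= @ord_max n)%N) ∘ (g i ∘ tmap X h).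
  have hL : (j <= L)%N.
    by apply: leq_trans h _; apply: clip_homo; rewrite leq_add2l leq_ord.
  rewrite -(tmapM X hL (leq_ord L : (L <= @ord_max l)%N)) compA kE.
  rewrite -!compA; congr (_ ∘ _); rewrite compA cm_nat -compA.
  by congr (_ ∘ _); rewrite /= (tmapM X _ _ hL).
have intoP (j : 'I_l.+1) e (E : xp j = e) (i : 'I_n.+1) (h : ext_le e (Inside i))
    (h' : (j <= clip l (a + i))%N) : ext_map H Y h ∘ into j e E = g i ∘ tmap X h'.
  case: e E h => [|i'|] //= E h.
    by rewrite comp0m g0 //; exact: xposB E.
  by rewrite compA (cm_nat g) -compA; congr (_ ∘ _); exact: tmapM.
have inton (j j' : 'I_l.+1) (h : (j <= j')%N) e (E : xp j = e) e' (E' : xp j' = e')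
    (le : ext_le e e') : ext_map H Y le ∘ into j e E = into j' e' E' ∘ tmap X h.
  case: e' E' le => [|i'|] E' le; first by case: e E le => //= E _; rewrite !comp0m.
    have h' := xposI_le E'; rewrite (intoP _ _ _ _ _ (leq_trans h h')) /=.
    by rewrite -compA; congr (_ ∘ _); exact/esym/tmapM.
  rewrite /= -compA (tmapM X _ _ (leq_ord j : (j <= @ord_max l)%N)).
  case: e E le => [|i|] E le /=; last by rewrite comp1m.
    rewrite compm0; have jL : (j <= L)%N by have := xposB E; rewrite /L /=; lia.
    by rewrite (kI _ _ jL) g0 ?compm0 //; exact: xposB E.
  exact/esym/kI.
have fn (i j : 'I_l.+1) (h : (i <= j)%N) :
    tmap (xo Y) h ∘ into i _ erefl = into j _ erefl ∘ tmap X h.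
  exact: inton.
exists (@ChainHom _ _ X (xo Y) (fun j => into j _ erefl) fn) => j i h h'.
exact: intoP.
Qed.

(** From position [(a + n).+1] on the target is constantly the hull, so [f] is determined there by
    its last component and factors through the chain that is the hull from that position on and 0
    before. *)
Lemma ext_to_null (X : chain F l) (Y : chain F n) (f : chain_hom X (xo Y)) :
  (forall (j : 'I_l.+1) (i : 'I_n.+1) (h : ext_le (xp j) (Inside i)),
     xp j = Inside i -> ext_map H Y h ∘ f j = 0) ->
  @factors_proj (Morm F l) X (xo Y) f.
Proof.
move=> f0.
have fj0 (j : 'I_l.+1) : (j < (a + n).+1)%N -> f j = 0.
  move=> h; case E : (xp j) => [|i|]; last by have := xposA E; lia.
    have h' := ext_le_refl E; have h2 := ext_le_refl (esym E).
    rewrite -[f j]comp1m -(ext_map_id Y h' h2) -compA.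
    by rewrite [ext_map H Y h' ∘ f j]zob_term compm0.
  have h' := ext_le_refl E; have h2 := ext_le_refl (esym E).
  by rewrite -[f j]comp1m -(ext_map_id Y h' h2) -compA f0 // compm0.
case: (ltnP (a + n) l) => hl; last first.
  suff -> : f = 0 by exact: factors_proj0.
  by apply: chain_homP => j; apply: fj0; have := leq_ord j; lia.
have pA (j : 'I_l.+1) : (a + n < j)%N -> xp j = Above n by exact: xpos_above.
have lm : (a + n < @ord_max l)%N by [].
have lc : (a + n < clip l (a + n).+1)%N by rewrite /=; lia.
pose u := ext_map H Y (ext_le_refl (pA _ lm)) ∘ f ord_max.
pose v := ext_map H Y (ext_le_refl (esym (pA _ lc))).
apply: (@null_from F l X (xo Y) f (a + n).+1 _ u v).
- exact/proj_inj/ihull_inj.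
- move=> i hi; split=> [|h]; first exact: fj0.
  by rewrite /u -compA -(cm_nat f) fj0 // !compm0.
- move=> i h h' ci; rewrite /u -!compA -(cm_nat f) !compA /v /=.
  have hAi : ext_le (Above n) (xp i) by exact: (ext_le_refl (esym (pA _ ci))).
  rewrite (ext_mapM H Y _ _ hAi) -[LHS]comp1m; congr (_ ∘ _).
  exact/esym/(ext_map_id3 Y (xpos_le n a (a + n) h') (ext_le_refl (pA _ lm)) hAi).
Qed.

(** The equation on [h] is guarded by [a + n < l] because for [a + n = l] the index [(a + n).+1] is
    clipped back to [l] and [xo Y] has no hull terms. *)
Lemma ext_from (Y : chain F n) (X : chain F l) (g : chain_hom Y (rst X))
    (h : hom (hullI H (Y ord_max)) (X (clip l (a + n).+1))) :
  ((a + n < l)%N -> forall le : (clip l (a + @ord_max n) <= clip l (a + n).+1)%N,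
     h ∘ xhull H Y = tmap X le ∘ g ord_max) ->
  exists f : chain_hom (xo Y) X,
    (forall (j : 'I_l.+1) (i : 'I_n.+1) (hI : ext_le (Inside i) (xp j))
       (h' : (clip l (a + i) <= j)%N), f j ∘ ext_map H Y hI = tmap X h' ∘ g i) /\
    (forall (j : 'I_l.+1) (hA : ext_le (Above n) (xp j))
       (h' : (clip l (a + n).+1 <= j)%N), f j ∘ ext_map H Y hA = tmap X h' ∘ h).
Proof.
move=> hE.
pose out (j : 'I_l.+1) (e : ext n) : xp j = e -> hom (ext_ob H Y e) (X j) :=
  match e return xp j = e -> hom (ext_ob H Y e) (X j) with
  | Below => fun _ => 0
  | Inside i => fun E => tmap X (xposI_ge l E) ∘ g i
  | Above => fun E => tmap X (xposA_ge l E) ∘ h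
  end.
have outI (j : 'I_l.+1) e (E : xp j = e) (i : 'I_n.+1) (hI : ext_le (Inside i) e)
    (h' : (clip l (a + i) <= j)%N) : out j e E ∘ ext_map H Y hI = tmap X h' ∘ g i.
  case: e E hI => [|i'|] //= E hI.
    rewrite -compA -(cm_nat g) compA; congr (_ ∘ _).
    exact: (tmapM X).
  have hl : (a + n < l)%N by have := xposA E; have := leq_ord j; lia.
  have le1 : (clip l (a + @ord_max n) <= clip l (a + n).+1)%N by apply: clip_homo.
  rewrite -compA [h ∘ _]compA (hE hl le1) -!compA -(cm_nat g) !compA /=.
  congr (_ ∘ _); rewrite (tmapM X _ _ (leq_trans le1 (xposA_ge l E))).
  exact: (tmapM X).
have outA (j : 'I_l.+1) e (E : xp j = e) (hA : ext_le (Above n) e)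
    (h' : (clip l (a + n).+1 <= j)%N) : out j e E ∘ ext_map H Y hA = tmap X h' ∘ h.
  case: e E hA => [|i'|] //= E hA.
  by rewrite compm1 (bool_irrelevance (xposA_ge l E) h').
have outn (j j' : 'I_l.+1) (le : (j <= j')%N) e (E : xp j = e) e' (E' : xp j' = e')
    (le' : ext_le e e') : tmap X le ∘ out j e E = out j' e' E' ∘ ext_map H Y le'.
  case: e E le' => [|i|] E le'.
  - by rewrite /= compm0; exact/esym/zob_init.
  - rewrite (outI _ _ E' _ le' (leq_trans (xposI_ge l E) le)) /= compA.
    by congr (_ ∘ _); apply: tmapM.
  - rewrite (outA _ _ E' le' (leq_trans (xposA_ge l E) le)) /= compA.
    by congr (_ ∘ _); apply: tmapM.
have fn (i j : 'I_l.+1) (le : (i <= j)%N) :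
    tmap X le ∘ out i _ erefl = out j _ erefl ∘ tmap (xo Y) le.
  exact: outn.
exists (@ChainHom _ _ (xo Y) X (fun j => out j _ erefl) fn); split=> [j i hI h'|j hA h'].
  exact: outI.
exact: outA.
Qed.

(** Since [d] kills the inclusion into the hull, it defines a chain map from [xo Y] to the chain
    that is 0 up to position [a + n] and [P] afterwards; [p] leads from there to [X]. *)
Lemma ext_from_null (Y : chain F n) (X : chain F l) (f : chain_hom (xo Y) X) (P : F)
    (d : hom (hullI H (Y ord_max)) P) (p : hom P (X (clip l (a + n).+1))) :
  projective P -> d ∘ xhull H Y = 0 ->
  (forall (j : 'I_l.+1) (i : 'I_n.+1) (hI : ext_le (Inside i) (xp j)),
     xp j = Inside i -> f j ∘ ext_map H Y hI = 0) ->
  (forall (j : 'I_l.+1) (hA : ext_le (Above n) (xp j))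
     (h' : (clip l (a + n).+1 <= j)%N), f j ∘ ext_map H Y hA = tmap X h' ∘ p ∘ d) ->
  @factors_proj (Morm F l) (xo Y) X f.
Proof.
move=> hP d0 fI fA.
have fj0 (j : 'I_l.+1) : (j < (a + n).+1)%N -> f j = 0.
  move=> h; case E : (xp j) => [|i|]; last by have := xposA E; lia.
    have h' := ext_le_refl E; have h2 := ext_le_refl (esym E).
    rewrite -[f j]compm1 -(ext_map_id Y h' h2) compA.
    by rewrite [f j ∘ ext_map H Y h2]zob_init comp0m.
  have h' := ext_le_refl E; have h2 := ext_le_refl (esym E).
  by rewrite -[f j]compm1 -(ext_map_id Y h' h2) compA fI // comp0m.
case: (ltnP (a + n) l) => hl; last first.
  suff -> : f = 0 by exact: factors_proj0.
  by apply: chain_homP => j; apply: fj0; have := leq_ord j; lia.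
have hA e : ext_le e (Above n) by case: e.
have dA e : e <> Above n -> d ∘ ext_map H Y (hA e) = 0.
  case: e => [|i|] //= _; first by rewrite compm0.
  by rewrite compA d0 comp0m.
apply: (@null_from F l (xo Y) X f (a + n).+1 P (d ∘ ext_map H Y (hA _)) p) => //.
- move=> i hi; split=> [|h]; first exact: fj0.
  have -> : d ∘ ext_map H Y (hA _) ∘ tmap (xo Y) h = d ∘ ext_map H Y (hA (xp i)).
    rewrite -compA; congr (_ ∘ _).
    exact: (@ext_mapM F H n Y (xp i) (xp (@ord_max l)) (Above n) (xpos_le _ _ _ h)).
  by apply: dA => E; have := xposA E; lia.
- move=> i h h' ci.
  have le : ext_le (Above n) (xp i) by exact/ext_le_refl/esym/xpos_above.
  rewrite -[LHS]compm1 -(ext_map_id Y (hA (xp i)) le) compA (fA _ _ h).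
  rewrite -!compA; congr (_ ∘ (_ ∘ (_ ∘ _))).
  exact/esym/(ext_mapM H Y).
Qed.

Definition x_in_hom (Y : chain F n) (i : 'I_n.+1) : hom (Y i) (rst (xo Y) i) :=
  ext_map H Y (ext_le_refl (esym (clip_inside i))).

Definition x_out_hom (Y : chain F n) (i : 'I_n.+1) : hom (rst (xo Y) i) (Y i) :=
  ext_map H Y (ext_le_refl (clip_inside i)).

Lemma x_in_nat (Y : chain F n) (i j : 'I_n.+1) (h : (i <= j)%N) :
  tmap (rst (xo Y)) h ∘ x_in_hom Y i = x_in_hom Y j ∘ tmap Y h.
Proof.
have le : ext_le (Inside i) (xp (clip l (a + j))) by rewrite clip_inside.
by rewrite [LHS](ext_mapM H Y _ _ le) [RHS](@ext_mapM _ H _ Y (Inside i) (Inside j) _ h _ le).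
Qed.

Lemma x_out_nat (Y : chain F n) (i j : 'I_n.+1) (h : (i <= j)%N) :
  tmap Y h ∘ x_out_hom Y i = x_out_hom Y j ∘ tmap (rst (xo Y)) h.
Proof.
have le : ext_le (xp (clip l (a + i))) (Inside j) by rewrite clip_inside.
by rewrite [RHS](ext_mapM H Y _ _ le) [LHS](@ext_mapM _ H _ Y _ (Inside i) (Inside j) _ h le).
Qed.

Definition x_in (Y : chain F n) : chain_hom Y (rst (xo Y)) := ChainHom (@x_in_nat Y).
Definition x_out (Y : chain F n) : chain_hom (rst (xo Y)) Y := ChainHom (@x_out_nat Y).

Lemma x_inK (Y : chain F n) i : x_in Y i ∘ x_out Y i = idm _.
Proof.
have e := ext_map_id Y (ext_le_refl (clip_inside i))
  (ext_le_refl (esym (clip_inside i))).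
exact: e.
Qed.

Definition rst_map (X X' : chain F l) (f : chain_hom X X') : chain_hom (rst X) (rst X') :=
  @ChainHom _ _ (rst X) (rst X') (fun i => f (clip l (a + i)))
    (fun i j h => cm_nat f (reindex_le l (@add_homo a) h)).

Lemma ext_hom_inside (Y Y' : chain F n) (f : chain_hom Y Y')
    (f' : chain_hom (xo Y) (xo Y')) (i : 'I_n.+1) :
  sind (s := x_recipe H n l a (a + n)) (f : @hom (Morm F n) Y Y') f' ->
  f i = x_out Y' i ∘ f' (clip l (a + i)) ∘ x_in Y i.
Proof.
move=> [h _ f'E]; rewrite f'E /= /x_out_hom /x_in_hom.
move: (ext_le_refl _) (ext_le_refl _); rewrite clip_inside /= => h1 h2.
by rewrite !tmap1 compm1 comp1m.
Qed.

(** Restricting to the inside positions recovers the chain map and turns a factorization through [Q]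
    into one through [rst Q]. Two maps with the same restriction differ only by the choice on hulls,
    which is null. *)
Lemma x_fully_faithful :
  fully_faithful (sfunctor (x_recipe H n l a (a + n))).
Proof.
move=> Y Y'; apply: sfunctor_bij => [g|f f' ff' [Q [u [v [hQ f'E]]]]].
  pose f : chain_hom Y Y' := ch_comp (ch_comp (x_out Y') (rst_map g)) (x_in Y).
  have [f' ff'] := sind_ex (x_recipe H n l a (a + n)) (f : @hom (Morm F n) Y Y').
  exists f, f'; split=> //; apply: ext_to_null => j i le E.
  have := ext_hom_inside i ff'.
  have ej := xposI_ord E; subst j.
  move=> /(congr1 (fun k => k ∘ x_out Y i)); rewrite /f /=.
  rewrite -![_ ∘ x_in_hom Y i ∘ x_out_hom Y i]compA !(x_inK Y) !compm1 => e.
  suff : ext_map H Y' le ∘ ((f' : chain_hom _ _) (clip l (a + i)) -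
      (g : chain_hom _ _) (clip l (a + i))) = 0 by [].
  apply/eqP; rewrite compBr subr_eq0; apply/eqP.
  by move: e; rewrite /x_out_hom (bool_irrelevance le (ext_le_refl (clip_inside i))).
pose u1 : chain_hom Y (rst Q) := ch_comp (rst_map u) (x_in Y).
pose v1 : chain_hom (rst Q) Y' := ch_comp (x_out Y') (rst_map v).
exists (rst Q : Morm F n), u1, v1; split.
  by apply/Morm_projective => i; move/Morm_projective: hQ; apply.
apply: chain_homP => i /=.
rewrite (ext_hom_inside i ff') f'E /=.
by rewrite !compA.
Qed.

Section Induced.
Variables (Y Y' : chain F n) (v : chain_hom Y Y').

Lemma ext_hom_in (k : hom (hullI H (Y ord_max)) (hullI H (Y' ord_max))) (e : ext n)
    (i : 'I_n.+1) (h : ext_le (Inside i) e) :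
  k ∘ xhull H Y = xhull H Y' ∘ v ord_max ->
  ext_hom v k e ∘ ext_map H Y h = ext_map H Y' h ∘ v i.
Proof.
move=> kE; case: e h => [|i'|] //= h; first exact/esym/cm_nat.
by rewrite compA kE -!compA; congr (_ ∘ _); exact/esym/cm_nat.
Qed.

Lemma ext_hom_out (k : hom (hullI H (Y ord_max)) (hullI H (Y' ord_max))) (e : ext n)
    (i : 'I_n.+1) (h : ext_le e (Inside i)) :
  ext_map H Y' h ∘ ext_hom v k e = v i ∘ ext_map H Y h.
Proof.
case: e h => [|i'|] //= h; first by rewrite comp0m compm0.
exact: cm_nat.
Qed.

Variable v1 : chain_hom (xo Y) (xo Y').
Hypothesis vv1 : sind (s := x_recipe H n l a (a + n)) (v : @hom (Morm F n) Y Y') v1.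

Lemma x_induced_in (j : 'I_l.+1) (i : 'I_n.+1) (h : ext_le (Inside i) (xp j)) :
  v1 j ∘ ext_map H Y h = ext_map H Y' h ∘ v i.
Proof. by have [k kE v1E] := vv1; rewrite v1E; exact: ext_hom_in. Qed.

Lemma x_induced_out (j : 'I_l.+1) (i : 'I_n.+1) (h : ext_le (xp j) (Inside i)) :
  ext_map H Y' h ∘ v1 j = v i ∘ ext_map H Y h.
Proof. by have [k kE v1E] := vv1; rewrite v1E; exact: ext_hom_out. Qed.

End Induced.

Variable phi : nat -> nat.
Hypothesis phi_homo : {homo phi : i j / (i <= j)%N}.
Hypothesis phiE : forall i : 'I_n.+1, phi i = (a + i)%N.

Lemma phi_xpos (i : 'I_n.+1) : xp (clip l (phi i)) = Inside i.
Proof. by rewrite phiE clip_inside. Qed.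

Lemma phi_le (i : 'I_n.+1) : (clip l (phi i) <= clip l (a + i))%N.
Proof. by rewrite phiE. Qed.

Lemma phi_ge (i : 'I_n.+1) : (clip l (a + i) <= clip l (phi i))%N.
Proof. by rewrite phiE. Qed.

(** For [a = 0] nothing lies below the inside positions, so every map on the restriction extends.
    [phi] stays abstract since the [omit_pos] of [hat_gamma] agrees with [a + i] only on positions
    of the shorter chain. *)
Lemma restriction_adjoint_x : a = 0%N ->
  sfunctor (reindex_recipe F l n phi_homo) ⊣ sfunctor (x_recipe H n l a (a + n)).
Proof.
move=> a0; pose R (Y : chain F n) := reindex_ob n phi_homo (xo Y).
pose e (Y : chain F n) (i : 'I_n.+1) : hom (R Y i) (Y i) :=
  ext_map H Y (ext_le_refl (phi_xpos i)).
have en (Y : chain F n) (i j : 'I_n.+1) (h : (i <= j)%N) :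
    tmap Y h ∘ e Y i = e Y j ∘ tmap (R Y) h.
  have le : ext_le (xp (clip l (phi i))) (Inside j) by rewrite phi_xpos.
  by rewrite [RHS](ext_mapM H Y _ _ le) [LHS](@ext_mapM _ H _ Y _ (Inside i) (Inside j) _ h le).
pose eps Y := @ChainHom _ _ (R Y) Y (e Y) (@en Y).
apply: (@stable_adjoint_counit _ _ (reindex_recipe F l n phi_homo)
  (x_recipe H n l a (a + n)) eps).
- move=> Y Y' v.
  have [v1 vv1] := sind_ex (x_recipe H n l a (a + n)) v.
  have [v2 v12] := sind_ex (reindex_recipe F l n phi_homo) v1.
  exists v1, v2; split=> //; apply: chain_homP => i /=; rewrite v12 /=.
  have k := x_induced_out vv1 (ext_le_refl (phi_xpos i)); exact: k.
- move=> X Y g; set g_ := (g : chain_hom (reindex_ob n phi_homo X) Y).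
  have gn (i j : 'I_n.+1) (h : (i <= j)%N) :
      tmap (Y : chain F n) h ∘ (g_ i ∘ tmap (X : chain F l) (phi_ge i)) =
      (g_ j ∘ tmap (X : chain F l) (phi_ge j)) ∘ tmap (rst X) h.
    rewrite compA cm_nat /= -!compA; congr (_ ∘ _).
    have le : (clip l (a + i) <= clip l (phi j))%N.
      by rewrite phiE; apply: clip_homo; rewrite leq_add2l.
    by rewrite !(tmapM X _ _ le).
  have [|f fE] := @ext_to X Y (@ChainHom _ _ (rst X) Y _ gn).
    by move=> i j h; have := a0; lia.
  have [f' ff'] := sind_ex (reindex_recipe F l n phi_homo)
    (f : @hom (Morm F l) X (xo Y)).
  exists f, f'; split=> //; apply: chain_homP => i /=; rewrite ff' /e.
  rewrite (fE _ _ _ (phi_le i)) /= -compA (tmapM (X : chain F l) _ _ (leqnn _)).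
  by rewrite tmap1 compm1.
- move=> X Y f f' ff' f0; apply: ext_to_null => j i h E.
  have ej : j = clip l (phi i) by rewrite phiE; exact: xposI_ord.
  subst j; have /(congr1 (fun k : chain_hom _ _ => k i)) /= := f0.
  by rewrite ff' /e (bool_irrelevance h (ext_le_refl (phi_xpos i))).
Qed.

(** For [a + n = l] the extension merely prepends zeros, so a map out of it amounts to a map out of
    [Y]. *)
Lemma x_adjoint_restriction : (a + n)%N = l ->
  sfunctor (x_recipe H n l a (a + n)) ⊣ sfunctor (reindex_recipe F l n phi_homo).
Proof.
move=> anE; pose R (Y : chain F n) := reindex_ob n phi_homo (xo Y).
pose e (Y : chain F n) (i : 'I_n.+1) : hom (Y i) (R Y i) :=
  ext_map H Y (ext_le_refl (esym (phi_xpos i))).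
have en (Y : chain F n) (i j : 'I_n.+1) (h : (i <= j)%N) :
    tmap (R Y) h ∘ e Y i = e Y j ∘ tmap Y h.
  have le : ext_le (Inside i) (xp (clip l (phi j))) by rewrite phi_xpos.
  by rewrite [LHS](ext_mapM H Y _ _ le) [RHS](@ext_mapM _ H _ Y (Inside i) (Inside j) _ h _ le).
pose eta Y := @ChainHom _ _ Y (R Y) (e Y) (@en Y).
apply: (@stable_adjoint_unit _ _ (x_recipe H n l a (a + n))
  (reindex_recipe F l n phi_homo) eta).
- move=> Y Y' v.
  have [v1 vv1] := sind_ex (x_recipe H n l a (a + n)) v.
  have [v2 v12] := sind_ex (reindex_recipe F l n phi_homo) v1.
  exists v1, v2; split=> //; apply: chain_homP => i /=; rewrite v12 /=.
  have k := x_induced_in vv1 (ext_le_refl (esym (phi_xpos i))); exact: k.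
- move=> Y X g; set g_ := (g : chain_hom Y (reindex_ob n phi_homo X)).
  have gn (i j : 'I_n.+1) (h : (i <= j)%N) :
      tmap (rst X) h ∘ (tmap (X : chain F l) (phi_le i) ∘ g_ i) =
      (tmap (X : chain F l) (phi_le j) ∘ g_ j) ∘ tmap (Y : chain F n) h.
    rewrite -compA -(cm_nat g_) /= !compA; congr (_ ∘ _).
    have le : (clip l (phi i) <= clip l (a + j))%N.
      by rewrite phiE; apply: clip_homo; rewrite leq_add2l.
    by rewrite !(tmapM X _ _ le).
  have [|f [fE _]] := @ext_from Y X (@ChainHom _ _ Y (rst X) _ gn) 0.
    by have := anE; lia.
  have [f' ff'] := sind_ex (reindex_recipe F l n phi_homo)
    (f : @hom (Morm F l) (xo Y) X).
  exists f, f'; split=> //; apply: chain_homP => i /=; rewrite ff' /e.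
  rewrite (fE _ _ _ (phi_ge i)) /= compA (tmapM (X : chain F l) _ _ (leqnn _)).
  by rewrite tmap1 comp1m.
- move=> Y X f f' ff' f0.
  apply: (@ext_from_null Y X f (zob F) 0 0); first exact: projective_zob.
  + by rewrite comp0m.
  + move=> j i h E.
    have ej : j = clip l (phi i) by rewrite phiE; exact: xposI_ord.
    subst j; have /(congr1 (fun k : chain_hom _ _ => k i)) /= := f0.
    by rewrite ff' /e (bool_irrelevance h (ext_le_refl (esym (phi_xpos i)))).
  + by move=> j hA; have := xposA (above_le hA); have := leq_ord j; lia.
Qed.

End Extension.

(** * The adjunctions of hat-gamma, delta_c and check-gamma *)

Section HatGamma.
Variables (F : frobenius) (H : hulls F) (n l a : nat).
Hypothesis anl : (a.+1 + n <= l)%N.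
Let ex := frob_exact F.
Local Notation xp := (xpos n a.+1 (a.+1 + n)).
Local Notation xo := (x_ob H l a.+1 (a.+1 + n)).

Lemma ck_below (X : chain F l) (k : 'I_n.+1) T (f : hom (X (clip l (a.+1 + k))) T)
    (j : 'I_l.+1) (h : (j <= clip l (a.+1 + k))%N) :
  (j < a.+1)%N -> f ∘ tmap X (ck_le l a k) = 0 -> f ∘ tmap X h = 0.
Proof.
move=> ja f0; have h' : (j <= clip l a)%N by have := leq_ord j; rewrite /=; lia.
by rewrite -(tmapM X h' (ck_le l a k)) compA f0 comp0m.
Qed.

Lemma ck_factor (X : chain F l) (Z : chain F n) (g : chain_hom (rst n a.+1 X) Z) :
  (forall k : 'I_n.+1, g k ∘ tmap X (ck_le l a k) = 0) ->
  exists G : chain_hom (ck_ob n a X) Z, forall k : 'I_n.+1, G k ∘ ckp a X k = g k.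
Proof.
move=> g0; pose G (k : 'I_n.+1) := cok_fact ex (tmap_infl X (ck_le l a k)) (g0 k).
have GE (k : 'I_n.+1) : G k ∘ ckp a X k = g k by exact: cok_factE.
have Gn (i j : 'I_n.+1) (h : (i <= j)%N) :
    tmap Z h ∘ G i = G j ∘ tmap (ck_ob n a X) h.
  apply: (cok_inj ex); rewrite -/(ckp a X i) -!compA GE ck_mapE compA GE.
  rewrite (cm_nat g); congr (_ ∘ _).
  exact: (tmap_irrelevance X).
by exists (@ChainHom _ _ (ck_ob n a X) Z G Gn).
Qed.

(** The term of [xo Y] at position [a] is 0, so the inside components of a map from [X] kill [X^a]
    and descend to the cokernels; by [ext_to_null] the hull components carry no stable
    information. *)
Lemma ck_adjoint_x :
  sfunctor (ck_recipe F l n a) ⊣ sfunctor (x_recipe H n l a.+1 (a.+1 + n)).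
Proof.
have /dep_choice[eps epsE] (Y : chain F n) :
    exists G : chain_hom (ck_ob n a (xo Y)) Y,
      forall k : 'I_n.+1, G k ∘ ckp a (xo Y) k = x_out H anl Y k.
  apply: ck_factor => k.
  have le : (clip l a < a.+1)%N by rewrite /= ltnS geq_minr.
  have le' : ext_le (xp (clip l a)) (Inside k) by rewrite (xpos_below _ le).
  apply: etrans (ext_mapM H Y (xpos_le n a.+1 (a.+1 + n) (ck_le l a k)) _ le') _.
  by apply: ext_map_below; exact: xpos_below.
apply: (@stable_adjoint_counit _ _ (ck_recipe F l n a)
  (x_recipe H n l a.+1 (a.+1 + n)) eps).
- move=> Y Y' v.
  have [v1 vv1] := sind_ex (x_recipe H n l a.+1 (a.+1 + n)) v.
  have [v2 v12] := sind_ex (ck_recipe F l n a) v1.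
  exists v1, v2; split=> //; apply: chain_homP => i; apply: (cok_inj ex).
  rewrite -/(ckp a (xo Y) i) /= -!compA v12 !compA epsE -[RHS]compA epsE.
  have k := x_induced_out vv1 (ext_le_refl (clip_inside anl i)); exact: k.
- move=> X Y g; set g_ := (g : chain_hom (ck_ob n a X) Y).
  have gn (i j : 'I_n.+1) (h : (i <= j)%N) :
      tmap (Y : chain F n) h ∘ (g_ i ∘ ckp a X i) =
      (g_ j ∘ ckp a X j) ∘ tmap (rst n a.+1 X) h.
    rewrite compA (cm_nat g_) -!compA; congr (_ ∘ _); apply: etrans (ck_mapE a X h) _.
    congr (_ ∘ _); exact: (tmap_irrelevance X).
  have [|f fE] := @ext_to F H n l a.+1 anl X Y (@ChainHom _ _ (rst n a.+1 X) Y _ gn).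
    move=> i j h ja; apply: (ck_below _ ja) => /=.
    by rewrite -compA cokp0 ?compm0.
  have [f' ff'] := sind_ex (ck_recipe F l n a) (f : @hom (Morm F l) X (xo Y)).
  exists f, f'; split=> //; apply: chain_homP => i; apply: (cok_inj ex).
  rewrite -/(ckp a X i) /= -compA ff' compA epsE.
  apply: etrans (fE _ _ _ (leqnn _)) _.
  by rewrite tmap1 compm1.
- move=> X Y f f' ff' f0; apply: (ext_to_null anl) => j i h E.
  have ej := xposI_ord E; subst j.
  have /(congr1 (fun k : chain_hom (ck_ob n a X) Y => k i ∘ ckp a X i)) := f0.
  rewrite /= comp0m -compA ff' compA epsE => <-.
  by rewrite /= /x_out_hom (bool_irrelevance h (ext_le_refl (clip_inside anl i))).
Qed.

End HatGamma.

Lemma coverp_iso (F : frobenius) (H : hulls F) (A : F) :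
  projective A -> is_iso (coverp H A).
Proof.
move=> hA; rewrite /coverp /coverP (pcover_id H hA) /=.
by exists (idm A); rewrite comp1m.
Qed.

Section CheckGamma.
Variables (F : frobenius) (H : hulls F) (n l a : nat).
Hypothesis anl : (a + n < l)%N.
Let ex := frob_exact F.
Let anl' : (a + n <= l)%N := ltnW anl.
Local Notation b := (a + n)%N.
Local Notation xp := (xpos n a b).
Local Notation xo := (x_ob H l a b).
Local Notation plo := (pl_ob H n a b).

Lemma pl_induced (X X' : chain F l) (f : chain_hom X X')
    (h : hom (coverP H (X (pl_end l b))) (coverP H (X' (pl_end l b)))) :
  pl_cov H b X' ∘ h = f (pl_end l b) ∘ pl_cov H b X ->
  exists f' : chain_hom (plo X) (plo X'), forall k : 'I_n.+1,
    pl1 H a b X' k ∘ f' k = f (pl_pos l a b k) ∘ pl1 H a b X k /\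
    pl2 H a b X' k ∘ f' k = h ∘ pl2 H a b X k.
Proof.
move=> hE.
have e (k : 'I_n.+1) : tmap X' (pl_le l a b k) ∘ (f (pl_pos l a b k) ∘ pl1 H a b X k) =
    pl_cov H b X' ∘ (h ∘ pl2 H a b X k).
  by rewrite !compA hE (cm_nat f) -!compA plE.
have /dep_choice[w wE] (k : 'I_n.+1) := pb_pair_ex ex (pl_defl H b X') (e k).
have wn (i j : 'I_n.+1) (hij : (i <= j)%N) :
    tmap (plo X') hij ∘ w i = w j ∘ tmap (plo X) hij.
  have [wi1 wi2] := wE i; have [wj1 wj2] := wE j.
  apply: pl_inj; rewrite /= !compA.
    rewrite pl1_map -[LHS]compA [pl1 _ _ _ _ _ ∘ w i]wi1 [pl1 _ _ _ _ _ ∘ w j]wj1.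
    by rewrite -[RHS]compA pl1_map !compA cm_nat.
  by rewrite pl2_map [LHS]wi2 [pl2 _ _ _ _ _ ∘ w j]wj2 -compA pl2_map.
exists (@ChainHom _ _ (plo X) (plo X') w wn) => k; exact: wE.
Qed.

Lemma pl_pos_inside (k : 'I_n.+1) : xp (pl_pos l a b k) = Inside k.
Proof. by apply: xpos_inside; rewrite /=; have := leq_ord k; lia. Qed.

Lemma pl_end_above : xp (pl_end l b) = Above n.
Proof. by apply: xpos_above; rewrite /=; lia. Qed.

Lemma x_cover_iso (Y : chain F n) : is_iso (pl_cov H b (xo Y)).
Proof.
apply: coverp_iso; rewrite /= pl_end_above /=.
exact/proj_inj/ihull_inj.
Qed.

(** The hull of [Y^n] is projective, so its cover is invertible and pulling back along it changes
    nothing: this is the unit. Conversely, a map into the pullbacks has a component from [Y^n] to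
    the cover of [X^(b+1)], which extends over the hull because that cover is injective. *)
Lemma x_adjoint_pl :
  sfunctor (x_recipe H n l a b) ⊣ sfunctor (pl_recipe H l n a b).
Proof.
have /dep_choice[s sP] (Y : chain F n) :
    exists s : hom (xo Y (pl_end l b)) (coverP H (xo Y (pl_end l b))),
      s ∘ pl_cov H b (xo Y) = idm _ /\ pl_cov H b (xo Y) ∘ s = idm _.
  by have [s] := x_cover_iso Y; exists s.
have le1 (k : 'I_n.+1) : ext_le (Inside k) (xp (pl_pos l a b k)).
  exact/ext_le_refl/esym/pl_pos_inside.
have le2 (k : 'I_n.+1) : ext_le (Inside k) (xp (pl_end l b)) by rewrite pl_end_above.
have /dep_choice[eta etaE] (Y : chain F n) : exists eta : chain_hom Y (plo (xo Y)),
    forall k : 'I_n.+1, pl1 H a b (xo Y) k ∘ eta k = ext_map H Y (le1 k) /\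
      pl2 H a b (xo Y) k ∘ eta k = s Y ∘ ext_map H Y (le2 k).
  have e (k : 'I_n.+1) : tmap (xo Y) (pl_le l a b k) ∘ ext_map H Y (le1 k) =
      pl_cov H b (xo Y) ∘ (s Y ∘ ext_map H Y (le2 k)).
    rewrite compA (sP Y).2 comp1m; exact: (ext_mapM H Y).
  have /dep_choice[w wE] (k : 'I_n.+1) := pb_pair_ex ex (pl_defl H b (xo Y)) (e k).
  have wn (i j : 'I_n.+1) (h : (i <= j)%N) :
      tmap (plo (xo Y)) h ∘ w i = w j ∘ tmap Y h.
    have [wi1 wi2] := wE i; have [wj1 wj2] := wE j.
    apply: pl_inj; rewrite /= !compA.
      rewrite pl1_map -[LHS]compA [pl1 _ _ _ _ _ ∘ w i]wi1 [pl1 _ _ _ _ _ ∘ w j]wj1.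
      have le : ext_le (Inside i) (xp (pl_pos l a b j)) by rewrite pl_pos_inside.
      apply: etrans (ext_mapM H Y _ _ le) (esym _).
      exact: (@ext_mapM _ H _ Y (Inside i) (Inside j) _ h).
    rewrite pl2_map [LHS]wi2 [pl2 _ _ _ _ _ ∘ w j]wj2 -compA; congr (_ ∘ _).
    exact/esym/(@ext_mapM _ H _ Y (Inside i) (Inside j) _ h).
  by exists (@ChainHom _ _ Y (plo (xo Y)) w wn).
apply: (@stable_adjoint_unit _ _ (x_recipe H n l a b) (pl_recipe H l n a b) eta).
- move=> Y Y' v.
  have [v1 vv1] := sind_ex (x_recipe H n l a b) v.
  have [v2 v12] := sind_ex (pl_recipe H l n a b) v1.
  exists v1, v2; split=> //; apply: chain_homP => k.
  have [h hE /(_ k)[p1 p2]] := v12.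
  have [e1 e2] := etaE Y k; have [e1' e2'] := etaE Y' k.
  apply: pl_inj; rewrite /= compA [RHS]compA.
    rewrite p1 e1' -compA e1; have t := x_induced_in vv1 (le1 k); exact: t.
  rewrite p2 e2' -compA e2 -compA -(x_induced_in vv1) compA compA; congr (_ ∘ _).
  rewrite -[LHS]comp1m -(sP Y').1 -!compA [_ ∘ (h ∘ _)]compA hE.
  by rewrite -[_ ∘ s Y]compA (sP Y).2 compm1.
- move=> Y X g; set g_ := (g : chain_hom Y (plo X)).
  have pe (k : 'I_n.+1) : (pl_pos l a b k <= clip l (a + k))%N.
    by apply: clip_homo; exact: geq_minr.
  have ep (k : 'I_n.+1) : (clip l (a + k) <= pl_pos l a b k)%N.
    by apply: clip_homo; have := leq_ord k; lia.
  have gn (i j : 'I_n.+1) (h : (i <= j)%N) :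
      tmap (rst n a X) h ∘ (tmap (X : chain F l) (pe i) ∘ pl1 H a b X i ∘ g_ i) =
      (tmap (X : chain F l) (pe j) ∘ pl1 H a b X j ∘ g_ j) ∘ tmap (Y : chain F n) h.
    rewrite -[RHS]compA -(cm_nat g_) !compA; congr (_ ∘ _).
    rewrite -[RHS]compA [pl1 _ _ _ _ _ ∘ _]pl1_map !compA; congr (_ ∘ _).
    rewrite (tmapM X _ _ (leq_trans (pl_pos_le l a b h) (pe j))).
    exact: (tmapM X).
  pose gm := @ChainHom _ _ Y (rst n a X) _ gn.
  have hP := (proj_inj _).1 (@pcover_proj F H ((X : chain F l) (pl_end l b))).
  have [h hE] := hP _ _ (xhull H Y) (pl2 H a b X ord_max ∘ g_ ord_max) (xhull_infl H Y).
  have [|f [fI fA]] := @ext_from F H n l a anl' Y X gm (pl_cov H b X ∘ h).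
    move=> _ le; rewrite -compA hE compA -plE /= !compA; congr (_ ∘ _ ∘ _).
    exact/esym/(tmapM X).
  have leA : ext_le (Above n) (xp (pl_end l b)) by rewrite pl_end_above.
  have geA : ext_le (xp (pl_end l b)) (Above n) by rewrite pl_end_above.
  (* The lift between covers is free in [sind]; this one makes the second projection of the
     transpose equal to that of [g]. *)
  have [|f' f'E] := @pl_induced (xo Y) X f (h ∘ ext_map H Y geA ∘ pl_cov H b (xo Y)).
    rewrite !compA; congr (_ ∘ _).
    have := fA (pl_end l b) leA (leqnn _); rewrite tmap1 comp1m => <-.
    by rewrite -compA (ext_map_id H Y geA leA) compm1.
  exists f, f'; split.
    exists (h ∘ ext_map H Y geA ∘ pl_cov H b (xo Y)) => //.
    rewrite !compA; congr (_ ∘ _).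
    have := fA (pl_end l b) leA (leqnn _); rewrite tmap1 comp1m => <-.
    by rewrite -compA (ext_map_id H Y geA leA) compm1.
  apply: chain_homP => k; have [p1 p2] := f'E k; have [e1 e2] := etaE Y k.
  apply: pl_inj; rewrite /= compA.
    rewrite p1 -compA e1 (fI _ _ _ (ep k)) /= !compA.
    by rewrite (tmapM (X : chain F l) _ _ (leqnn _)) tmap1 comp1m.
  rewrite p2 -compA e2 compA -[_ ∘ s Y]compA (sP Y).2 compm1 -compA.
  have -> : ext_map H Y geA ∘ ext_map H Y (le2 k) =
      xhull H Y ∘ tmap (Y : chain F n) (leq_ord k : (k <= @ord_max n)%N).
    exact: (@ext_mapM _ H _ Y (Inside k) _ (Above n)).
  rewrite compA hE -compA -(cm_nat g_) compA; congr (_ ∘ _); exact: pl2_map.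
- move=> Y X f f' [h hE f'E] f0.
  have leA : ext_le (Above n) (xp (pl_end l b)) by rewrite pl_end_above.
  have e0 (k : 'I_n.+1) : (f' : chain_hom _ _) k ∘ eta Y k = 0.
    by move: f0 => /(congr1 (fun t : chain_hom _ _ => t k)).
  (* On hull terms [f] passes through the cover of [X^(b+1)], and the map into that cover kills
     [Y^n] because the second projection of the transpose is zero. *)
  apply: (@ext_from_null F H n l a anl' Y X f _ (h ∘ s Y ∘ ext_map H Y leA) (pl_cov H b X)).
  + exact: pcover_proj.
  + have [_ p2] := f'E ord_max; have [_ e2] := etaE Y ord_max.
    have -> : h ∘ s Y ∘ ext_map H Y leA ∘ xhull H Y = h ∘ (s Y ∘ ext_map H Y (le2 ord_max)).
      rewrite -!compA; congr (_ ∘ (_ ∘ _)).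
      have := @ext_mapM _ H _ Y (Inside ord_max) (Above n) _ isT leA (le2 ord_max).
      by rewrite /= tmap1 compm1.
    by rewrite -e2 compA -p2 -compA e0 compm0.
  + move=> j i hI E.
    have ej : j = pl_pos l a b i.
      by apply: val_inj; have := xposI E; have := leq_ord j; have := leq_ord i; rewrite /=; lia.
    subst j; have [p1 _] := f'E i; have [e1 _] := etaE Y i.
    rewrite (bool_irrelevance hI (le1 i)) -e1 compA -p1 -compA e0.
    by rewrite compm0.
  + move=> j hA h'.
    rewrite -(@ext_mapM _ H _ Y (Above n) (xp (pl_end l b)) (xp j) leA (xpos_le _ _ _ h')).
    have e := cm_nat f h'; rewrite compA [f j ∘ _](esym e).
    rewrite !compA; congr (_ ∘ _); rewrite -!compA; congr (_ ∘ _).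
    by rewrite compA hE -compA (sP Y).2 compm1.
Qed.

End CheckGamma.

(** * Theta as an equivalence *)

Section HatGammaOnImage.
Variables (F : frobenius) (H : hulls F) (n l c : nat).
Hypothesis cnl : (c + n < l)%N.
Let ex := frob_exact F.
Local Notation xp := (xpos n c (c + n)).
Local Notation xo := (x_ob H l c (c + n)).
Local Notation L := (ck_pos l c (@ord_max n)).

Lemma xo_below (Y : chain F n) (j : 'I_l.+1) T (f : hom (xo Y j) T) :
  (j < c)%N -> f = 0.
Proof.
move=> jc; have E : xp j = Below n by exact: xpos_below.
have e : idm (xo Y j) = 0.
  by rewrite -(ext_map_id H Y (ext_le_refl E) (ext_le_refl (esym E)))
    (ext_map_below _ _ _ E) compm0.
by rewrite -[f]compm1 e compm0.
Qed.

Lemma last_above : xp L = Above n.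
Proof. by apply: xpos_above; rewrite /=; lia. Qed.

Lemma le_above (e : ext n) : ext_le e (Above n).
Proof. by case: e. Qed.

Section Image.
Variable Y : chain F n.
Local Notation W := (xo Y).
Local Notation I := (hullI H (Y ord_max)).

Definition hull_in : hom I (W L) := ext_map H Y (ext_le_refl (esym last_above)).

Definition hull_out (j : 'I_l.+1) : hom (W j) I := ext_map H Y (le_above (xp j)).

Lemma hull_out_tmap (i j : 'I_l.+1) (h : (i <= j)%N) :
  hull_out j ∘ tmap W h = hull_out i.
Proof. exact: (@ext_mapM _ H _ Y (xp i) (xp j) (Above n)). Qed.

Lemma hull_outK : hull_in ∘ hull_out L = idm (W L).
Proof.
exact: (@ext_map_id _ H _ Y (xp L) (Above n) _ (ext_le_refl (esym last_above))).
Qed.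

Lemma hull_in_out (j : 'I_l.+1) (h : (j <= L)%N) : hull_in ∘ hull_out j = tmap W h.
Proof. by rewrite -(hull_out_tmap h) compA hull_outK comp1m. Qed.

Lemma hull_above (j : 'I_l.+1) (h : (L <= j)%N) :
  tmap W h ∘ (hull_in ∘ hull_out j) = idm (W j).
Proof.
have E : xp j = Above n by apply: xpos_above; move: h; rewrite /=; lia.
rewrite compA.
have e : tmap W h ∘ hull_in = ext_map H Y (ext_le_refl (esym E)).
  exact: (@ext_mapM _ H _ Y (Above n) (xp L) (xp j)).
rewrite e; exact: (@ext_map_id _ H _ Y (xp j) (Above n)).
Qed.

(** Lifting through a projection onto a cokernel is needed only at [L], the first position where [W]
    takes the projective value [I]. The monics into the last term of [X] then force all other
    components. *)
Lemma ck_full (X : chain F l) (g : chain_hom (ck_ob n c W) (ck_ob n c X)) :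
  exists f : chain_hom W X, forall k : 'I_n.+1, g k ∘ ckp c W k = ckp c X k ∘ f (ck_pos l c k).
Proof.
pose pX := ckp c X (@ord_max n); pose pW := ckp c W (@ord_max n).
have [h hE] : exists h, pX ∘ h = g ord_max ∘ pW ∘ hull_in.
  have hI : projective I by exact/proj_inj/ihull_inj.
  apply: hI.
  by exists (X (clip l c)), (tmap X (ck_le l c (@ord_max n))); exact: cok_conf.
have [fL flE] : exists f, f = h ∘ hull_out L by exists (h ∘ hull_out L).
have fLE : pX ∘ fL = g ord_max ∘ pW.
  by rewrite flE compA hE -!compA hull_outK compm1.
pose Lm := leq_ord L : (L <= @ord_max l)%N.
have [|f fE] := @chain_hom_from_last F l W X (tmap X Lm ∘ h ∘ hull_out ord_max).
  move=> i; rewrite -compA hull_out_tmap.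
  case: (ltnP i c) => ic.
    exists 0; rewrite compm0; exact/esym/xo_below.
  case: (leqP L i) => Li.
    exists (tmap X Li ∘ h ∘ hull_out i); rewrite !compA; congr (_ ∘ _ ∘ _).
    exact: tmapM.
  pose Li' := ltnW Li : (i <= L)%N.
  (* Between [c] and [L] the lift must land in [X^i]. A [q] that kills [X^i] also kills [X^c], so it
     factors through the last cokernel, where [g] is compatible with its earlier components. *)
  have [|x xE] := @inflation_factor F ex _ _ _ (tmap X Li') (fL ∘ tmap W Li') (tmap_infl X Li').
    move=> D q q0.
    have ci : (clip l c <= i)%N by rewrite /=; lia.
    have qc : q ∘ tmap X (ck_le l c (@ord_max n)) = 0.
      by rewrite -(tmapM X ci Li') compA q0 comp0m.
    have [q' q'E] := cok_fact_ex ex (tmap_infl X (ck_le l c (@ord_max n))) qc.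
    have {}q'E : q' ∘ pX = q by exact: q'E.
    rewrite -q'E compA -[q' ∘ pX ∘ fL]compA fLE.
    (* Position [c] carries no component of [g]; there the projection [pW] vanishes on [W^c] by
       itself. *)
    move: ic; rewrite leq_eqVlt => /orP[/eqP ic|ic].
      have ei : i = clip l c by apply: val_inj; have := leq_ord i; rewrite /=; lia.
      subst i; rewrite -!compA [pW ∘ _](_ : _ = 0) ?compm0 //.
      by rewrite (tmap_irrelevance W Li' (ck_le l c (@ord_max n))); exact: cokp0.
    have [k ek] : exists k : 'I_n.+1, i = ck_pos l c k.
      have ik : (i - c.+1 < n.+1)%N by have := Li; rewrite /=; lia.
      exists (Ordinal ik); apply: val_inj; have := leq_ord i; rewrite /=; lia.
    subst i; have kn : (k <= @ord_max n)%N by exact: leq_ord.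
    have -> : q' ∘ (g ord_max ∘ pW) ∘ tmap W Li' =
        q' ∘ ck_map c X kn ∘ g k ∘ ckp c W k.
      have gk : ck_map c X kn ∘ g k = g ord_max ∘ ck_map c W kn by exact: (cm_nat g).
      rewrite -[q' ∘ ck_map c X kn ∘ g k]compA gk -!compA; congr (_ ∘ (_ ∘ _)).
      rewrite ck_mapE; congr (_ ∘ _); exact: tmap_irrelevance.
    have -> : q' ∘ ck_map c X kn = 0; last by rewrite !comp0m.
    apply: (cok_inj ex); rewrite -/(ckp c X k) comp0m -compA ck_mapE compA.
    by rewrite [q' ∘ _]q'E (tmap_irrelevance X _ Li') q0.
  exists x; have iL := tmapM X Li' Lm (leq_ord i : (i <= @ord_max l)%N).
  by rewrite -iL -compA xE flE -compA hull_out_tmap compA.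
exists f => k.
have kn : (k <= @ord_max n)%N by exact: leq_ord.
have kL : (ck_pos l c k <= L)%N by exact: (ck_pos_le l c kn).
have fLE' : f L = fL.
  apply: (inflation_mono ex (tmap_infl X Lm)); rewrite (fE _ Lm) flE.
  by rewrite -compA hull_out_tmap compA.
apply: (inflation_mono ex (tmap_infl (ck_ob n c X) kn)); rewrite compA (cm_nat g).
rewrite -compA; have -> : tmap (ck_ob n c W) kn ∘ ckp c W k = pW ∘ tmap W kL.
  by rewrite [LHS]ck_mapE; congr (_ ∘ _); exact: tmap_irrelevance.
rewrite compA -fLE [RHS]compA; have -> : tmap (ck_ob n c X) kn ∘ ckp c X k = pX ∘ tmap X kL.
  by rewrite [LHS]ck_mapE; congr (_ ∘ _); exact: tmap_irrelevance.
by rewrite -!compA -fLE' (cm_nat f).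
Qed.

(** Vanishing on the last cokernel makes [t] at [L] factor through [X^c]; hence the whole of [t]
    factors through the hull placed from position [c] on. *)
Lemma ck_null (X : chain F l) (t : chain_hom W X) :
  (forall k : 'I_n.+1, ckp c X k ∘ t (ck_pos l c k) = 0) ->
  @factors_proj (Morm F l) W X t.
Proof.
move=> t0.
pose iX := tmap_infl X (ck_le l c (@ord_max n)).
have [y [yE _]] := (conf_ker ex (cok_conf iX)).2 _ _ (t0 ord_max).
have {}yE : tmap X (ck_le l c (@ord_max n)) ∘ y = t L by exact: yE.
have uE (i : 'I_l.+1) (h : (i <= @ord_max l)%N) :
    hull_out ord_max ∘ tmap W h = hull_out i by exact: hull_out_tmap.
apply: (@null_from F l W X t c I (hull_out ord_max) (y ∘ hull_in)).
- exact/proj_inj/ihull_inj.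
- move=> i ic; split=> [|h]; first exact: xo_below.
  rewrite uE; exact: xo_below.
- move=> i h h' ci; rewrite -[RHS]compA uE -[RHS]compA -[y ∘ _ ∘ _]compA.
  case: (leqP i L) => iL.
    rewrite (hull_in_out iL); apply: (inflation_mono ex (tmap_infl X iL)).
    by rewrite !compA (tmapM X _ _ (ck_le l c (@ord_max n))) yE (cm_nat t).
  rewrite -[t i]compm1 -(hull_above (ltnW iL)) compA -(cm_nat t) -yE.
  by rewrite !compA (tmapM X _ _ h).
Qed.

End Image.

Lemma ck_bij (Y : chain F n) (X : chain F l) :
  bijective (fun f : @hom (sMorm F l) (xo Y) X => fmap (sfunctor (ck_recipe F l n c)) f).
Proof.
apply: sfunctor_bij => [g|f f' ff' [Q [u [v [hQ f'E]]]]].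
  have [f fE] := ck_full g; exists f, g; split; first exact: fE.
  by rewrite subrr; exact: factors_proj0.
(* [K] is the constant chain at [X^c], the termwise kernel of the projection of the next [n.+1]
   terms onto their cokernels. This projection is thus a deflation of chains, and [v] lifts through
   it. *)
set W := xo Y; pose K := reindex_ob n (fun i j (_ : (i <= j)%N) => leqnn c) X.
have kn (i j : 'I_n.+1) (h : (i <= j)%N) :
    tmap (rst n c.+1 X) h ∘ tmap X (ck_le l c i) = tmap X (ck_le l c j) ∘ tmap K h.
  rewrite [RHS](tmapM X _ _ (ck_le l c j)); exact: (tmapM X).
have pn (i j : 'I_n.+1) (h : (i <= j)%N) :
    tmap (ck_ob n c X) h ∘ ckp c X i = ckp c X j ∘ tmap (rst n c.+1 X) h.
  by rewrite [LHS]ck_mapE; congr (_ ∘ _); exact: (tmap_irrelevance X).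
pose p := @ChainHom _ _ (rst n c.+1 X) (ck_ob n c X) (fun k => ckp c X k) pn.
have dp : @deflation (Morm F n) _ _ p.
  exists (K : Morm F n), (@ChainHom _ _ K (rst n c.+1 X) (fun k => tmap X (ck_le l c k)) kn).
  by move=> k; exact: cok_conf.
have [v' v'E] := hQ _ _ p v dp.
set v'_ := (v' : chain_hom Q (rst n c.+1 X)).
have {}v'E (k : 'I_n.+1) : ckp c X k ∘ v'_ k = (v : chain_hom _ _) k.
  by rewrite -v'E.
have cnl' : (c.+1 + n <= l)%N by [].
set Q_ := (Q : chain F n).
have hQk k : injective_ob (Q_ k) by apply/proj_inj; move/Morm_projective: hQ; apply.
(* [Q] is termwise injective, so the hull of its last term retracts onto that term and the lift of
   [v] continues over the hull. *)
have [r rE] := hQk ord_max _ _ (xhull H Q_) (idm _) (xhull_infl H Q_).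
have un (i j : 'I_n.+1) (h : (i <= j)%N) :
    tmap Q_ h ∘ ((u : chain_hom _ Q_) i ∘ ckp c W i) =
    ((u : chain_hom _ Q_) j ∘ ckp c W j) ∘ tmap (rst n c.+1 W) h.
  rewrite compA (cm_nat u) -!compA; congr (_ ∘ _); rewrite [LHS]ck_mapE.
  by congr (_ ∘ _); exact: (tmap_irrelevance W).
have [|fu fuE] := @ext_to F H n l c.+1 cnl' W Q_ (@ChainHom _ _ (rst n c.+1 W) Q_ _ un).
  move=> i j h jc; apply: (ck_below cnl' _ jc) => /=.
  by rewrite -compA cokp0 ?compm0.
have le1 : (clip l (c.+1 + @ord_max n) <= clip l (c.+1 + n).+1)%N.
  by apply: clip_homo.
have [|fv [fvE _]] := @ext_from F H n l c.+1 cnl' Q_ X v'_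
    (tmap (X : chain F l) le1 ∘ v'_ ord_max ∘ r).
  by move=> _ le; rewrite -compA rE compm1 (tmap_irrelevance X le le1).
(* The correction runs through the extension of [Q] placed at [c.+1] and induces the same [v ∘ u] on
   cokernels, so the difference falls under [ck_null]. *)
apply: (@factors_proj_sub (Morm F l) W X f (ch_comp fv fu)).
  exists (x_ob H l c.+1 (c.+1 + n) Q_ : Morm F l), fu, fv; split=> //.
  have t := @sob_proj _ _ (x_recipe H n l c.+1 (c.+1 + n)) Q hQ; exact: t.
apply: ck_null => k.
suff : ckp c X k ∘ ((f : chain_hom W X) (ck_pos l c k) -
    fv (ck_pos l c k) ∘ fu (ck_pos l c k)) = 0 by [].
have ek := clip_inside cnl' k.
rewrite compBr -[fu _]comp1m -(ext_map_id H Q_ (ext_le_refl ek) (ext_le_refl (esym ek))).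
rewrite -[_ ∘ _ ∘ fu _]compA (fuE _ _ _ (leqnn _)) tmap1 compm1.
rewrite !compA -[ckp c X k ∘ fv _ ∘ _]compA (fvE _ _ _ (leqnn _)) tmap1 comp1m v'E.
rewrite -ff' f'E /=.
by rewrite subrr.
Qed.

End HatGammaOnImage.

Section ExtHom.
Variables (F : frobenius) (H : hulls F) (n : nat) (Y Y' : chain F n).
Variables (v : chain_hom Y Y') (k : hom (hullI H (Y ord_max)) (hullI H (Y' ord_max))).
Hypothesis kE : k ∘ xhull H Y = xhull H Y' ∘ v ord_max.

Lemma ext_hom_nat (e e' : ext n) (h : ext_le e e') :
  ext_map H Y' h ∘ ext_hom v k e = ext_hom v k e' ∘ ext_map H Y h.
Proof.
case: e h => [|i|] h; first by rewrite /= compm0; exact/esym/zob_init.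
  by rewrite (ext_hom_in _ kE).
by case: e' h => //= h; rewrite comp1m compm1.
Qed.

Lemma x_induced_by (l a b : nat) :
  exists w : chain_hom (x_ob H l a b Y) (x_ob H l a b Y'),
    forall j : 'I_l.+1, w j = ext_hom v k (xpos n a b j).
Proof.
pose w (j : 'I_l.+1) : hom (x_ob H l a b Y j) (x_ob H l a b Y' j) :=
  ext_hom v k (xpos n a b j).
have wn (i j : 'I_l.+1) (h : (i <= j)%N) :
    tmap (x_ob H l a b Y') h ∘ w i = w j ∘ tmap (x_ob H l a b Y) h.
  exact: ext_hom_nat.
by exists (ChainHom wn).
Qed.

End ExtHom.

(** * Independence of the placement of an extended chain *)

Section CokernelsOfExtensions.
Variables (F : frobenius) (H : hulls F) (n : nat).
Let ex := frob_exact F.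

Lemma ck_xpos (l c l' c' : nat) (k : 'I_n.+1) : (c + n < l)%N -> (c' + n < l')%N ->
  xpos n c (c + n) (ck_pos l c k) = xpos n c' (c' + n) (ck_pos l' c' k).
Proof.
move=> cnl cnl'; have := leq_ord k; rewrite leq_eqVlt => /orP[/eqP e|kn].
  by rewrite !xpos_above //=; lia.
have h : (k.+1 < n.+1)%N by [].
by rewrite !(@xpos_inside n _ (Ordinal h)) //=; lia.
Qed.

Section Comparison.
Variables (l c l' c' : nat).
Hypotheses (cnl : (c + n < l)%N) (cnl' : (c' + n < l')%N).
Local Notation xo := (x_ob H l c (c + n)).
Local Notation xo' := (x_ob H l' c' (c' + n)).

Definition ck_ext (Y : chain F n) (k : 'I_n.+1) :
    hom (xo Y (ck_pos l c k)) (xo' Y (ck_pos l' c' k)) :=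
  ext_map H Y (ext_le_refl (ck_xpos k cnl cnl')).

Lemma ck_compare (Y : chain F n) :
  exists G : chain_hom (ck_ob n c (xo Y)) (ck_ob n c' (xo' Y)),
    forall k : 'I_n.+1, G k ∘ ckp c (xo Y) k = ckp c' (xo' Y) k ∘ ck_ext Y k.
Proof.
have gn (i j : 'I_n.+1) (h : (i <= j)%N) :
    tmap (ck_ob n c' (xo' Y)) h ∘ (ckp c' (xo' Y) i ∘ ck_ext Y i) =
    (ckp c' (xo' Y) j ∘ ck_ext Y j) ∘ tmap (rst n c.+1 (xo Y)) h.
  rewrite compA [tmap _ h ∘ _]ck_mapE -!compA; congr (_ ∘ _).
  have le : ext_le (xpos n c (c + n) (ck_pos l c i)) (xpos n c' (c' + n) (ck_pos l' c' j)).
    by rewrite (ck_xpos _ cnl cnl'); exact/xpos_le/ck_pos_le.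
  by apply: etrans (ext_mapM H Y _ _ le) (esym _); exact: (ext_mapM H Y).
have [|G GE] := @ck_factor F n l c (xo Y) _ (@ChainHom _ _ (rst n c.+1 (xo Y)) _ _ gn).
  move=> k /=.
  have E : xpos n c (c + n) (clip l c) = xpos n c' (c' + n) (clip l' c').
    by rewrite !(@xpos_inside n _ ord0) //=; lia.
  rewrite -compA [ck_ext Y k ∘ _](_ : _ = tmap (xo' Y) (ck_le l' c' k) ∘
      ext_map H Y (ext_le_refl E)); first by rewrite compA cokp0 ?comp0m.
  have le : ext_le (xpos n c (c + n) (clip l c)) (xpos n c' (c' + n) (ck_pos l' c' k)).
    by rewrite E; exact/xpos_le/ck_le.
  by apply: etrans (ext_mapM H Y _ _ le) (esym _); exact: (ext_mapM H Y).
by exists G.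
Qed.

End Comparison.

(** Wherever the chain is placed, the cokernels are those of [Y^0] in [Y^(k+1)] and, at the end, in
    the hull. The placement [(n.+1, 0)] is the one that defines [Theta]. *)
Lemma ck_x_natiso (l c l' c' : nat) : (c + n < l)%N -> (c' + n < l')%N ->
  natiso (sfunctor (ck_recipe F l n c) ⊙ sfunctor (x_recipe H n l c (c + n)))
         (sfunctor (ck_recipe F l' n c') ⊙ sfunctor (x_recipe H n l' c' (c' + n))).
Proof.
move=> cnl cnl'.
have /dep_choice[t tE] := ck_compare cnl cnl'.
have /dep_choice[t' t'E] := ck_compare cnl' cnl.
have tK (Y : chain F n) (k : 'I_n.+1) : t' Y k ∘ t Y k = idm _.
  apply: (cok_inj ex); rewrite -/(ckp c (x_ob H l c (c + n) Y) k) -compA tE compA t'E.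
  rewrite -compA [ck_ext _ _ _ _ ∘ _](ext_map_id H Y) comp1m.
  by rewrite compm1.
have Kt (Y : chain F n) (k : 'I_n.+1) : t Y k ∘ t' Y k = idm _.
  apply: (cok_inj ex); rewrite -/(ckp c' (x_ob H l' c' (c' + n) Y) k) -compA t'E compA tE.
  rewrite -compA [ck_ext _ _ _ _ ∘ _](ext_map_id H Y) comp1m.
  by rewrite compm1.
exists (fun Y => spi (t Y : @hom (Morm F n) _ _)); split=> [Y|Y Y' x].
  by apply/spi_iso/chain_iso => k; exists (t' Y k); [exact: tK | exact: Kt].
have [v ->] := srepr x.
have [v1 vv1] := sind_ex (x_recipe H n l c (c + n)) v.
have [k kE v1E] := vv1.
(* The same map [k] of hulls induces the morphism in both placements, so the naturality square
   commutes strictly. *)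
have [w1 w1E] := x_induced_by kE l' c' (c' + n).
have vw1 : sind (s := x_recipe H n l' c' (c' + n)) v w1 by exists k.
have [v2 v12] := sind_ex (ck_recipe F l n c) v1.
have [w2 w12] := sind_ex (ck_recipe F l' n c') (w1 : @hom (Morm F l') _ _).
have -> : fmap (sfunctor (ck_recipe F l n c) ⊙ sfunctor (x_recipe H n l c (c + n)))
    (spi v) = spi v2 by rewrite /= (sfmapE vv1) (sfmapE v12).
have -> : fmap (sfunctor (ck_recipe F l' n c') ⊙ sfunctor (x_recipe H n l' c' (c' + n)))
    (spi v) = spi w2 by rewrite /= (sfmapE vw1) (sfmapE w12).
rewrite !stable_compE; congr (spi _).
apply: chain_homP => i; apply: (cok_inj ex).
rewrite -/(ckp c (x_ob H l c (c + n) Y) i) /= -!compA v12 tE !compA w12 tE.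
rewrite -!compA; congr (_ ∘ _); rewrite v1E w1E.
exact: (ext_hom_nat kE).
Qed.

End CokernelsOfExtensions.

(** * Essential surjectivity of Theta *)

Section ThetaSurjective.
Variables (F : frobenius) (H : hulls F) (n : nat).
Let ex := frob_exact F.

Section LastProjective.
Variable E : chain F n.+1.
Hypothesis Eproj : projective (E ord_max).
Let En : (0 + n <= n.+1)%N. Proof. by []. Qed.
Let Y : chain F n := rst n 0 E.
Local Notation xp := (xpos n 0 (0 + n)).
Local Notation D := (x_ob H n.+1 0 (0 + n) Y).

(** [E^n] embeds both in its hull and in the projective-injective [E^(n+1)], and each embedding
    extends over the other. The round trips differ from identities only at the last position, by a
    map through a projective. *)
Lemma x_rst_last_projective :
  exists s : @hom (sMorm F n.+1) D E, is_iso s.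
Proof.
have En1 : clip n.+1 (0 + n).+1 = ord_max by apply: val_inj; rewrite /=; lia.
have [|f fE] := @ext_to F H n n.+1 0 En E Y (ch_id Y); first by [].
have hE : injective_ob (E (clip n.+1 (0 + n).+1)).
  by apply/proj_inj; rewrite En1.
have le1 : (clip n.+1 (0 + @ord_max n) <= clip n.+1 (0 + n).+1)%N by exact: clip_homo.
have [h hhE] := hE _ _ (xhull H Y) (tmap E le1) (xhull_infl H Y).
have [|g [gE _]] := @ext_from F H n n.+1 0 En Y E (ch_id Y) h.
  by move=> _ le; rewrite hhE compm1 (tmap_irrelevance E le le1).
exists (spi (g : @hom (Morm F n.+1) D E)).
exists (spi (f : @hom (Morm F n.+1) E D)); rewrite stable_compE; apply/spi_eq.
  apply: (ext_to_null En) => j i le J; have ej := xposI_ord J; subst j.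
  set j := clip n.+1 (0 + i) in le J *.
  suff : ext_map H Y le ∘ (f j ∘ g j - idm _) = 0 by [].
  have ge : ext_le (Inside i) (xp j) by exact/ext_le_refl/esym.
  have -> : g j = tmap E (leqnn _) ∘ (ch_id Y) i ∘ ext_map H Y le.
    by rewrite -(gE _ _ ge) -compA (ext_map_id H Y le ge) compm1.
  rewrite compBr compA (fE _ _ _ (leqnn _)) !tmap1 /= !comp1m !compm1.
  by rewrite subrr.
pose t : chain_hom E E := (g : @hom (Morm F n.+1) D E) ∘
  (f : @hom (Morm F n.+1) E D) - idm (E : Morm F n.+1).
have t0 (j : 'I_n.+2) : (j < n.+1)%N -> t j = 0.
  move=> jn; have J : xp j = Inside (Ordinal jn) by exact: xpos_inside.
  suff : g j ∘ f j - idm _ = 0 by [].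
  rewrite -[f j]comp1m.
  rewrite -(ext_map_id H Y (ext_le_refl J) (ext_le_refl (esym J))) !compA.
  rewrite (gE _ _ _ (xposI_ge _ J)) -!compA (fE _ _ _ (xposI_le J)) /= !comp1m.
  by rewrite (tmapM E _ _ (leqnn j)) tmap1 subrr.
have le2 : (@ord_max n.+1 <= clip n.+1 n.+1)%N by rewrite /=; lia.
apply: (@null_from F n.+1 E E t n.+1 _ (tmap E le2 ∘ t ord_max) (idm _)).
- by have -> : clip n.+1 n.+1 = ord_max by apply: val_inj; rewrite /=; lia.
- move=> i ic; split=> [|h']; first exact: t0.
  by rewrite -compA -(cm_nat t) t0 // !compm0.
- move=> i h1 h2 ic; rewrite compm1 -!compA -(cm_nat t) !compA.
  by rewrite (tmapM E _ _ (leq_trans le2 h1)) (tmapM E _ _ (leqnn i)) tmap1 comp1m.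
Qed.

End LastProjective.

Lemma xo_to_below (l a b : nat) (Y : chain F n) (j : 'I_l.+1) T
    (f : hom T (x_ob H l a b Y j)) : (j < a)%N -> f = 0.
Proof.
move=> ja; have J : xpos n a b j = Below n by rewrite /xpos ja.
rewrite -[f]comp1m.
have -> : idm (x_ob H l a b Y j) = 0; last by rewrite comp0m.
by rewrite -(ext_map_id H Y (ext_le_refl J) (ext_le_refl (esym J)))
    (ext_map_below _ _ _ J) compm0.
Qed.

Lemma cokernel_comp_iso (A B K K' : F) (i : hom A B) (p : hom B K) (w : hom K K') :
  is_cokernel i p -> is_iso w -> is_cokernel i (w ∘ p).
Proof.
move=> [pi0 u] [w' wK Kw]; split=> [|T f f0]; first by rewrite -compA pi0 compm0.
have [g [gE gu]] := u _ f f0.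
exists (g ∘ w'); split=> [|g' g'E].
  by rewrite -compA [w' ∘ _]compA wK comp1m.
by rewrite (gu (g' ∘ w)) -?compA ?Kw ?compm1 // compA.
Qed.

(* [E] is the chain K = E^0 -> .. -> E^(n+1) of the pullbacks of
   0 -> Z^0 -> .. -> Z^n = Z^n along P(Z^n) -> Z^n. *)
Lemma ck_surjective (Z : chain F n) : exists E : chain F n.+1,
  projective (E ord_max) /\
  exists G : chain_hom (ck_ob n 0 E) Z, forall k, is_iso (G k).
Proof.
pose V := x_ob H n.+1 1 (1 + n) Z.
(* [clip] truncates position [n.+2] to [n.+1], so [V'] repeats the last term of [V] and the
   pullbacks of all terms of [V] are taken along its cover. *)
pose V' : chain F n.+2 := reindex_ob n.+2 (fun i j (h : (i <= j)%N) => h) V.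
pose E := pl_ob H n.+1 0 n.+1 V'; exists E.
pose q (k : nat) : hom (pl H 0 n.+1 V' k) (V' (pl_pos n.+2 0 n.+1 k)) := pl1 H 0 n.+1 V' k.
have q0 (k : nat) T (f : hom T (V' (pl_pos n.+2 0 n.+1 k))) : (k < 1)%N -> f = 0.
  by move=> k0; apply: xo_to_below; rewrite /=; lia.
split.
  (* The last pullback is along an isomorphism, hence a copy of the cover. The positions [a] and [b]
     agree in value, and maps in both directions stand in for the equality. *)
  pose a := clip n.+1 (pl_pos n.+2 0 n.+1 (@ord_max n.+1)).
  pose b := clip n.+1 (pl_end n.+2 n.+1).
  have ba : (b <= a)%N by rewrite /=; lia.
  have ab : (a <= b)%N by rewrite /=; lia.
  have e : tmap V' (pl_le n.+2 0 n.+1 (@ord_max n.+1)) ∘ (tmap V ba ∘ pl_cov H n.+1 V') =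
      pl_cov H n.+1 V' ∘ idm _.
    rewrite compm1 compA [X in X ∘ _](_ : _ = idm _) ?comp1m //.
    by rewrite [LHS](tmapM V _ _ (leqnn b)) tmap1.
  apply: (@projective_retract _ _ _ (pl2 H 0 n.+1 V' (@ord_max n.+1))
    (pb_pair ex (pl_defl H n.+1 V') e)); last exact: pcover_proj.
  apply: pl_inj; rewrite compA compm1.
    rewrite [pl1 _ _ _ _ _ ∘ _]pb1_pair -compA -plE compA.
    rewrite [X in X ∘ _](_ : _ = idm _) ?comp1m //.
    by rewrite [LHS](tmapM V _ _ (leqnn a)) tmap1.
  by rewrite [pl2 _ _ _ _ _ ∘ _]pb2_pair comp1m.
have pk (k : 'I_n.+1) : xpos n 1 (1 + n)
    (clip n.+1 (pl_pos n.+2 0 n.+1 (clip n.+1 (1 + k)))) = Inside k.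
  by apply: xpos_inside; have := leq_ord k; rewrite /=; lia.
pose w (k : 'I_n.+1) : hom (V' (pl_pos n.+2 0 n.+1 (clip n.+1 (1 + k)))) (Z k) :=
  ext_map H Z (ext_le_refl (pk k)).
have wi (k : 'I_n.+1) : is_iso (w k).
  have ge := ext_le_refl (esym (pk k)); exists (ext_map H Z ge).
    exact: (ext_map_id H Z (ext_le_refl (pk k)) ge).
  exact: (ext_map_id H Z ge (ext_le_refl (pk k))).
have gn (i j : 'I_n.+1) (h : (i <= j)%N) :
    tmap Z h ∘ (w i ∘ q (clip n.+1 (1 + i))) =
    (w j ∘ q (clip n.+1 (1 + j))) ∘ tmap (rst n 1 E) h.
  rewrite -[RHS]compA [q _ ∘ _]pl1_map !compA; congr (_ ∘ _).
  have le : ext_le (xpos n 1 (1 + n)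
      (clip n.+1 (pl_pos n.+2 0 n.+1 (clip n.+1 (1 + i))))) (Inside j).
    by rewrite pk.
  apply: etrans (@ext_mapM _ H _ Z _ (Inside i) (Inside j) _ h le) (esym _).
  exact: (ext_mapM H Z).
have qE (k : 'I_n.+1) : q (clip n.+1 (1 + k)) ∘ tmap E (ck_le n.+1 0 k) = 0.
  by rewrite [LHS]pl1_map [pl1 _ _ _ _ _](q0 (clip n.+1 0)) ?compm0 //; rewrite /=; lia.
have [|G GE] := @ck_factor F n n.+1 0 E Z (@ChainHom _ _ (rst n 1 E) Z _ gn).
  by move=> k /=; rewrite -compA qE compm0.
exists G => k.
(* The projection [pl1] is a deflation whose kernel is [E^0], the pullback of the zero term of [V'];
   so it is also a cokernel of [E^0 -> E^(k+1)]. *)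
apply: (cokernel_iso (cok_coker ex (tmap_infl E (ck_le n.+1 0 k))) _ (GE k)).
apply: cokernel_comp_iso (wi k); apply: (conf_coker ex).
apply: (kernel_conf ex); first exact: pb1_defl.
split=> [|T f f0]; first exact: qE.
have e : tmap V' (pl_le n.+2 0 n.+1 (clip n.+1 0)) ∘ 0 =
    pl_cov H n.+1 V' ∘ (pl2 H 0 n.+1 V' (clip n.+1 (1 + k)) ∘ f).
  by rewrite compm0 compA -plE -compA f0 compm0.
have q2E : pl2 H 0 n.+1 V' (clip n.+1 (1 + k)) ∘ tmap E (ck_le n.+1 0 k) =
    pl2 H 0 n.+1 V' (clip n.+1 0) by exact: pl2_map.
exists (pb_pair ex (pl_defl H n.+1 V') e); split=> [|f' f'E].
  apply: pl_inj; rewrite compA; first by rewrite -/(q _) qE comp0m f0.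
  by rewrite q2E; exact: pb2_pair.
apply: (inflation_mono ex (tmap_infl E (ck_le n.+1 0 k))); rewrite f'E.
apply: pl_inj; rewrite compA; first by rewrite -/(q _) qE comp0m f0.
by rewrite q2E; exact: pb2_pair.
Qed.

Lemma Theta_surjective (Z : sMorm F n) :
  exists Y (s : hom (Theta H n Y) Z), is_iso s.
Proof.
have [E [Eproj [G Gi]]] := ck_surjective Z.
have [s si] := x_rst_last_projective Eproj.
exists (rst n 0 E), (@mcomp (sMorm F n) _ _ _ (spi (G : @hom (Morm F n) _ _))
  (fmap (sfunctor (ck_recipe F n.+1 n 0)) s)).
apply: is_iso_comp; last exact: (fmap_iso (sfunctor (ck_recipe F n.+1 n 0)) si).
exact/spi_iso/chain_iso.
Qed.

End ThetaSurjective.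

(** * The chain of adjunctions *)

Lemma unit_natiso (C D : precat) (F : functor C D) (G : functor D C) :
  F ⊣ G -> fully_faithful F -> natiso (G ⊙ F) (idF C).
Proof.
move=> FG Ff; apply: (@right_adjoint_unique _ _ (idF C)); last exact: adjoint_id.
by apply: adjoint_cancel => [|A B]; [exact: FG | exact: Ff].
Qed.

Section Adjunctions.
Variables (F : frobenius) (H : hulls F) (l n : nat).

Lemma hat_gamma_adjoint (a : nat) : (a + n <= l)%N ->
  hat_gamma F l n a (a + n) ⊣ delta_c H n l a (a + n).
Proof.
case: a => [|a] anl; last exact: ck_adjoint_x.
apply: (restriction_adjoint_x H anl) => // i.
by rewrite /omit_pos !add0n ltn_ord.
Qed.

Lemma check_gamma_adjoint (a : nat) : (a + n <= l)%N ->
  delta_c H n l a (a + n) ⊣ check_gamma H l n a (a + n).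
Proof.
move=> anl; rewrite /check_gamma; case: ltnP => h; first exact: x_adjoint_pl.
apply: (x_adjoint_restriction H anl) => [i|]; last by apply/eqP; rewrite eqn_leq anl h.
by rewrite /omit_pos ltn0 addnC.
Qed.

Lemma gamma_delta_adjoint (k m : nat) : l = (m + n).+1 -> (k <= n)%N ->
  gamma l n k (k + m) ⊣ delta (F := F) n l k (k + m.+1).
Proof.
move=> lE kn; rewrite /gamma /delta; apply: reindex_adjoint => i /=;
  have := ltn_ord i; rewrite /omit_pos /repeat_pos;
  by do !case: ifP => //=; lia.
Qed.

Lemma delta_gamma_adjoint (k m : nat) : l = (m + n).+1 -> (k <= n)%N ->
  delta (F := F) n l k (k + m.+1) ⊣ gamma l n k.+1 (k.+1 + m).
Proof.
move=> lE kn; rewrite /gamma /delta; apply: reindex_adjoint => i /=;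
  have := ltn_ord i; rewrite /omit_pos /repeat_pos;
  by do !case: ifP => //=; lia.
Qed.

End Adjunctions.

Section ThetaPowers.
Variables (F : frobenius) (H : hulls F) (n : nat).
Local Notation T := (Theta H n).
Local Notation T' := (Theta_inv H n).
Local Notation P := (Theta_pow H n).

(** Both functors are composites through chains of length [n.+1], and the factors of one are adjoint
    to those of the other in reverse order. *)
Lemma Theta_adjoint : T ⊣ T'.
Proof.
apply: adjoint_comp; first by apply: (@check_gamma_adjoint F H n.+1 n 0).
exact: (@hat_gamma_adjoint F H n.+1 n 1).
Qed.

Lemma Theta_fully_faithful : fully_faithful T.
Proof.
apply: fully_faithful_comp; first by move=> A B; apply: (@ck_bij F H n n.+1 0).
exact: (@x_fully_faithful F H n n.+1 0).
Qed.

Lemma Theta_counit : natiso (T ⊙ T') (idF _).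
Proof.
apply: counit_natiso Theta_adjoint Theta_fully_faithful _.
exact: Theta_surjective.
Qed.

Lemma Theta_unit : natiso (T' ⊙ T) (idF _).
Proof. exact: unit_natiso Theta_adjoint Theta_fully_faithful. Qed.

Lemma Theta_inv_adjoint : T' ⊣ T.
Proof. exact: adjoint_equivalence Theta_fully_faithful Theta_counit. Qed.

Lemma Theta_powS (z : int) : natiso (T ⊙ P z) (P (z + 1)).
Proof.
case: z => k.
  by have -> : Posz k + 1 = k.+1%:Z by [lia]; exact: natiso_refl.
have -> : Negz k + 1 = - k%:Z :> int by rewrite NegzE; lia.
have e : natiso (T ⊙ (T' ⊙ powF T' k)) (powF T' k).
  exact: natiso_cancel Theta_counit.
(* At [k = 0] the exponent is [Posz 0] and not a [Negz]; its power is the same identity functor. *)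
by case: k e.
Qed.

Lemma Theta_powP (z : int) : natiso (T' ⊙ P z) (P (z - 1)).
Proof.
apply: (@natiso_trans _ _ (T' ⊙ (T ⊙ P (z - 1)))).
  apply/natiso_whisker_l/natiso_sym; have := Theta_powS (z - 1).
  by rewrite subrK.
exact: natiso_cancel Theta_unit.
Qed.

Lemma Theta_powD (x y : int) : natiso (P x ⊙ P y) (P (x + y)).
Proof.
elim/int_ind: x => [|k IH|k IH].
- by rewrite add0r; exact: natiso_refl.
- have -> : k.+1%:Z = k%:Z + 1 by lia.
  apply: (@natiso_trans _ _ (T ⊙ (P k ⊙ P y))).
    apply/natiso_sym/natiso_assoc_l.
    exact: natiso_whisker_r (Theta_powS k).
  apply: (@natiso_trans _ _ (T ⊙ P (k%:Z + y))); first exact: natiso_whisker_l.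
  by rewrite addrAC; exact: Theta_powS.
- have -> : - k.+1%:Z = - k%:Z - 1 by lia.
  apply: (@natiso_trans _ _ (T' ⊙ (P (- k%:Z) ⊙ P y))).
    apply/natiso_sym/natiso_assoc_l.
    exact: natiso_whisker_r (Theta_powP _).
  apply: (@natiso_trans _ _ (T' ⊙ P (- k%:Z + y))); first exact: natiso_whisker_l.
  by rewrite addrAC; exact: Theta_powP.
Qed.

Lemma Theta_pow_adjoint (z : int) : P z ⊣ P (- z).
Proof.
elim/int_ind: z => [|k IH|k IH].
- exact: adjoint_id.
- have -> : k.+1%:Z = k%:Z + 1 by lia.
  apply: adjoint_natiso_l (Theta_powS k) _; rewrite opprD.
  apply: adjoint_natiso_r (Theta_powD _ _) _.
  exact: (adjoint_comp IH Theta_adjoint).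
- have -> : - k.+1%:Z = - k%:Z - 1 by lia.
  apply: adjoint_natiso_l (Theta_powP _) _; rewrite opprD.
  apply: adjoint_natiso_r (Theta_powD _ _) _.
  rewrite !opprK in IH *; exact: (adjoint_comp IH Theta_inv_adjoint).
Qed.

Lemma Theta_pow_adjointN (z : int) : P (- z) ⊣ P z.
Proof. by have := Theta_pow_adjoint (- z); rewrite opprK. Qed.

End ThetaPowers.

(** * Adjunctions between neighbouring intervals *)

Section ShiftedAdjunctions.
Variables (F : frobenius) (H : hulls F) (l n a : nat).
Hypothesis anl : (a + n < l)%N.
Local Notation D := (delta_c H n l a (a + n)).
Local Notation D1 := (delta_c H n l a.+1 (a.+1 + n)).
Local Notation G1 := (hat_gamma F l n a.+1 (a.+1 + n)).
Local Notation C := (check_gamma H l n a (a + n)).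

Lemma delta_Theta_inv_hat : D ⊣ Theta_inv H n ⊙ G1.
Proof.
apply: adjoint_cancel; last by move=> A B; apply: ck_bij.
apply: adjoint_natiso_l (Theta_adjoint H n).
exact: (@ck_x_natiso F H n n.+1 0 l a).
Qed.

(** Precomposing with [Theta_inv] puts [Theta] in front of the right adjoint, where it cancels
    against [Theta_inv]. *)
Lemma delta_Theta_inv_adjoint : D ⊙ Theta_inv H n ⊣ G1.
Proof.
have h := adjoint_comp (Theta_inv_adjoint H n) delta_Theta_inv_hat.
apply: adjoint_natiso_r h.
exact: natiso_cancel (Theta_counit H n).
Qed.

Lemma check_gamma_left_adjoint : C ⊣ D1 ⊙ Theta H n.
Proof.
apply: (@adjoint_natiso_l _ _ (Theta_inv H n ⊙ G1)).
  apply: right_adjoint_unique delta_Theta_inv_hat _.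
  exact/check_gamma_adjoint/ltnW.
by apply: adjoint_comp; [exact: hat_gamma_adjoint | exact: Theta_inv_adjoint].
Qed.

End ShiftedAdjunctions.

Section Chain.
Variables (F : frobenius) (H : hulls F) (l m n : nat).
Hypothesis lE : l = (m + n).+1.
Local Notation M := (sMorm F).
Local Notation P := (Theta_pow H n).

Lemma hatF_adjoint (j : nat) : (j <= m.+1)%N -> hatF H l m n j ⊣ hatG H l m n j.
Proof.
move=> jm; rewrite /hatF /hatG.
have -> : (l - j = m.+1 - j + n)%N by lia.
apply: adjoint_comp; last exact: Theta_pow_adjoint.
by apply: hat_gamma_adjoint; lia.
Qed.

Lemma hatG_adjoint (j : nat) : (j < m.+1)%N -> hatG H l m n j.+1 ⊣ hatF H l m n j.
Proof.
move=> jm; rewrite /hatF /hatG.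
have -> : (m.+1 - j = (m - j).+1)%N by lia.
have -> : (l - j = (m - j).+1 + n)%N by lia.
have -> : (m.+1 - j.+1 = m - j)%N by lia.
have -> : (l - j.+1 = m - j + n)%N by lia.
have anl : (m - j + n < l)%N by lia.
have -> : P (- j.+1%:Z) = Theta_inv H n ⊙ P (- j%:Z) by case: (j).
apply: adjoint_assoc_l.
exact: adjoint_comp (Theta_pow_adjointN H n j) (delta_Theta_inv_adjoint H anl).
Qed.

Lemma hatG0_adjoint : hatG H l m n 0 ⊣ gamma l n 0 m.
Proof.
have h := @check_gamma_adjoint F H l n m.+1.
rewrite (_ : (m.+1 + n)%N = l) ?lE // /check_gamma ltnn in h.
rewrite /hatG /gamma !subn0 lE; exact: h.
Qed.

Lemma checkF_adjoint (k : nat) : (k <= m.+1)%N -> checkF H l n k ⊣ checkG H l n k.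
Proof.
move=> km; apply: adjoint_comp; first exact: Theta_pow_adjoint.
by apply: check_gamma_adjoint; lia.
Qed.

Lemma checkG_adjoint (k : nat) : (k < m.+1)%N -> checkG H l n k ⊣ checkF H l n k.+1.
Proof.
move=> km; have knl : (k + n < l)%N by lia.
rewrite /checkF (_ : P k.+1 = Theta H n ⊙ P k) //; apply: adjoint_assoc_r.
exact: adjoint_comp (check_gamma_left_adjoint H knl) (Theta_pow_adjointN H n k).
Qed.

Lemma gamma_last_adjoint : gamma l n n.+1 l ⊣ checkF H l n 0.
Proof.
by have h := @hat_gamma_adjoint F H l n 0; apply: h; lia.
Qed.

Lemma adjunction_chain_intro (U : functor (M l) (M n) -> functor (M l) (M n))
    (V : functor (M n) (M l) -> functor (M n) (M l)) :
  (forall G D, G ⊣ D -> U G ⊣ V D) -> (forall D G, D ⊣ G -> V D ⊣ U G) ->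
  adjunction_chain H l m n U V.
Proof.
move=> UV VU; split.
- by split=> j jm; [apply/UV/hatF_adjoint | apply/VU/hatG_adjoint].
- exact/VU/hatG0_adjoint.
- by move=> k kn; split; [apply/UV/gamma_delta_adjoint | apply/VU/delta_gamma_adjoint].
- exact/UV/gamma_last_adjoint.
- by split=> k km; [apply/VU/checkF_adjoint | apply/UV/checkG_adjoint].
Qed.

End Chain.

Theorem theorem4 (F : frobenius) (H : hulls F) (l s t : nat)
    (hst : (s <= t)%N) (htl : (t <= l)%N) (htsl : (t - s < l)%N) :
  let m := (t - s)%N in
  let n := (l - t + s - 1)%N in
  [/\ adjunction_chain H l m n id id,
      hat_gamma F l n 0 n = gamma l n (l - t + s) l,
      check_gamma H l n m.+1 l = gamma l n 0 m
    & let U (r : int) (G : functor (sMorm F l) (sMorm F n)) :=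
        Theta_pow H n (- (r * m.+1%:Z)) ⊙ G in
      let V (r : int) (D : functor (sMorm F n) (sMorm F l)) :=
        D ⊙ Theta_pow H n (r * m.+1%:Z) in
      forall r : int,
        [/\ adjunction_chain H l m n (U r) (V r),
            V (r - 1) (delta n l n (n + m.+1)) ⊣ U r (hatF H l m n m.+1)
          & U r (checkG H l n m.+1) ⊣ V (r + 1) (delta n l 0 m.+1)]].
Proof.
move=> m n; have lE : l = (m + n).+1 by rewrite /m /n; lia.
have nE : (l - t + s = n.+1)%N by rewrite /n; lia.
rewrite nE; clearbody m n; clear hst htl htsl s t nE.
have hE : hat_gamma F l n 0 n = gamma l n n.+1 l by rewrite /gamma subSS.
have cE : check_gamma H l n m.+1 l = gamma l n 0 m.
  by rewrite /check_gamma ltnn /gamma subn0.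
split=> //; first exact: adjunction_chain_intro.
move=> U V r.
(* Opposite powers of [Theta] are adjoint on either side, so the twist by [U] and [V] preserves
   adjunctions in both directions. *)
have UV z G D : G ⊣ D -> U z G ⊣ V z D.
  by move=> GD; exact: adjoint_comp GD (Theta_pow_adjointN H n _).
have VU z D G : D ⊣ G -> V z D ⊣ U z G.
  by move=> DG; exact: adjoint_comp (Theta_pow_adjoint H n _) DG.
split; first exact: adjunction_chain_intro (@UV r) (@VU r).
(* [hatF] at [m.+1] is [Theta] to the power [m.+1] after the last gamma, so [U r] of it is
   [U (r - 1)] of that gamma: the left end of copy [r] follows the last delta of copy [r - 1]. *)
- apply: (@adjoint_natiso_r _ _ _ (U (r - 1) (gamma l n n.+1 l))).
    rewrite /hatF subnn (_ : (l - m.+1 = n)%N) ?hE; last by rewrite lE; lia.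
    apply: natiso_sym; apply: natiso_assoc_l.
    apply: (natiso_whisker_r (gamma l n n.+1 l)).
    have -> : - ((r - 1) * m.+1%:Z) = - (r * m.+1%:Z) + m.+1%:Z.
      by rewrite mulrBl mul1r opprB addrC.
    exact: Theta_powD.
  apply: VU; have := @delta_gamma_adjoint F l n n m lE (leqnn n).
  by rewrite (_ : (n.+1 + m)%N = l) // lE; lia.
(* Symmetrically, [U r] of [checkG] at [m.+1] is [U (r + 1)] of the first gamma, which precedes the
   first delta of copy [r + 1]. *)
- apply: (@adjoint_natiso_l _ _ (U (r + 1) (gamma l n 0 m))).
    rewrite /checkG (_ : (m.+1 + n)%N = l) ?cE; last by rewrite lE.
    apply: natiso_sym; apply: natiso_assoc_l.
    apply: (natiso_whisker_r (gamma l n 0 m)).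
    have -> : - ((r + 1) * m.+1%:Z) = - (r * m.+1%:Z) - m.+1%:Z.
      by rewrite mulrDl mul1r opprD.
    exact: Theta_powD.
  by apply: UV; exact: (@gamma_delta_adjoint F l n 0 m lE (leq0n n)).
Qed.
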